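(* Let $\Lambda=\{\lambda_n,\mu_n\}_{n=1}^{\infty}$ belong to the class $ABC$ and let $-\infty<\gamma<\beta<\infty$. For $n\in\mathbb{N}$ and $k=0,\dots,\mu_n-1$ let $e_{n,k}(x)=x^ke^{\lambda_nx}$, $E_{\Lambda_{n,k}}=E_\Lambda\setminus\{e_{n,k}\}$, and \[ D_{\gamma,\beta,n,k}=\inf_{g\in\overline{\mathrm{span}}(E_{\Lambda_{n,k}})}\|e_{n,k}-g\|_{C[\gamma,\beta]}, \] the closed span being taken in $C[\gamma,\beta]$ with the supremum norm. Then for every $\epsilon>0$ there is $u_\epsilon>0$, independent of $n$ and $k$ (depending on $\Lambda$ and $\beta-\gamma$), such that $D_{\gamma,\beta,n,k}\ge u_\epsilon e^{(\beta-\epsilon)\Re\lambda_n}$ for all $n\in\mathbb{N}$, $k=0,\dots,\mu_n-1$.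
   Context: A multiplicity sequence $\Lambda=\{\lambda_n,\mu_n\}_{n=1}^\infty$ consists of distinct nonzero complex numbers $\lambda_n$ with $|\lambda_n|\to\infty$, $|\lambda_n|\le|\lambda_{n+1}|$, and positive integers $\mu_n$. $A^0_{|z|}$ is the space of entire functions $F$ with: for every $\epsilon>0$ there is $M_\epsilon$ with $|F(z)|\le M_\epsilon e^{\epsilon|z|}$ on $\mathbb{C}$. $\Lambda$ is an interpolating variety for $A^0_{|z|}$ if for every doubly indexed complex sequence $(a_{n,k})_{n\in\mathbb{N},0\le k\le\mu_n-1}$ with $\sup_n\sum_{k}|a_{n,k}|e^{-\epsilon|\lambda_n|}<\infty$ for every $\epsilon>0$ there is $f\in A^0_{|z|}$ with $f^{(k)}(\lambda_n)/k!=a_{n,k}$ for all $n,k$. $\Lambda\in ABC$ means: (A) $\sum_n\mu_n/|\lambda_n|<\infty$; (B) $\sup_n|\arg\lambda_n|<\pi/2$; (C) $\Lambda$ is an interpolating variety for $A^0_{|z|}$. $E_\Lambda=\{x^ke^{\lambda_n x}:n\in\mathbb{N},\ 0\le k\le\mu_n-1\}$; $C[\gamma,\beta]$ is the space of complex continuous functions on $[\gamma,\beta]$.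
   Formalization: The constant u_ε is independent of n and k but may depend on γ and β themselves, not only on β−γ; dependence on β−γ alone fails when some μ_n≥2 (k=0, β→∞: subtract x e^{λ_n x}/β), and follows by translation when all μ_n=1. *)

(* Defs.v *)
From Stdlib Require Import Reals Factorial.
From Coquelicot Require Import Coquelicot.
Open Scope R_scope.

Definition cexp (w : C) : C :=
  (exp (Re w) * cos (Im w), exp (Re w) * sin (Im w)).

(* Principal argument Arg z in (-pi, pi] (atan2 convention), for z <> 0. *)
Definition carg (z : C) : R :=
  if Rlt_dec 0 (Re z) then atan (Im z / Re z)
  else if Rlt_dec (Re z) 0 then
    (if Rle_dec 0 (Im z) then atan (Im z / Re z) + PI else atan (Im z / Re z) - PI)
  else (if Rle_dec 0 (Im z) then PI / 2 else - (PI / 2)).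

Definition cderiv (f : C -> C) (z l : C) : Prop :=
  @is_derive C_AbsRing C_NormedModule f z l.

Definition entire_with_derivs (F : C -> C) (df : nat -> C -> C) : Prop :=
  df 0%nat = F /\ forall (j : nat) (z : C), cderiv (df j) z (df (S j) z).

Definition in_A0 (F : C -> C) : Prop :=
  forall eps : R, 0 < eps -> exists M : R, forall z : C, Cmod (F z) <= M * exp (eps * Cmod z).

(* Multiplicity sequence, indexed from n = 0 (instead of 1). *)
Definition multiplicity_sequence (lam : nat -> C) (mu : nat -> nat) : Prop :=
  (forall n m, n <> m -> lam n <> lam m) /\
  (forall n, lam n <> 0%C) /\
  is_lim_seq (fun n => Cmod (lam n)) p_infty /\
  (forall n, Cmod (lam n) <= Cmod (lam (S n))) /\
  (forall n, (1 <= mu n)%nat).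

Definition interpolating_variety (lam : nat -> C) (mu : nat -> nat) : Prop :=
  forall a : nat -> nat -> C,
    (forall eps : R, 0 < eps -> exists M : R, forall n : nat,
        sum_n (fun k => Cmod (a n k)) (pred (mu n)) * exp (- eps * Cmod (lam n)) <= M) ->
    exists (f : C -> C) (df : nat -> C -> C),
      entire_with_derivs f df /\ in_A0 f /\
      forall n k, (k < mu n)%nat -> Cmult (df k (lam n)) (/ INR (fact k), 0) = a n k.

Definition in_ABC (lam : nat -> C) (mu : nat -> nat) : Prop :=
  multiplicity_sequence lam mu /\
  ex_series (fun n => INR (mu n) / Cmod (lam n)) /\
  (exists theta : R, theta < PI / 2 /\ forall n, Rabs (carg (lam n)) <= theta) /\
  interpolating_variety lam mu.

Definition e_fun (lam : nat -> C) (n k : nat) (x : R) : C :=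
  Cmult (x ^ k, 0) (cexp (Cmult (x, 0) (lam n))).

Definition supnorm (gam bet : R) (f : R -> C) : Rbar :=
  Lub_Rbar (fun r => exists x, gam <= x <= bet /\ r = Cmod (f x)).

Definition in_span_without (lam : nat -> C) (mu : nat -> nat) (n k : nat) (h : R -> C) : Prop :=
  exists (N : nat) (c : nat -> nat -> C),
    c n k = 0%C /\
    forall x : R,
      h x = sum_n (fun m => sum_n (fun j => Cmult (c m j) (e_fun lam m j x)) (pred (mu m))) N.

Definition in_closed_span_without (gam bet : R) (lam : nat -> C) (mu : nat -> nat)
    (n k : nat) (g : R -> C) : Prop :=
  forall delta : R, 0 < delta -> exists h : R -> C,
    in_span_without lam mu n k h /\
    Rbar_lt (supnorm gam bet (fun x => Cminus (g x) (h x))) delta.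

Definition D_dist (gam bet : R) (lam : nat -> C) (mu : nat -> nat) (n k : nat) : Rbar :=
  Glb_Rbar (fun r => exists g : R -> C,
     in_closed_span_without gam bet lam mu n k g /\
     supnorm gam bet (fun x => Cminus (e_fun lam n k x) (g x)) = Finite r).

(* Main.v *)
Require Import Defs.
From Stdlib Require Import Reals Factorial Lra Lia Psatz List Compare_dec Classical ClassicalEpsilon.
From Coquelicot Require Import Coquelicot.
Open Scope R_scope.
Import ListNotations.

(** Write X = |lam_n| + A.  A coefficient c_{n,k} of a finite sum
    P(x) = sum c_{m,j} x^j exp(lam_m x) is isolated by a product T of difference operators,
    polynomials in translations E_b, which kills every exponent m <> n.  If |lam_m| <= K1 X
    the factor is E_b - exp(b lam_m) with b of order 1/X; there are only o(X) such factors, so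
    their norms contribute exp(o(X)).  If |lam_m| > K1 X the factor is
    ((1+E)/2)^2 (VE-1)(V-E)/(V-1)^2 with b of order 1/|lam_m| and V = exp(b lam_m): it is an l^2
    contraction, and the total translation is small because sum mu_m/|lam_m| < oo.  All b are
    dyadic multiples of one step, so everything takes place on a lattice in [bet - 2 del, bet].
    On polynomials times exp(lam_n x) the operator T is bounded below by exp(-eps X).  This
    needs sum_{m near n} mu_m ln(|lam_n|/|lam_m - lam_n|) <= eps |lam_n| + C, and that is what
    interpolation provides: along a lacunary sequence of violators one would find f in A^0 with
    f^(mu_n - 1)(lam_n)/(mu_n - 1)! = 1 vanishing at all the neighbours, and dividing f by its zeros and
    applying the maximum principle contradicts the growth of f. *)

(** * Taylor expansions of entire functions *)

(** The number of far exponents is not bounded in terms of n, so a far factor may lose nothing in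
    norm: estimating by the absolute values of its coefficients would cost a constant factor each.
    This forces l^2 on a periodic lattice. The periodic extension spoils only the last samples, as
    many as the width of T. By averaging, some arithmetic progression of mu_n points carries small
    values of the polynomial part of T P, and Newton interpolation recovers its coefficients at the
    price exp(O(mu_n)).

    The lower bound for T uses the norm sum |a_i| t^i, in which a translation by b differs from the
    identity by at most (1 + b/t)^d - 1. This must be small against b |lam_n - lam_m|, so t has to
    exceed mu_n / |lam_n - lam_m| by a constant factor, while t^(mu_n) must stay exp(o(X)). Crowding
    is therefore needed twice: summed over m with weights mu_m, and for each single m with weight
    mu_n; the second form comes from the crowding around lam_m instead of lam_n.

    Condition (B) makes |lam_n| and Re lam_n comparable. It makes the far multipliers V large and
    turns the loss exp(eps |lam_n|) into one in Re lam_n. *)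

Definition cdiff (f : C -> C) (z l : C) : Prop :=
  forall eps, 0 < eps -> exists d, 0 < d /\ forall y, Cmod (y - z) < d ->
    Cmod (f y - f z - (y - z) * l) <= eps * Cmod (y - z).

Lemma cderiv_cdiff f z l : cderiv f z l -> cdiff f z l.
Proof.
  intros [_ H] eps He.
  specialize (H z (fun P HP => HP) (mkposreal eps He)); simpl in H.
  destruct H as [d Hd].
  exists d; split; [apply cond_pos|]. intros y Hy.
  assert (B : ball (M := AbsRing_UniformSpace C_AbsRing) z d y) by exact Hy.
  specialize (Hd y B).
  exact Hd.
Qed.

Lemma Cmod_minus_sym x y : Cmod (x - y) = Cmod (y - x).
Proof. rewrite <- Cmod_opp. f_equal. ring. Qed.

Lemma Cmod_triangle_minus x y : Cmod (x - y) <= Cmod x + Cmod y.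
Proof. unfold Cminus. rewrite <- (Cmod_opp y). apply Cmod_triangle. Qed.

Lemma Cmod_triangle_rev x y : Cmod x - Cmod y <= Cmod (x + y).
Proof.
  pose proof (Cmod_triangle (x + y) (- y)) as H.
  rewrite Cmod_opp in H. replace (x + y + - y)%C with x in H by ring. lra.
Qed.

Lemma Cmod_triangle3 x y z : Cmod (x - z) <= Cmod (x - y) + Cmod (y - z).
Proof. replace (x - z)%C with ((x - y) + (y - z))%C by ring. apply Cmod_triangle. Qed.

Lemma cdiff_plus f g z l m :
  cdiff f z l -> cdiff g z m -> cdiff (fun y => f y + g y)%C z (l + m)%C.
Proof.
  intros Hf Hg eps He.
  destruct (Hf (eps / 2)) as [d1 [D1 H1]]; [lra|].
  destruct (Hg (eps / 2)) as [d2 [D2 H2]]; [lra|].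
  exists (Rmin d1 d2); split; [now apply Rmin_glb_lt|]. intros y Hy.
  specialize (H1 y (Rlt_le_trans _ _ _ Hy (Rmin_l _ _))).
  specialize (H2 y (Rlt_le_trans _ _ _ Hy (Rmin_r _ _))).
  replace (f y + g y - (f z + g z) - (y - z) * (l + m))%C
    with ((f y - f z - (y - z) * l) + (g y - g z - (y - z) * m))%C by ring.
  eapply Rle_trans; [apply Cmod_triangle|]. lra.
Qed.

Lemma cdiff_scal f z l a : cdiff f z l -> cdiff (fun y => a * f y)%C z (a * l)%C.
Proof.
  intros Hf eps He. pose proof (Cmod_ge_0 a) as Ha.
  destruct (Hf (eps / (Cmod a + 1))) as [d [D H]].
  { apply Rdiv_lt_0_compat; lra. }
  exists d; split; [exact D|]. intros y Hy. specialize (H y Hy).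
  replace (a * f y - a * f z - (y - z) * (a * l))%C
    with (a * (f y - f z - (y - z) * l))%C by ring.
  rewrite Cmod_mult.
  eapply Rle_trans; [apply Rmult_le_compat_l; [exact Ha|exact H]|].
  pose proof (Cmod_ge_0 (y - z)).
  assert (Cmod a * (eps / (Cmod a + 1)) <= eps).
  { apply (Rmult_le_reg_r (Cmod a + 1)); [lra|]. field_simplify; nra. }
  nra.
Qed.

Lemma cdiff_mulX g w z l :
  cdiff g z l -> cdiff (fun y => (y - w) * g y)%C z (g z + (z - w) * l)%C.
Proof.
  intros Hg eps He.
  pose proof (Cmod_ge_0 (z - w)) as H0. pose proof (Cmod_ge_0 l) as H1.
  set (B := Cmod (z - w) + 1).
  destruct (Hg (eps / (2 * B))) as [d [D H]].
  { apply Rdiv_lt_0_compat; unfold B; lra. }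
  set (d' := eps / (2 * (Cmod l + 1))).
  assert (Hd' : 0 < d') by (apply Rdiv_lt_0_compat; lra).
  exists (Rmin 1 (Rmin d d')); split.
  { repeat apply Rmin_glb_lt; lra. }
  intros y Hy.
  pose proof (Rmin_l 1 (Rmin d d')). pose proof (Rmin_r 1 (Rmin d d')).
  pose proof (Rmin_l d d'). pose proof (Rmin_r d d').
  specialize (H y ltac:(lra)). pose proof (Cmod_ge_0 (y - z)) as Hyz.
  replace ((y - w) * g y - (z - w) * g z - (y - z) * (g z + (z - w) * l))%C
    with (((z - w) + (y - z)) * (g y - g z - (y - z) * l) + (y - z) * ((y - z) * l))%C by ring.
  eapply Rle_trans; [apply Cmod_triangle|]. rewrite !Cmod_mult.
  assert (E1 : Cmod (z - w + (y - z)) <= B).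
  { eapply Rle_trans; [apply Cmod_triangle|]. unfold B; lra. }
  assert (E2 : Cmod (z - w + (y - z)) * Cmod (g y - g z - (y - z) * l)
               <= B * (eps / (2 * B) * Cmod (y - z))).
  { apply Rmult_le_compat; auto using Cmod_ge_0. }
  replace (B * (eps / (2 * B) * Cmod (y - z))) with (eps / 2 * Cmod (y - z)) in E2
    by (field; unfold B; lra).
  assert (E3 : Cmod (y - z) * Cmod l <= eps / 2).
  { apply Rle_trans with (d' * Cmod l); [apply Rmult_le_compat_r; lra|].
    unfold d'. apply (Rmult_le_reg_r (2 * (Cmod l + 1))); [lra|]. field_simplify; nra. }
  nra.
Qed.

Lemma cdiff_const (c z : C) : cdiff (fun _ => c) z 0%C.
Proof.
  intros eps He. exists 1; split; [lra|]. intros y _.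
  replace (c - c - (y - z) * 0)%C with (RtoC 0) by ring. rewrite Cmod_0.
  pose proof (Cmod_ge_0 (y - z)); nra.
Qed.

Lemma cdiff_ext f g z l m : (forall y, f y = g y) -> l = m -> cdiff f z l -> cdiff g z m.
Proof.
  intros E E' H eps He. destruct (H eps He) as [d [D Hd]].
  exists d; split; [exact D|]. intros y Hy. rewrite <- !E, <- E'. auto.
Qed.

Lemma cdiff_monomial w z k :
  cdiff (fun y => (y - w) ^ (S k))%C z (INR (S k) * (z - w) ^ k)%C.
Proof.
  induction k as [|k IH].
  - apply (cdiff_ext (fun y => (y - w) * 1)%C _ z (1 + (z - w) * 0)%C).
    + intro y. simpl. ring.
    + simpl. ring.
    + apply (cdiff_mulX (fun _ => 1%C)), cdiff_const.
  - eapply cdiff_ext; [| |apply (cdiff_mulX _ w z _ IH)].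
    + intro y. reflexivity.
    + rewrite (S_INR (S k)), RtoC_plus. simpl Cpow. ring.
Qed.

Lemma cdiff_continuous f z l : cdiff f z l ->
  forall eps, 0 < eps -> exists d, 0 < d /\ forall y, Cmod (y - z) < d -> Cmod (f y - f z) < eps.
Proof.
  intros H eps He. destruct (H 1 Rlt_0_1) as [d [D Hd]].
  pose proof (Cmod_ge_0 l).
  exists (Rmin d (eps / (Cmod l + 2))). split.
  { apply Rmin_glb_lt; [lra|]. apply Rdiv_lt_0_compat; lra. }
  intros y Hy.
  pose proof (Rmin_l d (eps / (Cmod l + 2))). pose proof (Rmin_r d (eps / (Cmod l + 2))).
  specialize (Hd y ltac:(lra)).
  replace (f y - f z)%C with ((f y - f z - (y - z) * l) + (y - z) * l)%C by ring.
  eapply Rle_lt_trans; [apply Cmod_triangle|]. rewrite Cmod_mult.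
  pose proof (Cmod_ge_0 (y - z)).
  apply Rle_lt_trans with (Cmod (y - z) * (Cmod l + 1)); [nra|].
  apply Rle_lt_trans with (eps / (Cmod l + 2) * (Cmod l + 1)).
  { apply Rmult_le_compat_r; lra. }
  apply (Rmult_lt_reg_r (Cmod l + 2)); [lra|]. field_simplify; nra.
Qed.

Lemma Re_mult_le x y : Re (x * y)%C <= Cmod x * Cmod y.
Proof.
  rewrite <- Cmod_mult. eapply Rle_trans; [apply Rle_abs|]. apply re_le_Cmod.
Qed.

(** Pairing F with the conjugate of F z - F w and taking real parts along the segment gives a real
    function whose increment on [0, 1] is |F z - F w|^2. The real mean value theorem applies to it,
    and one factor cancels. *)
Lemma mean_value_ineq F F' w z M :
  (forall y, cdiff F y (F' y)) ->
  (forall t, 0 <= t <= 1 -> Cmod (F' (w + t * (z - w))%C) <= M) ->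
  Cmod (F z - F w) <= M * Cmod (z - w).
Proof.
  intros HF HM.
  set (om := Cconj (F z - F w)).
  set (phi := fun t : R => Re (om * F (w + t * (z - w)))%C).
  set (dphi := fun t : R => Re (om * ((z - w) * F' (w + t * (z - w))))%C).
  pose proof (Cmod_ge_0 (z - w)) as Hzw. pose proof (Cmod_ge_0 om) as Hom.
  assert (Hd : forall t, derivable_pt_lim phi t (dphi t)).
  { intros t eps He.
    set (y := (w + t * (z - w))%C).
    set (B := (Cmod om + 1) * (Cmod (z - w) + 1)).
    assert (HB : 0 < B) by (unfold B; nra).
    destruct (HF y (eps / (2 * B))) as [d [D H]].
    { apply Rdiv_lt_0_compat; lra. }
    assert (Dp : 0 < d / (Cmod (z - w) + 1)) by (apply Rdiv_lt_0_compat; lra).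
    exists (mkposreal _ Dp). intros h Hh Hlt. simpl in Hlt.
    set (y' := (w + (t + h)%R * (z - w))%C).
    assert (Ey : (y' - y)%C = (h * (z - w))%C).
    { unfold y', y. rewrite RtoC_plus. ring. }
    assert (Hy : Cmod (y' - y) < d).
    { rewrite Ey, Cmod_mult, Cmod_R.
      apply Rle_lt_trans with (Rabs h * (Cmod (z - w) + 1)).
      - apply Rmult_le_compat_l; [apply Rabs_pos|lra].
      - apply (Rmult_lt_reg_r (/ (Cmod (z - w) + 1))).
        + apply Rinv_0_lt_compat; lra.
        + rewrite Rmult_assoc, Rinv_r, Rmult_1_r by lra. exact Hlt. }
    specialize (H y' Hy). rewrite Ey in H.
    replace ((phi (t + h) - phi t) / h - dphi t)
      with (Re (om * (F y' - F y - h * (z - w) * F' y))%C / h).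
    2:{ unfold phi, dphi, y', y. simpl. field. exact Hh. }
    unfold Rdiv. rewrite Rabs_mult, Rabs_inv.
    apply (Rmult_lt_reg_r (Rabs h)); [now apply Rabs_pos_lt|].
    rewrite Rmult_assoc, Rinv_l, Rmult_1_r by now apply Rabs_no_R0.
    eapply Rle_lt_trans; [apply re_le_Cmod|]. rewrite Cmod_mult.
    eapply Rle_lt_trans; [apply Rmult_le_compat_l; [exact Hom|exact H]|].
    rewrite Cmod_mult, Cmod_R.
    replace (Cmod om * (eps / (2 * B) * (Rabs h * Cmod (z - w))))
      with ((eps / (2 * B)) * (Cmod om * Cmod (z - w)) * Rabs h) by ring.
    apply Rmult_lt_compat_r; [now apply Rabs_pos_lt|].
    apply Rle_lt_trans with (eps / (2 * B) * B).
    - apply Rmult_le_compat_l; [apply Rlt_le, Rdiv_lt_0_compat; lra|unfold B; nra].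
    - replace (eps / (2 * B) * B) with (eps / 2) by (field; lra). lra. }
  destruct (MVT_cor2 phi dphi 0 1 Rlt_0_1) as [t [Ht It]]; [intros; apply Hd|].
  assert (E : phi 1 - phi 0 = Cmod (F z - F w) * Cmod (F z - F w)).
  { unfold phi.
    replace (w + 1%R * (z - w))%C with z by ring.
    replace (w + 0%R * (z - w))%C with w by ring.
    pose proof (Cmod2_alt (F z - F w)) as E. unfold om.
    replace (Cmod (F z - F w) * Cmod (F z - F w)) with (Cmod (F z - F w) ^ 2) by ring.
    rewrite E. simpl. ring. }
  rewrite E in Ht.
  assert (Hle : dphi t <= Cmod om * (Cmod (z - w) * M)).
  { unfold dphi. eapply Rle_trans; [apply Re_mult_le|].
    apply Rmult_le_compat_l; [exact Hom|]. rewrite Cmod_mult.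
    apply Rmult_le_compat_l; [exact Hzw|]. apply HM; lra. }
  unfold om in Hle. rewrite Cmod_conj in Hle.
  destruct (Cmod_ge_0 (F z - F w)) as [P|P].
  - apply (Rmult_le_reg_l (Cmod (F z - F w))); [exact P|]. nra.
  - rewrite <- P.
    pose proof (HM 0 ltac:(lra)). pose proof (Cmod_ge_0 (F' (w + 0%R * (z - w))%C)). nra.
Qed.

Fixpoint psum (a : nat -> C) (K : nat) (u : C) : C :=
  match K with
  | O => 0%C
  | S K => (psum a K u + a K * u ^ K)%C
  end.

(** The expansion is only asymptotic: M and rho may depend on K, and no series has to converge. This
    form passes to quotients by z - w and is enough for the maximum principle. *)
Definition taylor_at (f : C -> C) (w : C) (a : nat -> C) : Prop :=
  forall K, exists M rho, 0 <= M /\ 0 < rho /\ forall z, Cmod (z - w) < rho ->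
    Cmod (f z - psum a K (z - w)) <= M * Cmod (z - w) ^ K.

Definition smooth (f : C -> C) : Prop := forall w, exists a, taylor_at f w a.

Lemma psum_at_0 a K : psum a (S K) 0 = a O.
Proof.
  induction K as [|K IH].
  - simpl. ring.
  - change (psum a (S (S K)) 0) with (psum a (S K) 0 + a (S K) * 0 ^ (S K))%C.
    rewrite IH. simpl. ring.
Qed.

Lemma psum_Sl a K u : psum a (S K) u = (a O + u * psum (fun i => a (S i)) K u)%C.
Proof.
  induction K as [|K IH].
  - simpl. ring.
  - change (psum a (S (S K)) u) with (psum a (S K) u + a (S K) * u ^ (S K))%C.
    rewrite IH. simpl. ring.
Qed.

Lemma taylor_at_value f w a : taylor_at f w a -> f w = a O.
Proof.
  intro H. destruct (H 1%nat) as [M [rho [_ [Hr HM]]]].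
  specialize (HM w). replace (w - w)%C with (RtoC 0) in HM by ring.
  rewrite Cmod_0, psum_at_0 in HM. specialize (HM Hr).
  rewrite pow_ne_zero, Rmult_0_r in HM by discriminate.
  pose proof (Cmod_ge_0 (f w - a O)).
  assert (E : (f w - a O)%C = 0%C) by (apply Cmod_eq_0; lra).
  replace (f w) with ((f w - a O) + a O)%C by ring. rewrite E. ring.
Qed.

Lemma cdiff_psum a b w K z :
  (forall i, b i = (INR (S i) * a (S i))%C) ->
  cdiff (fun y => psum a (S K) (y - w)) z (psum b K (z - w)).
Proof.
  intro Hb. induction K as [|K IH].
  - simpl. apply (cdiff_ext (fun _ => a O) _ z 0%C); [intro y; ring|reflexivity|].
    apply cdiff_const.
  - eapply cdiff_ext; [| |exact (cdiff_plus _ _ _ _ _ IH (cdiff_scal _ _ _ (a (S K)) (cdiff_monomial w z K)))].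
    + intro y. reflexivity.
    + change (psum b (S K) (z - w)) with (psum b K (z - w) + b K * (z - w) ^ K)%C.
      rewrite Hb. ring.
Qed.

Lemma INR_fact_S i : INR (fact (S i)) = INR (S i) * INR (fact i).
Proof. rewrite <- mult_INR. reflexivity. Qed.

(** Induction on the order, for all derivative sequences at once: the expansion of [df 1] to order K
    bounds the derivative of the remainder of [df 0], and the mean value inequality gains one power
    of z - w. *)
Lemma taylor_of_derivs (df : nat -> C -> C) w :
  (forall j z, cdiff (df j) z (df (S j) z)) ->
  taylor_at (df O) w (fun i => (df i w * / INR (fact i))%C).
Proof.
  intros H K. revert df H.
  induction K as [|K IH]; intros df H.
  - destruct (cdiff_continuous _ _ _ (H O w) 1 Rlt_0_1) as [d [D Hd]].
    exists (Cmod (df O w) + 1), d. split; [pose proof (Cmod_ge_0 (df O w)); lra|].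
    split; [exact D|]. intros z Hz. specialize (Hd z Hz). simpl.
    replace (df O z - 0)%C with ((df O z - df O w) + df O w)%C by ring.
    pose proof (Cmod_triangle (df O z - df O w) (df O w)). lra.
  - destruct (IH (fun j => df (S j)) (fun j => H (S j))) as [M [rho [HM [Hr HT]]]].
    set (a := fun i => (df i w * / INR (fact i))%C).
    set (b := fun i => (df (S i) w * / INR (fact i))%C).
    exists M, rho. split; [exact HM|]. split; [exact Hr|]. intros z Hz.
    set (F := fun y => (df O y + -(1) * psum a (S K) (y - w))%C).
    set (F' := fun y => (df 1%nat y + -(1) * psum b K (y - w))%C).
    assert (HF : forall y, cdiff F y (F' y)).
    { intro y. apply cdiff_plus; [apply H|]. apply cdiff_scal, cdiff_psum.
      intro i. unfold a, b. rewrite INR_fact_S, RtoC_mult.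
      assert (INR (fact i) <> 0) by apply INR_fact_neq_0.
      assert (INR (S i) <> 0) by now apply not_0_INR.
      field. split; intro E; injection E; auto. }
    pose proof (Cmod_ge_0 (z - w)) as Hzw.
    assert (HB : forall t, 0 <= t <= 1 -> Cmod (F' (w + t * (z - w))%C) <= M * Cmod (z - w) ^ K).
    { intros t Ht. unfold F'.
      replace (w + t * (z - w) - w)%C with (t * (z - w))%C by ring.
      assert (Et : Cmod (t * (z - w)) <= Cmod (z - w)).
      { rewrite Cmod_mult, Cmod_R, Rabs_pos_eq by lra. nra. }
      specialize (HT (w + t * (z - w))%C).
      replace (w + t * (z - w) - w)%C with (t * (z - w))%C in HT by ring.
      specialize (HT ltac:(lra)).
      replace (df 1%nat (w + t * (z - w)) + - (1) * psum b K (t * (z - w)))%C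
        with (df 1%nat (w + t * (z - w)) - psum b K (t * (z - w)))%C by ring.
      eapply Rle_trans; [exact HT|]. apply Rmult_le_compat_l; [exact HM|].
      apply pow_incr. split; [apply Cmod_ge_0|exact Et]. }
    pose proof (mean_value_ineq F F' w z _ HF HB) as Q.
    replace (F z - F w)%C with (df O z - psum a (S K) (z - w))%C in Q.
    2:{ unfold F. replace (w - w)%C with (RtoC 0) by ring. rewrite psum_at_0.
        unfold a at 3. simpl. field. }
    simpl pow. eapply Rle_trans; [exact Q|]. lra.
Qed.

Lemma smooth_entire f df : entire_with_derivs f df ->
  smooth f /\ forall w, taylor_at f w (fun i => (df i w * / INR (fact i))%C).
Proof.
  intros [E H]. subst f.
  assert (HT : forall w, taylor_at (df O) w (fun i => (df i w * / INR (fact i))%C)).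
  { intro w. apply taylor_of_derivs. intros j z. apply cderiv_cdiff, H. }
  split; [|exact HT]. intro w. eexists. apply HT.
Qed.

(** * Division by zeros and the maximum principle *)

Definition vanishes (f : C -> C) (v : C) (j : nat) : Prop :=
  exists a, taylor_at f v a /\ forall i, (i < j)%nat -> a i = 0%C.

Lemma Csub_neq0 (z w : C) : z <> w -> (z - w)%C <> 0%C.
Proof.
  intros H E. apply H. replace z with ((z - w) + w)%C by ring. rewrite E. ring.
Qed.

(** Coefficients b of the formal quotient of sum a_i u^i by e + u, solved from a_(i+1) = e b_(i+1) +
    b_i. *)
Fixpoint quot_coef (e : C) (a : nat -> C) (i : nat) : C :=
  match i with
  | O => (a O / e)%C
  | S i' => ((a (S i') - quot_coef e a i') / e)%C
  end.

Lemma psum_quot (e : C) a K u : e <> 0%C ->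
  psum a (S K) u = ((e + u) * psum (quot_coef e a) (S K) u - quot_coef e a K * u ^ (S K))%C.
Proof.
  intro He. induction K as [|K IH].
  - simpl. field. exact He.
  - change (psum a (S (S K)) u) with (psum a (S K) u + a (S K) * u ^ (S K))%C.
    change (psum (quot_coef e a) (S (S K)) u)
      with (psum (quot_coef e a) (S K) u + quot_coef e a (S K) * u ^ (S K))%C.
    rewrite IH. simpl quot_coef. simpl Cpow. field. exact He.
Qed.

(** Near v the divisor z - w has modulus at least |v - w| / 2, so the remainder grows by at most the
    factor 2 / |v - w|. The boundary term of [psum_quot] is of the order of the remainder and is
    absorbed into M. *)
Lemma taylor_quot f g v w a : v <> w -> (forall z, f z = ((z - w) * g z)%C) ->
  taylor_at f v a -> taylor_at g v (quot_coef (v - w) a).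
Proof.
  intros Hvw Hfg Hf K.
  pose proof (Csub_neq0 _ _ Hvw) as He.
  assert (Hm : 0 < Cmod (v - w)) by now apply Cmod_gt_0.
  set (b := quot_coef (v - w) a).
  assert (Hfar : forall z, Cmod (z - v) < Cmod (v - w) / 2 -> Cmod (v - w) / 2 <= Cmod (z - w)).
  { intros z Hz. replace (z - w)%C with ((v - w) + (z - v))%C by ring.
    pose proof (Cmod_triangle_rev (v - w) (z - v)). lra. }
  destruct K as [|K].
  - destruct (Hf O) as [M [rho [HM [Hr H]]]].
    exists (M * (2 / Cmod (v - w))), (Rmin rho (Cmod (v - w) / 2)).
    split; [apply Rmult_le_pos; [exact HM|apply Rlt_le, Rdiv_lt_0_compat; lra]|].
    split; [apply Rmin_glb_lt; lra|]. intros z Hz.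
    pose proof (Rmin_l rho (Cmod (v - w) / 2)). pose proof (Rmin_r rho (Cmod (v - w) / 2)).
    specialize (H z ltac:(lra)). specialize (Hfar z ltac:(lra)). simpl in H |- *.
    replace (f z - 0)%C with ((z - w) * g z)%C in H by (rewrite Hfg; ring).
    replace (g z - 0)%C with (g z) by ring. rewrite Cmod_mult in H.
    apply (Rmult_le_reg_l (Cmod (v - w) / 2)); [lra|].
    replace (Cmod (v - w) / 2 * (M * (2 / Cmod (v - w)) * 1)) with (M * 1) by (field; lra).
    eapply Rle_trans; [|exact H]. apply Rmult_le_compat_r; [apply Cmod_ge_0|exact Hfar].
  - destruct (Hf (S K)) as [M [rho [HM [Hr H]]]].
    pose proof (Cmod_ge_0 (b K)) as HbK.
    exists ((M + Cmod (b K)) * (2 / Cmod (v - w))), (Rmin rho (Cmod (v - w) / 2)).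
    split; [apply Rmult_le_pos; [lra|apply Rlt_le, Rdiv_lt_0_compat; lra]|].
    split; [apply Rmin_glb_lt; lra|]. intros z Hz.
    pose proof (Rmin_l rho (Cmod (v - w) / 2)). pose proof (Rmin_r rho (Cmod (v - w) / 2)).
    specialize (H z ltac:(lra)). specialize (Hfar z ltac:(lra)).
    rewrite (psum_quot _ _ _ _ He) in H. fold b in H.
    set (P := psum b (S K) (z - v)) in *. set (u := (z - v)%C) in *.
    assert (E : ((z - w) * (g z - P))%C
      = ((f z - ((v - w + u) * P - b K * u ^ S K)) - b K * u ^ S K)%C).
    { rewrite Hfg. unfold u. ring. }
    assert (Q : Cmod (z - w) * Cmod (g z - P) <= (M + Cmod (b K)) * Cmod u ^ S K).
    { rewrite <- Cmod_mult, E. eapply Rle_trans; [apply Cmod_triangle_minus|].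
      rewrite (Cmod_mult (b K)), Cmod_pow. lra. }
    apply (Rmult_le_reg_l (Cmod (v - w) / 2)); [lra|].
    replace (Cmod (v - w) / 2 * ((M + Cmod (b K)) * (2 / Cmod (v - w)) * Cmod u ^ S K))
      with ((M + Cmod (b K)) * Cmod u ^ S K) by (field; lra).
    eapply Rle_trans; [|exact Q]. apply Rmult_le_compat_r; [apply Cmod_ge_0|exact Hfar].
Qed.

Lemma quot_coef_0 (e : C) (a : nat -> C) j : (forall i, (i < j)%nat -> a i = 0%C) ->
  e <> 0%C -> forall i, (i < j)%nat -> quot_coef e a i = 0%C.
Proof.
  intros H He i. induction i as [|i IH]; intro Hi; simpl.
  - rewrite H by exact Hi. field. exact He.
  - rewrite H by exact Hi. rewrite IH by lia. field. exact He.
Qed.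

(** The singularity at w is filled with the coefficient [a 1], after which the shifted coefficients
    expand g at w; at every other point [taylor_quot] applies and preserves the order of
    vanishing. *)
Lemma divide_linear f w a : smooth f -> taylor_at f w a -> a O = 0%C ->
  exists g, smooth g /\ (forall z, f z = ((z - w) * g z)%C) /\
    taylor_at g w (fun i => a (S i)) /\
    forall v j, v <> w -> vanishes f v j -> vanishes g v j.
Proof.
  intros Hf Ha H0.
  set (g := fun z => if excluded_middle_informative (z = w) then a 1%nat else (f z / (z - w))%C).
  assert (Hfg : forall z, f z = ((z - w) * g z)%C).
  { intro z. unfold g. destruct (excluded_middle_informative (z = w)) as [E|E].
    - subst z. rewrite (taylor_at_value _ _ _ Ha), H0. ring.
    - field. now apply Csub_neq0. }
  assert (Hgw : taylor_at g w (fun i => a (S i))).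
  { intro K. destruct (Ha (S K)) as [M [rho [HM [Hr H]]]].
    pose proof (Cmod_ge_0 (a 1%nat)) as Hp.
    exists (M + Cmod (a 1%nat)), rho. split; [lra|]. split; [exact Hr|]. intros z Hz.
    specialize (H z Hz). rewrite psum_Sl, H0 in H.
    destruct (classic (z = w)) as [E|E].
    - subst z. assert (Eg : g w = a 1%nat).
      { unfold g. destruct (excluded_middle_informative (w = w)); [reflexivity|tauto]. }
      rewrite Eg. replace (w - w)%C with (RtoC 0) by ring. destruct K as [|K].
      + simpl. replace (a 1%nat - 0)%C with (a 1%nat) by ring. lra.
      + rewrite psum_at_0. replace (a 1%nat - a 1%nat)%C with (RtoC 0) by ring.
        rewrite Cmod_0, pow_ne_zero by discriminate. lra.
    - assert (Hz0 : 0 < Cmod (z - w)) by now apply Cmod_gt_0, Csub_neq0.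
      replace (f z - (0 + (z - w) * psum (fun i => a (S i)) K (z - w)))%C
        with ((z - w) * (g z - psum (fun i => a (S i)) K (z - w)))%C in H
        by (rewrite Hfg; ring).
      rewrite Cmod_mult in H. simpl pow in H.
      assert (Cmod (g z - psum (fun i => a (S i)) K (z - w)) <= M * Cmod (z - w) ^ K).
      { apply (Rmult_le_reg_l (Cmod (z - w))); [exact Hz0|]. lra. }
      pose proof (pow_le _ K (Rlt_le _ _ Hz0)). nra. }
  assert (Hgv : forall v j, v <> w -> vanishes f v j -> vanishes g v j).
  { intros v j Hv [b [Hb Hb0]]. exists (quot_coef (v - w) b). split.
    - now apply taylor_quot with f.
    - exact (quot_coef_0 (v - w)%C b j Hb0 (Csub_neq0 _ _ Hv)). }
  exists g. split; [|auto].
  intro v. destruct (classic (v = w)) as [E|E].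
  - subst v. eexists; exact Hgw.
  - destruct (Hf v) as [b Hb]. exists (quot_coef (v - w) b). now apply taylor_quot with f.
Qed.

Lemma divide_power k : forall f w a, smooth f -> taylor_at f w a ->
  (forall i, (i < k)%nat -> a i = 0%C) ->
  exists g, smooth g /\ (forall z, f z = ((z - w) ^ k * g z)%C) /\ g w = a k /\
    forall v j, v <> w -> vanishes f v j -> vanishes g v j.
Proof.
  induction k as [|k IH]; intros f w a Hf Ha H0.
  - exists f. split; [exact Hf|]. split; [intro z; simpl; ring|].
    split; [now apply taylor_at_value|auto].
  - destruct (divide_linear f w a Hf Ha) as [g [Hg [Hfg [Hgw Hgv]]]]; [apply H0; lia|].
    destruct (IH g w (fun i => a (S i)) Hg Hgw) as [h [Hh [Hgh [Hhw Hhv]]]].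
    { intros i Hi. apply H0. lia. }
    exists h. split; [exact Hh|]. split.
    { intro z. rewrite Hfg, Hgh. simpl. ring. }
    split; [exact Hhw|]. intros v j Hv Hj. auto.
Qed.

Lemma smooth_lipschitz g w : smooth g ->
  exists M rho, 0 <= M /\ 0 < rho /\ forall z, Cmod (z - w) < rho ->
    Cmod (g z - g w) <= M * Cmod (z - w).
Proof.
  intro Hg. destruct (Hg w) as [a Ha].
  pose proof (taylor_at_value _ _ _ Ha) as E.
  destruct (Ha 1%nat) as [M [rho [HM [Hr H]]]].
  exists M, rho. split; [exact HM|]. split; [exact Hr|]. intros z Hz. specialize (H z Hz).
  simpl in H. rewrite E. replace (g z - a O)%C with (g z - (0 + a O * 1))%C by ring. lra.
Qed.

(** Compactness of the rectangle as a local-to-uniform principle. The single parameter d is both the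
    radius of the neighbourhood and the strength of the property, so it serves for boundedness and
    for strict gaps alike. *)
Lemma rectangle_cover (a b a' b' : R) (B : R -> R -> R -> Prop) :
  (forall x y d d', 0 < d <= d' -> B x y d' -> B x y d) ->
  (forall x y, a <= x <= b -> a' <= y <= b' -> exists d, 0 < d /\
     forall x' y', a <= x' <= b -> a' <= y' <= b' ->
       Rabs (x' - x) < d -> Rabs (y' - y) < d -> B x' y' d) ->
  exists d, 0 < d /\ forall x y, a <= x <= b -> a' <= y <= b' -> B x y d.
Proof.
  intros Hanti Hloc.
  assert (Hdel : forall x y, exists d : posreal, a <= x <= b -> a' <= y <= b' ->
     forall x' y', a <= x' <= b -> a' <= y' <= b' ->
       Rabs (x' - x) < d -> Rabs (y' - y) < d -> B x' y' d).
  { intros x y. destruct (classic (a <= x <= b /\ a' <= y <= b')) as [[Hx Hy]|N].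
    - destruct (Hloc x y Hx Hy) as [d [D H]]. exists (mkposreal d D). intros _ _. exact H.
    - exists (mkposreal 1 Rlt_0_1). intros; tauto. }
  set (delta := fun x y => proj1_sig (constructive_indefinite_description _ (Hdel x y))).
  destruct (compactness_value_2d a b a' b' delta) as [d Hd].
  exists d. split; [apply cond_pos|]. intros x y Hx Hy.
  specialize (Hd x y Hx Hy). apply NNPP in Hd.
  destruct Hd as [u [v [Hu [Hv [H1 [H2 H3]]]]]].
  unfold delta in H1, H2, H3.
  destruct (constructive_indefinite_description _ (Hdel u v)) as [e He]. simpl in *.
  apply Hanti with e; [split; [apply cond_pos|exact H3]|]. auto.
Qed.

(** Two covers are used. The property u <= 1/d bounds u above; if the supremum s were not attained,
    the property u <= s - d would keep u uniformly below s. Upper semicontinuity is enough. *)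
Lemma rectangle_max (a b a' b' : R) (u : R -> R -> R) :
  a <= b -> a' <= b' ->
  (forall x y, a <= x <= b -> a' <= y <= b' -> forall eps, 0 < eps -> exists d, 0 < d /\
     forall x' y', Rabs (x' - x) < d -> Rabs (y' - y) < d -> u x' y' < u x y + eps) ->
  exists x0 y0, a <= x0 <= b /\ a' <= y0 <= b' /\
    forall x y, a <= x <= b -> a' <= y <= b' -> u x y <= u x0 y0.
Proof.
  intros Hab Hab' Hc.
  destruct (rectangle_cover a b a' b' (fun x y d => u x y <= / d)) as [d0 [D0 Hd0]].
  { intros x y d d' Hd H. eapply Rle_trans; [exact H|]. apply Rinv_le_contravar; lra. }
  { intros x y Hx Hy. destruct (Hc x y Hx Hy 1 Rlt_0_1) as [d [D H]].
    pose proof (Rabs_pos (u x y)) as Hp.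
    assert (0 < / (Rabs (u x y) + 1)) by (apply Rinv_0_lt_compat; lra).
    exists (Rmin d (/ (Rabs (u x y) + 1))). split; [now apply Rmin_glb_lt|].
    intros x' y' _ _ H1 H2. pose proof (Rmin_l d (/ (Rabs (u x y) + 1))) as Hl.
    pose proof (Rmin_r d (/ (Rabs (u x y) + 1))) as Hr.
    specialize (H x' y' ltac:(lra) ltac:(lra)). pose proof (Rle_abs (u x y)).
    apply Rle_trans with (Rabs (u x y) + 1); [lra|].
    set (q := Rmin d (/ (Rabs (u x y) + 1))) in *.
    assert (0 < q) by (unfold q; now apply Rmin_glb_lt).
    rewrite <- (Rinv_inv (Rabs (u x y) + 1)). now apply Rinv_le_contravar. }
  set (E := fun r => exists x y, a <= x <= b /\ a' <= y <= b' /\ r = u x y).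
  destruct (completeness E) as [s [Hub Hlub]].
  { exists (/ d0). intros r [x [y [Hx [Hy ->]]]]. auto. }
  { exists (u a a'), a, a'. repeat split; lra. }
  apply NNPP. intro N.
  assert (Hlt : forall x y, a <= x <= b -> a' <= y <= b' -> u x y < s).
  { intros x y Hx Hy. assert (u x y <= s) by (apply Hub; exists x, y; auto).
    destruct (Req_dec (u x y) s) as [E0|E0]; [|lra].
    exfalso. apply N. exists x, y. split; [exact Hx|]. split; [exact Hy|].
    intros x' y' Hx' Hy'. rewrite E0. apply Hub. exists x', y'. auto. }
  destruct (rectangle_cover a b a' b' (fun x y d => u x y <= s - d)) as [d [D Hd]].
  { intros x y d d' H1 H2. lra. }
  { intros x y Hx Hy. specialize (Hlt x y Hx Hy).
    destruct (Hc x y Hx Hy ((s - u x y) / 2) ltac:(lra)) as [d [D H]].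
    exists (Rmin d ((s - u x y) / 2)). split; [apply Rmin_glb_lt; lra|].
    intros x' y' _ _ H1 H2. pose proof (Rmin_l d ((s - u x y) / 2)) as Hl.
    pose proof (Rmin_r d ((s - u x y) / 2)) as Hr.
    specialize (H x' y' ltac:(lra) ltac:(lra)). lra. }
  assert (s <= s - d); [|lra].
  apply Hlub. intros r [x [y [Hx [Hy ->]]]]. auto.
Qed.

Lemma Cmod_le_abs (x y : R) : Cmod (x, y) <= Rabs x + Rabs y.
Proof.
  replace (x, y) with (RtoC x + Ci * RtoC y)%C by (unfold Ci, RtoC, Cmult, Cplus; simpl; f_equal; ring).
  eapply Rle_trans; [apply Cmod_triangle|].
  rewrite Cmod_mult, Cmod_Ci, !Cmod_R. lra.
Qed.

Lemma Cmod2_perturb G r : Cmod G ^ 2 - 2 * Cmod G * Cmod r <= Cmod (G + r) ^ 2.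
Proof.
  pose proof (Cmod_triangle_rev G r). pose proof (Cmod_ge_0 G). pose proof (Cmod_ge_0 r).
  pose proof (Cmod_ge_0 (G + r)).
  destruct (Rle_dec (Cmod r) (Cmod G)); nra.
Qed.

Definition qpoly (a0 a1 a2 z : C) : C := (a0 + a1 * z + a2 * z * z)%C.

(** Averaging over the fourth roots of unity kills all cross terms of a quadratic, leaving 4 (|a0|^2
    + h^2 |a1|^2 + h^4 |a2|^2). *)
Lemma four_point_sum a0 a1 a2 (h : R) :
  4 * Cmod a0 ^ 2 <= Cmod (qpoly a0 a1 a2 h) ^ 2 + Cmod (qpoly a0 a1 a2 (- h)) ^ 2
    + Cmod (qpoly a0 a1 a2 (Ci * h)) ^ 2 + Cmod (qpoly a0 a1 a2 (- (Ci * h))) ^ 2.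
Proof.
  rewrite !Cmod2_alt. destruct a0 as [p0 q0], a1 as [p1 q1], a2 as [p2 q2].
  unfold qpoly, Ci, RtoC. simpl.
  match goal with |- ?l <= ?r => assert (E : r - l = 4 * h ^ 2 * (p1 ^ 2 + q1 ^ 2) + 4 * h ^ 4 * (p2 ^ 2 + q2 ^ 2)) by ring end.
  assert (0 <= 4 * h ^ 2 * (p1 ^ 2 + q1 ^ 2) + 4 * h ^ 4 * (p2 ^ 2 + q2 ^ 2)).
  { apply Rplus_le_le_0_compat; apply Rmult_le_pos; nra. }
  lra.
Qed.

(* The four-point mean of |g|^2 does not go below the centre value up to third order,
   so |g|^2 + e |z - c|^2 has no interior maximum. *)
Lemma four_point_mean g v : smooth g -> forall e, 0 < e ->
  exists h0, 0 < h0 /\ forall h, 0 < h < h0 ->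
    4 * Cmod (g v) ^ 2 - 4 * e * h ^ 2 < Cmod (g (v + h)%C) ^ 2 + Cmod (g (v + - h)%C) ^ 2
      + Cmod (g (v + Ci * h)%C) ^ 2 + Cmod (g (v + - (Ci * h))%C) ^ 2.
Proof.
  intros Hg e He. destruct (Hg v) as [a Ha].
  pose proof (taylor_at_value _ _ _ Ha) as Ev.
  destruct (Ha 3%nat) as [M [rho [HM [Hr H]]]].
  set (B := Cmod (a O) + Cmod (a 1%nat) + Cmod (a 2%nat)).
  assert (HB : 0 <= B).
  { unfold B. pose proof (Cmod_ge_0 (a O)). pose proof (Cmod_ge_0 (a 1%nat)).
    pose proof (Cmod_ge_0 (a 2%nat)). lra. }
  (* For h <= 1 the quadratic part is at most B and the remainder at most M h^3, so the four points
     lose at most 8 B M h^3 together; h q < e makes this less than 4 e h^2. *)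
  set (q := 2 * B * M + 1).
  assert (Hq : 0 < q) by (unfold q; nra).
  exists (Rmin 1 (Rmin rho (e / q))). split.
  { repeat apply Rmin_glb_lt; try lra. apply Rdiv_lt_0_compat; lra. }
  intros h [Hh0 Hh].
  pose proof (Rmin_l 1 (Rmin rho (e / q))). pose proof (Rmin_r 1 (Rmin rho (e / q))).
  pose proof (Rmin_l rho (e / q)). pose proof (Rmin_r rho (e / q)).
  assert (K : forall z, Cmod z = h ->
     Cmod (qpoly (a O) (a 1%nat) (a 2%nat) z) ^ 2 - 2 * B * M * h ^ 3 <= Cmod (g (v + z)%C) ^ 2).
  { intros z Hz.
    set (G := qpoly (a O) (a 1%nat) (a 2%nat) z). set (r := (g (v + z) - G)%C).
    specialize (H (v + z)%C). replace (v + z - v)%C with z in H by ring.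
    rewrite Hz in H. specialize (H ltac:(lra)).
    replace (g (v + z) - psum a 3 z)%C with r in H by (unfold r, G, qpoly; simpl; ring).
    replace (g (v + z)%C) with (G + r)%C by (unfold r; ring).
    eapply Rle_trans; [|apply Cmod2_perturb].
    assert (HG : Cmod G <= B).
    { unfold G, qpoly, B.
      eapply Rle_trans; [apply Cmod_triangle|].
      pose proof (Cmod_triangle (a O) (a 1%nat * z)) as HT.
      rewrite Cmod_mult, Hz in HT. rewrite !Cmod_mult, Hz.
      pose proof (Cmod_ge_0 (a 1%nat)). pose proof (Cmod_ge_0 (a 2%nat)).
      assert (Cmod (a 1%nat) * h <= Cmod (a 1%nat)) by nra.
      assert (h * h <= 1) by nra.
      assert (Cmod (a 2%nat) * (h * h) <= Cmod (a 2%nat) * 1) by (apply Rmult_le_compat_l; lra).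
      lra. }
    pose proof (Cmod_ge_0 r). pose proof (Cmod_ge_0 G).
    assert (Cmod G * Cmod r <= B * (M * h ^ 3)) by (apply Rmult_le_compat; lra).
    lra. }
  pose proof (K (RtoC h) ltac:(rewrite Cmod_R, Rabs_pos_eq; lra)) as K1.
  pose proof (K (- RtoC h)%C ltac:(rewrite Cmod_opp, Cmod_R, Rabs_pos_eq; lra)) as K2.
  pose proof (K (Ci * h)%C ltac:(rewrite Cmod_mult, Cmod_Ci, Cmod_R, Rabs_pos_eq; lra)) as K3.
  pose proof (K (- (Ci * h))%C ltac:(rewrite Cmod_opp, Cmod_mult, Cmod_Ci, Cmod_R, Rabs_pos_eq; lra)) as K4.
  pose proof (four_point_sum (a O) (a 1%nat) (a 2%nat) h) as F.
  rewrite Ev.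
  assert (h * q < e).
  { apply Rlt_le_trans with (e / q * q); [apply Rmult_lt_compat_r; lra|].
    right. field. lra. }
  assert (8 * B * M * h ^ 3 < 4 * e * h ^ 2).
  { replace (8 * B * M * h ^ 3) with (4 * h ^ 2 * (h * (2 * B * M))) by ring.
    replace (4 * e * h ^ 2) with (4 * h ^ 2 * e) by ring.
    apply Rmult_lt_compat_l; [nra|]. unfold q in *. nra. }
  lra.
Qed.

(** If |g c| exceeded S, then |g|^2 + e (x^2 + y^2) would attain its maximum over the square at an
    interior point. The quadratic adds exactly 4 e h^2 to the four-point sum, which contradicts
    [four_point_mean]. *)
Lemma maximum_modulus_square g c R0 S : smooth g -> 0 < R0 -> 0 <= S ->
  (forall x y, Rabs x <= R0 -> Rabs y <= R0 -> R0 <= Rabs x \/ R0 <= Rabs y ->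
     Cmod (g (c + (x, y))%C) <= S) ->
  Cmod (g c) <= S.
Proof.
  intros Hg HR HS Hb.
  destruct (Rle_dec (Cmod (g c)) S) as [|N]; [assumption|exfalso]. apply Rnot_le_lt in N.
  (* On the square x^2 + y^2 <= 2 R0^2, so the perturbation uses up at most half of the gap |g c|^2
     - S^2 and the boundary stays below the centre. *)
  set (e := (Cmod (g c) ^ 2 - S ^ 2) / (4 * R0 ^ 2)).
  assert (Hnum : 0 < Cmod (g c) ^ 2 - S ^ 2) by nra.
  assert (He : 0 < e) by (apply Rdiv_lt_0_compat; nra).
  set (u := fun x y => Cmod (g (c + (x, y))%C) ^ 2 + e * (x ^ 2 + y ^ 2)).
  destruct (rectangle_max (- R0) R0 (- R0) R0 u) as [x0 [y0 [Hx0 [Hy0 Hmax]]]]; try lra.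
  { intros x y Hx Hy eps Heps. unfold u.
    set (w := (c + (x, y))%C).
    destruct (smooth_lipschitz g w Hg) as [M [rho [HM [Hr HL]]]].
    pose proof (Cmod_ge_0 (g w)) as Hgw.
    set (L := 2 * M * (2 * Cmod (g w) + 2 * M) + e * (2 * R0 + 1) * 2 + 1).
    assert (HLp : 0 < L).
    { unfold L. assert (0 <= 2 * M * (2 * Cmod (g w) + 2 * M)) by (apply Rmult_le_pos; nra). nra. }
    exists (Rmin 1 (Rmin (rho / 2) (eps / L))). split.
    { repeat apply Rmin_glb_lt; try lra. apply Rdiv_lt_0_compat; lra. }
    intros x' y' H1 H2.
    pose proof (Rmin_l 1 (Rmin (rho / 2) (eps / L))). pose proof (Rmin_r 1 (Rmin (rho / 2) (eps / L))).
    pose proof (Rmin_l (rho / 2) (eps / L)). pose proof (Rmin_r (rho / 2) (eps / L)).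
    set (d := Rmax (Rabs (x' - x)) (Rabs (y' - y))).
    assert (Hd1 : Rabs (x' - x) <= d) by apply Rmax_l.
    assert (Hd2 : Rabs (y' - y) <= d) by apply Rmax_r.
    assert (Hd : 0 <= d < Rmin 1 (Rmin (rho / 2) (eps / L))).
    { split; [apply Rle_trans with (2 := Hd1), Rabs_pos|]. unfold d. now apply Rmax_lub_lt. }
    assert (Hdist : Cmod (c + (x', y') - w) <= 2 * d).
    { replace (c + (x', y') - w)%C with (x' - x, y' - y).
      - eapply Rle_trans; [apply Cmod_le_abs|]. lra.
      - unfold w, Cminus, Cplus, Copp. simpl. f_equal; ring. }
    specialize (HL (c + (x', y'))%C ltac:(lra)).
    assert (T : Cmod (g (c + (x', y'))%C) <= Cmod (g w) + 2 * M * d).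
    { replace (g (c + (x', y'))%C) with (g (c + (x', y'))%C - g w + g w)%C by ring.
      eapply Rle_trans; [apply Cmod_triangle|].
      assert (M * Cmod (c + (x', y') - w) <= M * (2 * d)) by (apply Rmult_le_compat_l; lra). lra. }
    pose proof (Cmod_ge_0 (g (c + (x', y'))%C)) as Hp.
    assert (T2 : Cmod (g (c + (x', y'))%C) ^ 2 <= Cmod (g w) ^ 2 + d * (2 * M * (2 * Cmod (g w) + 2 * M))).
    { apply Rle_trans with ((Cmod (g w) + 2 * M * d) ^ 2); [apply pow_incr; lra|].
      assert (d * d <= d) by nra. assert (0 <= M * M) by nra.
      assert (M * M * (d * d) <= M * M * d) by (apply Rmult_le_compat_l; lra). nra. }
    assert (Q : forall s s', - R0 <= s <= R0 -> Rabs (s' - s) <= d -> s' ^ 2 <= s ^ 2 + d * (2 * R0 + 1)).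
    { intros s s' Hs Hss. apply Rabs_le_between in Hss.
      replace s' with (s + (s' - s)) by ring. set (k := s' - s) in *.
      assert (k * k <= d) by nra.
      assert (s * k <= R0 * d).
      { apply Rle_trans with (Rabs (s * k)); [apply Rle_abs|]. rewrite Rabs_mult.
        apply Rmult_le_compat; try apply Rabs_pos; apply Rabs_le; lra. }
      nra. }
    pose proof (Q x x' Hx Hd1). pose proof (Q y y' Hy Hd2).
    assert (d * L < eps).
    { apply Rlt_le_trans with (eps / L * L); [apply Rmult_lt_compat_r; lra|]. right; field; lra. }
    assert (e * (x' ^ 2 + y' ^ 2) <= e * (x ^ 2 + y ^ 2 + 2 * (d * (2 * R0 + 1))))
      by (apply Rmult_le_compat_l; lra).
    unfold L in *. nra. }
  assert (Hc0 : Cmod (g c) ^ 2 <= u x0 y0).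
  { replace (Cmod (g c) ^ 2) with (u 0 0); [apply Hmax; lra|].
    unfold u. replace (c + (0, 0))%C with c by (change (0, 0) with (RtoC 0); ring). ring. }
  assert (Hint : - R0 < x0 < R0 /\ - R0 < y0 < R0).
  { apply NNPP. intro Nint.
    assert (HS' : Cmod (g (c + (x0, y0))%C) <= S).
    { apply Hb; try (apply Rabs_le; lra).
      apply NNPP. intro Q. apply Nint. apply not_or_and in Q. destruct Q as [Q1 Q2].
      apply Rnot_le_lt, Rabs_def2 in Q1. apply Rnot_le_lt, Rabs_def2 in Q2. lra. }
    pose proof (Cmod_ge_0 (g (c + (x0, y0))%C)).
    assert (u x0 y0 <= S ^ 2 + e * (2 * R0 ^ 2)).
    { unfold u. apply Rplus_le_compat; [apply pow_incr; lra|].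
      apply Rmult_le_compat_l; [lra|]. nra. }
    assert (e * (2 * R0 ^ 2) = (Cmod (g c) ^ 2 - S ^ 2) / 2) by (unfold e; field; lra).
    lra. }
  destruct Hint as [[A1 A2] [A3 A4]].
  destruct (four_point_mean g (c + (x0, y0))%C Hg e He) as [h0 [Hh0 H4]].
  set (h := Rmin (h0 / 2) (Rmin (Rmin (R0 - x0) (R0 + x0)) (Rmin (R0 - y0) (R0 + y0)))).
  assert (Hh : 0 < h < h0 /\ h <= R0 - x0 /\ h <= R0 + x0 /\ h <= R0 - y0 /\ h <= R0 + y0).
  { unfold h.
    pose proof (Rmin_l (h0 / 2) (Rmin (Rmin (R0 - x0) (R0 + x0)) (Rmin (R0 - y0) (R0 + y0)))).
    pose proof (Rmin_r (h0 / 2) (Rmin (Rmin (R0 - x0) (R0 + x0)) (Rmin (R0 - y0) (R0 + y0)))).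
    pose proof (Rmin_l (Rmin (R0 - x0) (R0 + x0)) (Rmin (R0 - y0) (R0 + y0))).
    pose proof (Rmin_r (Rmin (R0 - x0) (R0 + x0)) (Rmin (R0 - y0) (R0 + y0))).
    pose proof (Rmin_l (R0 - x0) (R0 + x0)). pose proof (Rmin_r (R0 - x0) (R0 + x0)).
    pose proof (Rmin_l (R0 - y0) (R0 + y0)). pose proof (Rmin_r (R0 - y0) (R0 + y0)).
    split; [split; [repeat apply Rmin_glb_lt; lra|lra]|lra]. }
  destruct Hh as [Hh [B1 [B2 [B3 B4]]]].
  specialize (H4 h Hh).
  pose proof (Hmax (x0 + h) y0 ltac:(lra) ltac:(lra)) as M1.
  pose proof (Hmax (x0 - h) y0 ltac:(lra) ltac:(lra)) as M2.
  pose proof (Hmax x0 (y0 + h) ltac:(lra) ltac:(lra)) as M3.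
  pose proof (Hmax x0 (y0 - h) ltac:(lra) ltac:(lra)) as M4.
  unfold u in M1, M2, M3, M4.
  replace (c + (x0 + h, y0)%R)%C with (c + (x0, y0) + h)%C in M1
    by (unfold Cplus, RtoC; simpl; f_equal; ring).
  replace (c + (x0 - h, y0)%R)%C with (c + (x0, y0) + - h)%C in M2
    by (unfold Cplus, Copp, RtoC; simpl; f_equal; ring).
  replace (c + (x0, y0 + h)%R)%C with (c + (x0, y0) + Ci * h)%C in M3
    by (unfold Cplus, Cmult, Ci, RtoC; simpl; f_equal; ring).
  replace (c + (x0, y0 - h)%R)%C with (c + (x0, y0) + - (Ci * h))%C in M4
    by (unfold Cplus, Cmult, Copp, Ci, RtoC; simpl; f_equal; ring).
  nra.
Qed.

(** * Crowding of the exponents *)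

Fixpoint rsum (f : nat -> R) (n : nat) : R :=
  match n with
  | O => 0
  | S n => rsum f n + f n
  end.

Lemma rsum_ext f g n : (forall i, (i < n)%nat -> f i = g i) -> rsum f n = rsum g n.
Proof. induction n as [|n IH]; intro H; simpl; [reflexivity|]. rewrite IH, H; auto. Qed.

Lemma rsum_le f g n : (forall i, (i < n)%nat -> f i <= g i) -> rsum f n <= rsum g n.
Proof.
  induction n as [|n IH]; intro H; simpl; [lra|]. apply Rplus_le_compat; [apply IH|]; auto.
Qed.

Lemma rsum_plus f g n : rsum (fun i => f i + g i) n = rsum f n + rsum g n.
Proof. induction n as [|n IH]; simpl; [ring|]. rewrite IH. ring. Qed.

Lemma rsum_scal a f n : rsum (fun i => a * f i) n = a * rsum f n.
Proof. induction n as [|n IH]; simpl; [ring|]. rewrite IH. ring. Qed.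

Lemma rsum_nonneg f n : (forall i, (i < n)%nat -> 0 <= f i) -> 0 <= rsum f n.
Proof.
  induction n as [|n IH]; intro H; simpl; [lra|]. apply Rplus_le_le_0_compat; [apply IH|]; auto.
Qed.

Lemma rsum_mono f n m : (forall i, 0 <= f i) -> (n <= m)%nat -> rsum f n <= rsum f m.
Proof. intros H L. induction L as [|m L IH]; simpl; [lra|]. specialize (H m). lra. Qed.

Lemma rsum_term_le f n i : (forall j, 0 <= f j) -> (i < n)%nat -> f i <= rsum f n.
Proof.
  intros H Hi. apply Rle_trans with (rsum f (S i)).
  - simpl. pose proof (rsum_nonneg f i (fun j _ => H j)). lra.
  - now apply rsum_mono.
Qed.

Lemma rsum_stable f n0 n : (forall i, 0 <= f i) ->
  (forall i, (n0 <= i)%nat -> f i = 0) -> rsum f n <= rsum f n0.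
Proof.
  intros H H0. destruct (Nat.le_ge_cases n n0) as [L|L]; [now apply rsum_mono|].
  induction L as [|m L IH]; simpl; [lra|]. rewrite H0 by exact L. lra.
Qed.

Lemma exp_le_compat x y : x <= y -> exp x <= exp y.
Proof. intros [H|H]; [left; now apply exp_increasing|right; now rewrite H]. Qed.

Fixpoint zero_product (lam : nat -> C) (e : nat -> nat) (N : nat) (z : C) : C :=
  match N with
  | O => 1%C
  | S N => (zero_product lam e N z * (z - lam N) ^ (e N))%C
  end.

Lemma divide_zeros lam e f : (forall n m, n <> m -> lam n <> lam m) ->
  smooth f -> (forall m, vanishes f (lam m) (e m)) ->
  forall N, exists g, smooth g /\ (forall z, f z = (zero_product lam e N z * g z)%C) /\
    forall m, (N <= m)%nat -> vanishes g (lam m) (e m).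
Proof.
  intros Hinj Hf Hv N. induction N as [|N [g [Hg [Hfg Hgv]]]].
  - exists f. split; [exact Hf|]. split; [intro z; simpl; ring|auto].
  - destruct (Hgv N (Nat.le_refl N)) as [a [Ha Ha0]].
    destruct (divide_power (e N) g (lam N) a Hg Ha Ha0) as [h [Hh [Hgh [_ Hhv]]]].
    exists h. split; [exact Hh|]. split.
    + intro z. rewrite Hfg, Hgh. simpl. ring.
    + intros m Hm. apply Hhv; [apply Hinj; lia|apply Hgv; lia].
Qed.

Lemma exp_nat_ln n x : 0 < x -> exp (INR n * ln x) = x ^ n.
Proof.
  intro Hx. induction n as [|n IH].
  - simpl. rewrite Rmult_0_l. apply exp_0.
  - rewrite S_INR, Rmult_plus_distr_r, exp_plus, IH, Rmult_1_l, exp_ln by exact Hx.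
    simpl. ring.
Qed.

Lemma Cmod_zero_product lam e N z :
  (forall m, (0 < e m)%nat -> z <> lam m) ->
  Cmod (zero_product lam e N z) = exp (rsum (fun m => INR (e m) * ln (Cmod (z - lam m))) N).
Proof.
  intro H. induction N as [|N IH]; simpl.
  - rewrite exp_0. apply Cmod_1.
  - rewrite Cmod_mult, IH, exp_plus, Cmod_pow. f_equal.
    destruct (e N) as [|k] eqn:E.
    + simpl. rewrite Rmult_0_l, exp_0. reflexivity.
    + symmetry. apply exp_nat_ln. apply Cmod_gt_0, Csub_neq0, H. lia.
Qed.

Lemma ln_div_eq a b : 0 < a -> 0 < b -> ln (a / b) = ln a - ln b.
Proof.
  intros Ha Hb. unfold Rdiv. rewrite ln_mult, ln_Rinv; [ring|exact Hb|exact Ha|].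
  now apply Rinv_0_lt_compat.
Qed.

(** A bound of Jensen type. Dividing f by (z - c)^k0 and by the zeros leaves g with |g c| the
    reciprocal of the product of the |c - lam_m|^(e m), while on the boundary of a square around c
    every zero factor has modulus at least r. The hypothesis [1 <= 2 * r] makes |z - c|^k0 at least
    1 there, so k0 does not enter the bound. *)
Lemma zeros_near_centre lam e f c k0 a r S N :
  (forall n m, n <> m -> lam n <> lam m) ->
  smooth f -> (forall m, vanishes f (lam m) (e m)) ->
  taylor_at f c a -> (forall i, (i < k0)%nat -> a i = 0%C) -> a k0 = 1%C ->
  (forall m, (0 < e m)%nat -> lam m <> c /\ Cmod (lam m - c) <= r) ->
  1 <= 2 * r -> 0 < S ->
  (forall z, Cmod (z - c) <= 4 * r -> Cmod (f z) <= S) ->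
  rsum (fun m => INR (e m) * ln (r / Cmod (lam m - c))) N <= ln S.
Proof.
  intros Hinj Hf Hv Ha Ha0 Ha1 He Hr HS Hbound.
  destruct (divide_power k0 f c a Hf Ha Ha0) as [g0 [Hg0 [Hfg0 [Hgc Hg0v]]]].
  assert (Hv0 : forall m, vanishes g0 (lam m) (e m)).
  { intro m. destruct (e m) as [|k] eqn:E.
    - destruct (Hg0 (lam m)) as [b Hb]. exists b. split; [exact Hb|]. intros i Hi. lia.
    - rewrite <- E. apply Hg0v; [apply He; lia|apply Hv]. }
  destruct (divide_zeros lam e g0 Hinj Hg0 Hv0 N) as [g [Hg [Hgg _]]].
  set (A := rsum (fun m => INR (e m) * ln r) N).
  assert (HM : Cmod (g c) <= S * exp (- A)).
  (* The square of half-side 2 r lies in the disc of radius 4 r where f is bounded, and its boundary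
     keeps distance at least r from all the zeros, which lie within r of c. *)
  { apply (maximum_modulus_square g c (2 * r)); [exact Hg|lra| |].
    - pose proof (exp_pos (- A)). nra.
    - intros x y Hx Hy Hxy. set (z := (c + (x, y))%C).
      assert (Ez : (z - c)%C = (x, y)).
      { unfold z, Cminus, Cplus, Copp. destruct c; simpl. f_equal; ring. }
      assert (Hz1 : 2 * r <= Cmod (z - c)).
      { rewrite Ez. eapply Rle_trans; [|apply Rmax_Cmod]. simpl.
        destruct Hxy as [K|K]; [eapply Rle_trans; [exact K|apply Rmax_l]|eapply Rle_trans; [exact K|apply Rmax_r]]. }
      assert (Hz2 : Cmod (z - c) <= 4 * r).
      { rewrite Ez. eapply Rle_trans; [apply Cmod_le_abs|]. lra. }
      specialize (Hbound z Hz2).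
      assert (Hd : forall m, (0 < e m)%nat -> r <= Cmod (z - lam m)).
      { intros m Hm. destruct (He m Hm) as [_ K].
        replace (z - lam m)%C with ((z - c) + - (lam m - c))%C by ring.
        pose proof (Cmod_triangle_rev (z - c) (- (lam m - c))) as T. rewrite Cmod_opp in T. lra. }
      assert (HQ : exp A <= Cmod (zero_product lam e N z)).
      { rewrite Cmod_zero_product.
        - apply exp_le_compat. apply rsum_le. intros m _.
          destruct (e m) as [|k] eqn:E; [simpl; lra|].
          apply Rmult_le_compat_l; [apply pos_INR|]. apply ln_le; [lra|]. apply Hd. lia.
        - intros m Hm E. specialize (Hd m Hm). rewrite E in Hd.
          replace (lam m - lam m)%C with (RtoC 0) in Hd by ring. rewrite Cmod_0 in Hd. lra. }
      rewrite Hfg0, Hgg, !Cmod_mult, Cmod_pow in Hbound.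
      assert (1 <= Cmod (z - c) ^ k0) by (apply pow_R1_Rle; lra).
      pose proof (Cmod_ge_0 (g z)). pose proof (exp_pos A).
      assert (exp A * Cmod (g z) <= S).
      { eapply Rle_trans; [|exact Hbound].
        apply Rle_trans with (Cmod (zero_product lam e N z) * Cmod (g z)); [nra|].
        assert (0 <= Cmod (zero_product lam e N z) * Cmod (g z)) by (apply Rmult_le_pos; apply Cmod_ge_0).
        nra. }
      rewrite exp_Ropp. apply (Rmult_le_reg_l (exp A)); [assumption|].
      replace (exp A * (S * / exp A)) with S by (field; lra). assumption. }
  assert (E1 : Cmod (zero_product lam e N c) * Cmod (g c) = 1).
  { rewrite <- Cmod_mult, <- Hgg, Hgc, Ha1. apply Cmod_1. }
  rewrite Cmod_zero_product in E1 by (intros m Hm E; now apply (proj1 (He m Hm))).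
  set (B := rsum (fun m => INR (e m) * ln (Cmod (c - lam m))) N) in *.
  assert (E2 : rsum (fun m => INR (e m) * ln (r / Cmod (lam m - c))) N = A - B).
  { unfold A, B. replace (rsum (fun m => INR (e m) * ln r) N - rsum (fun m => INR (e m) * ln (Cmod (c - lam m))) N)
      with (rsum (fun m => INR (e m) * ln r) N + (-1) * rsum (fun m => INR (e m) * ln (Cmod (c - lam m))) N) by ring.
    rewrite <- rsum_scal, <- rsum_plus. apply rsum_ext. intros m _.
    destruct (e m) as [|k] eqn:E; [simpl; ring|].
    rewrite (Cmod_minus_sym c). rewrite ln_div_eq; [ring|lra|].
    apply Cmod_gt_0, Csub_neq0, He. lia. }
  rewrite E2.
  pose proof (exp_pos B).
  assert (K : 1 <= exp B * (S * exp (- A))) by (rewrite <- E1; apply Rmult_le_compat_l; lra).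
  assert (exp (A - B) <= S).
  { unfold Rminus. rewrite exp_plus, exp_Ropp. rewrite exp_Ropp in K.
    pose proof (exp_pos A).
    apply (Rmult_le_reg_l (exp B * / exp A)).
    { apply Rmult_lt_0_compat; [assumption|now apply Rinv_0_lt_compat]. }
    replace (exp B * / exp A * (exp A * / exp B)) with 1 by (field; lra). lra. }
  rewrite <- (ln_exp (A - B)). apply ln_le; [apply exp_pos|assumption].
Qed.

Definition near_mult (lam : nat -> C) (mu : nat -> nat) (n m : nat) : nat :=
  if Nat.eq_dec m n then O
  else if Rle_dec (Cmod (lam m - lam n)) (Cmod (lam n) / 2) then mu m else O.

(** Jensen's integrated counting function of the other nodes, with centre lam_n and radius |lam_n| /
    2, truncated at index N. *)
Definition crowding (lam : nat -> C) (mu : nat -> nat) (n N : nat) : R :=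
  rsum (fun m => INR (near_mult lam mu n m) * ln (Cmod (lam n) / 2 / Cmod (lam m - lam n))) N.

Lemma near_mult_pos lam mu n m : (0 < near_mult lam mu n m)%nat ->
  m <> n /\ Cmod (lam m - lam n) <= Cmod (lam n) / 2 /\ near_mult lam mu n m = mu m.
Proof.
  unfold near_mult. destruct (Nat.eq_dec m n); [lia|].
  destruct (Rle_dec (Cmod (lam m - lam n)) (Cmod (lam n) / 2)); [auto|lia].
Qed.

Lemma ln_nonneg x : 1 <= x -> 0 <= ln x.
Proof. intro H. rewrite <- ln_1. apply ln_le; lra. Qed.

Lemma crowding_term_nonneg lam mu n m : (forall n m, n <> m -> lam n <> lam m) ->
  0 <= INR (near_mult lam mu n m) * ln (Cmod (lam n) / 2 / Cmod (lam m - lam n)).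
Proof.
  intro Hinj. destruct (near_mult lam mu n m) as [|k] eqn:E; [simpl; lra|].
  destruct (near_mult_pos lam mu n m) as [H1 [H2 _]]; [lia|].
  assert (0 < Cmod (lam m - lam n)) by (apply Cmod_gt_0, Csub_neq0, Hinj; exact H1).
  apply Rmult_le_pos; [apply pos_INR|]. apply ln_nonneg.
  apply (Rmult_le_reg_r (Cmod (lam m - lam n))); [assumption|].
  unfold Rdiv at 1. rewrite Rmult_assoc, Rinv_l; lra.
Qed.

(** For a fixed n only nodes with |lam_m| <= 3/2 |lam_n| contribute, and these are finitely many, so
    the sums over m stabilise. *)
Lemma crowding_bounded lam mu n0 : multiplicity_sequence lam mu ->
  exists C0, forall n N, (n < n0)%nat -> crowding lam mu n N <= C0.
Proof.
  intros [Hinj [_ [Hlim _]]]. induction n0 as [|n0 [C0 IH]].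
  - exists 0. intros n N H. lia.
  - assert (HL := Hlim). apply is_lim_seq_spec in HL.
    destruct (HL (2 * Cmod (lam n0))) as [m0 Hm0].
    exists (Rmax C0 (crowding lam mu n0 m0)). intros n N Hn.
    destruct (Nat.eq_dec n n0) as [E|E].
    + subst n. eapply Rle_trans; [|apply Rmax_r]. unfold crowding. apply rsum_stable.
      * intro i. now apply crowding_term_nonneg.
      * intros i Hi. destruct (near_mult lam mu n0 i) as [|k] eqn:E; [simpl; ring|exfalso].
        destruct (near_mult_pos lam mu n0 i) as [H1 [H2 _]]; [lia|].
        specialize (Hm0 i Hi).
        pose proof (Cmod_triangle (lam i - lam n0) (lam n0)) as T.
        replace (lam i - lam n0 + lam n0)%C with (lam i) in T by ring.
        pose proof (Cmod_ge_0 (lam n0)). lra.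
    + eapply Rle_trans; [apply IH; lia|apply Rmax_l].
Qed.

Lemma sum_n_last (g : nat -> R) p : (forall k, (k < p)%nat -> g k = 0) -> sum_n g p = g p.
Proof.
  intro H. destruct p as [|p]; [apply sum_O|]. rewrite sum_Sn.
  replace (sum_n g p) with 0; [apply Rplus_0_l|].
  assert (K : forall q, (q <= p)%nat -> sum_n g q = 0).
  { induction q as [|q IH]; intro Hq.
    - rewrite sum_O. apply H. lia.
    - rewrite sum_Sn, IH, H by lia. apply Rplus_0_l. }
  symmetry. apply K. lia.
Qed.

(* Argue by contradiction along a lacunary sequence of exponents violating the bound:
   interpolate 1 at the top derivative there and 0 at all other nodes. *)
Lemma crowding_bound lam mu : multiplicity_sequence lam mu -> interpolating_variety lam mu ->
  forall eps, 0 < eps -> exists C0, forall n N, crowding lam mu n N <= eps * Cmod (lam n) + C0.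
Proof.
  intros Hms Hint eps He. apply NNPP. intro Hno.
  (* Violations of the bound occur beyond every index, since the finitely many smaller n can be
     absorbed into the constant. *)
  assert (Hbad : forall n0 C0, exists n, (n0 <= n)%nat /\
            exists N, eps * Cmod (lam n) + C0 < crowding lam mu n N).
  { intros n0 C0. apply NNPP. intro Hn.
    destruct (crowding_bounded lam mu n0 Hms) as [C1 HC1].
    apply Hno. exists (Rmax C0 C1). intros n N.
    pose proof (Cmod_ge_0 (lam n)).
    destruct (Nat.lt_ge_cases n n0) as [L|L].
    - specialize (HC1 n N L). pose proof (Rmax_r C0 C1). nra.
    - pose proof (Rmax_l C0 C1).
      destruct (Rle_dec (crowding lam mu n N) (eps * Cmod (lam n) + C0)) as [K|K]; [lra|].
      exfalso. apply Hn. exists n. split; [exact L|]. exists N. lra. }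
  pose proof Hms as [Hinj [Hnz [Hlim [_ Hmu]]]].
  assert (Hthr : forall x : R, exists n0, forall n, (n0 <= n)%nat -> x < Cmod (lam n)).
  { intro x. assert (HL := Hlim). apply is_lim_seq_spec in HL.
    destruct (HL x) as [n0 H]. exists n0. exact H. }
  assert (Hpick : forall (x : R) (i : nat), exists n, x < Cmod (lam n) /\
            exists N, eps * Cmod (lam n) + INR i < crowding lam mu n N).
  { intros x i. destruct (Hthr x) as [n0 Hn0]. destruct (Hbad n0 (INR i)) as [n [Hn HN]].
    exists n. auto. }
  set (pick := fun x i => proj1_sig (constructive_indefinite_description _ (Hpick x i))).
  assert (Hpk : forall x i, x < Cmod (lam (pick x i)) /\
            exists N, eps * Cmod (lam (pick x i)) + INR i < crowding lam mu (pick x i) N).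
  { intros x i. unfold pick. destruct (constructive_indefinite_description _ (Hpick x i)). exact a. }
  clearbody pick.
  (* A node near lam_n has modulus between 1/2 and 3/2 of |lam_n|, so the ratio 4 keeps the chosen
     nodes out of each other's neighbourhoods. Starting above 1 provides the hypothesis [1 <= 2 * r]
     of [zeros_near_centre]. *)
  set (s := fix s i := match i with O => pick 1 O | S j => pick (4 * Cmod (lam (s j)) + 1) (S j) end).
  assert (Hs1 : forall i, 1 < Cmod (lam (s i))).
  { intro i. destruct i as [|i]; simpl; [apply Hpk|].
    pose proof (proj1 (Hpk (4 * Cmod (lam (s i)) + 1) (S i))).
    pose proof (Cmod_ge_0 (lam (s i))). lra. }
  assert (Hs2 : forall i, exists N, eps * Cmod (lam (s i)) + INR i < crowding lam mu (s i) N).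
  { intro i. destruct i as [|i]; apply Hpk. }
  assert (Hs3 : forall i j, (i < j)%nat -> 4 * Cmod (lam (s i)) < Cmod (lam (s j))).
  { intros i j L. induction L as [|j L IH].
    - simpl. pose proof (proj1 (Hpk (4 * Cmod (lam (s i)) + 1) (S i))). lra.
    - change (s (S j)) with (pick (4 * Cmod (lam (s j)) + 1) (S j)).
      pose proof (proj1 (Hpk (4 * Cmod (lam (s j)) + 1) (S j))).
      pose proof (Cmod_ge_0 (lam (s j))). lra. }
  (* Only the top coefficient is prescribed to be 1, so f vanishes at a chosen node to order exactly
     mu_n - 1, and at a near node to order at least mu_m. The data are bounded by 1, hence
     admissible for every eps. *)
  set (dat := fun n k => if excluded_middle_informative ((exists i, n = s i) /\ k = pred (mu n))
                         then RtoC 1 else RtoC 0).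
  assert (Hdat : forall n k, Cmod (dat n k) <= 1).
  { intros n k. unfold dat. destruct (excluded_middle_informative _); rewrite ?Cmod_1, ?Cmod_0; lra. }
  assert (Hdat0 : forall n k, k <> pred (mu n) -> dat n k = 0%C).
  { intros n k Hk. unfold dat. destruct (excluded_middle_informative _) as [[_ K]|]; tauto. }
  destruct (Hint dat) as [f [df [Hent [HA0 Hval]]]].
  { intros e Hep. exists 1. intro n.
    rewrite sum_n_last.
    2:{ intros k Hk. rewrite Hdat0 by lia. apply Cmod_0. }
    specialize (Hdat n (pred (mu n))). pose proof (Cmod_ge_0 (dat n (pred (mu n)))).
    assert (0 < exp (- e * Cmod (lam n)) <= 1).
    { split; [apply exp_pos|]. rewrite <- exp_0. apply exp_le_compat. pose proof (Cmod_ge_0 (lam n)). nra. }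
    nra. }
  destruct (smooth_entire f df Hent) as [Hsm Htay].
  assert (Hcoef : forall n k, (k < mu n)%nat -> (df k (lam n) * / INR (fact k))%C = dat n k).
  { intros n k Hk. rewrite <- (Hval n k Hk). f_equal.
    change (/ INR (fact k), 0) with (RtoC (/ INR (fact k))). rewrite RtoC_inv by apply INR_fact_neq_0. reflexivity. }
  (* With r = |lam_n| / 2 the disc of radius 4 r around lam_n lies in |z| <= 3 |lam_n|, which turns
     eps / 3 into eps. *)
  destruct (HA0 (eps / 3)) as [M HM]; [lra|].
  set (M1 := Rmax M 1). assert (HM1 : 1 <= M1) by apply Rmax_r.
  (* The i-th violator exceeds the bound by i, and this outgrows the constant ln M1. *)
  destruct (INR_unbounded (ln M1)) as [i Hi].
  destruct (Hs2 i) as [N HN]. set (n := s i) in *.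
  specialize (Hs1 i). fold n in Hs1.
  assert (Hle : crowding lam mu n N <= ln (M1 * exp (eps * Cmod (lam n)))).
  { unfold crowding.
    apply (zeros_near_centre lam (near_mult lam mu n) f (lam n) (pred (mu n))
             (fun j => (df j (lam n) * / INR (fact j))%C)).
    - exact Hinj.
    - exact Hsm.
    - intro m. eexists. split; [apply Htay|]. intros j Hj.
      destruct (near_mult_pos lam mu n m) as [H1 [H2 H3]]; [lia|].
      rewrite H3 in Hj. rewrite Hcoef by exact Hj.
      unfold dat. destruct (excluded_middle_informative _) as [[[j' Ej'] _]|]; [exfalso|reflexivity].
      pose proof (Cmod_triangle (lam m - lam n) (lam n)) as T.
      replace (lam m - lam n + lam n)%C with (lam m) in T by ring.
      pose proof (Cmod_triangle (lam n - lam m) (lam m)) as T'.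
      replace (lam n - lam m + lam m)%C with (lam n) in T' by ring.
      rewrite (Cmod_minus_sym (lam n)) in T'.
      destruct (Nat.lt_total i j') as [L|[L|L]].
      + specialize (Hs3 i j' L). fold n in Hs3. rewrite <- Ej' in Hs3. lra.
      + subst j'. tauto.
      + specialize (Hs3 j' i L). fold n in Hs3. rewrite <- Ej' in Hs3. lra.
    - apply Htay.
    - intros j Hj. rewrite Hcoef by (specialize (Hmu n); lia). apply Hdat0. lia.
    - rewrite Hcoef by (specialize (Hmu n); lia). unfold dat.
      destruct (excluded_middle_informative _) as [|K]; [reflexivity|].
      exfalso. apply K. split; [now exists i|reflexivity].
    - intros m Hm. destruct (near_mult_pos lam mu n m Hm) as [H1 [H2 _]].
      split; [now apply Hinj|exact H2].
    - lra.
    - pose proof (exp_pos (eps * Cmod (lam n))). nra.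
    - intros z Hz.
      assert (Cmod z <= 3 * Cmod (lam n)).
      { replace z with ((z - lam n) + lam n)%C by ring.
        eapply Rle_trans; [apply Cmod_triangle|]. lra. }
      eapply Rle_trans; [apply HM|]. apply Rle_trans with (M1 * exp (eps / 3 * Cmod z)).
      + apply Rmult_le_compat_r; [apply Rlt_le, exp_pos|apply Rmax_l].
      + apply Rmult_le_compat_l; [lra|]. apply exp_le_compat. nra. }
  rewrite ln_mult, ln_exp in Hle by (try apply exp_pos; lra). lra.
Qed.

(** * Difference operators on exponential polynomials *)

Lemma cexp_plus z w : cexp (z + w) = (cexp z * cexp w)%C.
Proof.
  destruct z as [a b], w as [c d]. unfold cexp, Cmult, Cplus; simpl.
  rewrite exp_plus, cos_plus, sin_plus. f_equal; ring.
Qed.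

Lemma Cmod_cexp z : Cmod (cexp z) = exp (Re z).
Proof.
  unfold Cmod, cexp; simpl.
  replace (exp (Re z) * cos (Im z) * (exp (Re z) * cos (Im z) * 1) +
           exp (Re z) * sin (Im z) * (exp (Re z) * sin (Im z) * 1))
    with (exp (Re z) * exp (Re z) * (sin (Im z) * sin (Im z) + cos (Im z) * cos (Im z))) by ring.
  pose proof (sin2_cos2 (Im z)) as E. unfold Rsqr in E. rewrite E, Rmult_1_r.
  apply sqrt_square. apply Rlt_le, exp_pos.
Qed.

(* A polynomial of degree < d is a coefficient sequence read up to index d; entries beyond
   d are ignored by hev and hnorm. *)
Fixpoint hev (d : nat) (a : nat -> C) (x : R) : C :=
  match d with
  | O => 0%C
  | S d => (a O + x * hev d (fun i => a (S i)) x)%C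
  end.

(** The norm sum |a_i| t^i. A large weight t makes translations small perturbations of the
    identity. *)
Fixpoint hnorm (t : R) (d : nat) (a : nat -> C) : R :=
  match d with
  | O => 0
  | S d => Cmod (a O) + t * hnorm t d (fun i => a (S i))
  end.

(** Coefficients of p(x + b): if p = a_0 + x r, then p(x + b) = a_0 + (x + b) r(x + b), and q holds
    the coefficients of r(x + b). *)
Fixpoint hshift (b : R) (d : nat) (a : nat -> C) : nat -> C :=
  match d with
  | O => fun _ => 0%C
  | S d => fun i =>
      let q := hshift b d (fun i => a (S i)) in
      ((match i with O => a O | S j => q j end) + b * q i)%C
  end.

Lemma hev_ext d : forall a a' x, (forall i, (i < d)%nat -> a i = a' i) -> hev d a x = hev d a' x.
Proof.
  induction d as [|d IH]; intros a a' x H; simpl; [reflexivity|].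
  rewrite H by lia. f_equal. f_equal. apply IH. intros i Hi. apply H. lia.
Qed.

Lemma hev_lin (al be : C) d : forall a a' x,
  hev d (fun i => al * a i + be * a' i)%C x = (al * hev d a x + be * hev d a' x)%C.
Proof.
  induction d as [|d IH]; intros a a' x; simpl; [ring|].
  rewrite (IH (fun i => a (S i)) (fun i => a' (S i))). ring.
Qed.

Lemma hev_trunc d : forall (a : nat -> C) x, a d = 0%C -> hev (S d) a x = hev d a x.
Proof.
  induction d as [|d IH]; intros a x H.
  - simpl. rewrite H. ring.
  - change (hev (S (S d)) a x) with (a O + x * hev (S d) (fun i => a (S i)) x)%C.
    rewrite IH by exact H. reflexivity.
Qed.

Lemma hshift_deg b d : forall a i, (d <= i)%nat -> hshift b d a i = 0%C.
Proof.
  induction d as [|d IH]; intros a i H; simpl; [reflexivity|].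
  destruct i as [|i]; [lia|]. rewrite !IH by lia. ring.
Qed.

Lemma hshift_top b d : forall a, hshift b (S d) a d = a d.
Proof.
  induction d as [|d IH]; intro a.
  - simpl. ring.
  - change (hshift b (S (S d)) a (S d)) with
      (hshift b (S d) (fun i => a (S i)) d + b * hshift b (S d) (fun i => a (S i)) (S d))%C.
    rewrite IH, hshift_deg by lia. ring.
Qed.

Lemma hev_shift b d : forall a x, hev d (hshift b d a) x = hev d a (x + b).
Proof.
  induction d as [|d IH]; intros a x; [reflexivity|].
  set (q := hshift b d (fun i => a (S i))).
  assert (Hq : hev (S d) q x = hev d q x) by (apply hev_trunc, hshift_deg; lia).
  change (hev (S d) q x) with (q O + x * hev d (fun i => q (S i)) x)%C in Hq.
  change (hev (S d) (hshift b (S d) a) x) with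
    ((a O + b * q O) + x * hev d (fun i => q i + b * q (S i)) x)%C.
  rewrite (hev_ext d _ (fun i => 1 * q i + b * (fun j => q (S j)) i)%C) by (intros; ring).
  rewrite hev_lin. simpl. rewrite <- IH, RtoC_plus. fold q.
  replace (a O + b * q O + x * (1 * hev d q x + b * hev d (fun j => q (S j)) x))%C
    with (a O + x * hev d q x + b * (q O + x * hev d (fun i => q (S i)) x))%C by ring.
  rewrite Hq. ring.
Qed.

Lemma hnorm_ext t d : forall a a', (forall i, (i < d)%nat -> a i = a' i) -> hnorm t d a = hnorm t d a'.
Proof.
  induction d as [|d IH]; intros a a' H; simpl; [reflexivity|].
  rewrite H by lia. f_equal. f_equal. apply IH. intros i Hi. apply H. lia.
Qed.

Lemma hnorm_ge_0 t d : 0 <= t -> forall a, 0 <= hnorm t d a.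
Proof.
  intros Ht. induction d as [|d IH]; intro a; simpl; [lra|].
  specialize (IH (fun i => a (S i))). pose proof (Cmod_ge_0 (a O)). nra.
Qed.

Lemma hnorm_trunc t d : forall (a : nat -> C), a d = 0%C -> hnorm t (S d) a = hnorm t d a.
Proof.
  induction d as [|d IH]; intros a H.
  - simpl. rewrite H, Cmod_0. ring.
  - change (hnorm t (S (S d)) a) with (Cmod (a O) + t * hnorm t (S d) (fun i => a (S i))).
    rewrite IH by exact H. reflexivity.
Qed.

Lemma hnorm_plus t d : 0 <= t -> forall a a',
  hnorm t d (fun i => a i + a' i)%C <= hnorm t d a + hnorm t d a'.
Proof.
  intro Ht. induction d as [|d IH]; intros a a'; simpl; [lra|].
  specialize (IH (fun i => a (S i)) (fun i => a' (S i))).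
  pose proof (Cmod_triangle (a O) (a' O)). nra.
Qed.

Lemma hnorm_scal t d (c : C) : forall a, hnorm t d (fun i => c * a i)%C = Cmod c * hnorm t d a.
Proof.
  induction d as [|d IH]; intro a; simpl; [ring|].
  rewrite Cmod_mult, (IH (fun i => a (S i))). ring.
Qed.

(** Translation sends x^i to (x + b)^i, whose norm is (t + b)^i, so subtracting x^i leaves t^i ((1 +
    b/t)^i - 1). The induction runs this through the Horner recursion. *)
Lemma hnorm_shift_diff t b d : 0 < t -> 0 <= b -> forall a,
  hnorm t d (fun i => hshift b d a i - a i)%C <= ((1 + b / t) ^ d - 1) * hnorm t d a.
Proof.
  intros Ht Hb. induction d as [|d IH]; intro a; [simpl; lra|].
  set (tl := fun i => a (S i)). set (q := hshift b d tl).
  specialize (IH tl). fold q in IH.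
  set (h := hnorm t d tl) in *.
  assert (Hh : 0 <= h) by (apply hnorm_ge_0; lra).
  assert (Hq : hnorm t d q <= (1 + b / t) ^ d * h).
  { rewrite (hnorm_ext t d q (fun i => (fun j => q j - tl j) i + tl i)%C) by (intros; ring).
    eapply Rle_trans; [apply hnorm_plus; lra|]. fold h. lra. }
  assert (Htr : hnorm t (S d) q = hnorm t d q) by (apply hnorm_trunc, hshift_deg; lia).
  change (hnorm t (S d) q) with (Cmod (q O) + t * hnorm t d (fun i => q (S i))) in Htr.
  change (hnorm t (S d) (fun i => hshift b (S d) a i - a i)%C) with
    (Cmod (a O + b * q O - a O) + t * hnorm t d (fun i => q i + b * q (S i) - tl i)%C).
  replace (a O + b * q O - a O)%C with (b * q O)%C by ring.
  rewrite Cmod_mult, Cmod_R, Rabs_pos_eq by exact Hb.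
  assert (E : hnorm t d (fun i => q i + b * q (S i) - tl i)%C
     <= hnorm t d (fun i => q i - tl i)%C + b * hnorm t d (fun i => q (S i))).
  { rewrite (hnorm_ext t d _ (fun i => (fun j => q j - tl j) i + (fun j => b * q (S j)) i)%C) by (intros; ring).
    eapply Rle_trans; [apply hnorm_plus; lra|].
    rewrite (hnorm_scal t d b (fun j => q (S j))), Cmod_R, Rabs_pos_eq by exact Hb. lra. }
  assert (E2 : t * hnorm t d (fun i => q i + b * q (S i) - tl i)%C
     <= t * (((1 + b / t) ^ d - 1) * h) + t * (b * hnorm t d (fun i => q (S i)))).
  { rewrite <- Rmult_plus_distr_l. apply Rmult_le_compat_l; lra. }
  assert (E3 : b * Cmod (q O) + t * (b * hnorm t d (fun i => q (S i))) <= b * ((1 + b / t) ^ d * h)).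
  { replace (b * Cmod (q O) + t * (b * hnorm t d (fun i => q (S i)))) with (b * hnorm t d q)
      by (rewrite <- Htr; ring).
    apply Rmult_le_compat_l; assumption. }
  change (hnorm t (S d) a) with (Cmod (a O) + t * h).
  assert (Hp : 1 <= (1 + b / t) ^ S d).
  { apply pow_R1_Rle. assert (0 <= b / t) by (apply Rdiv_le_0_compat; lra). lra. }
  pose proof (Cmod_ge_0 (a O)).
  assert (E4 : t * (((1 + b / t) ^ d - 1) * h) + b * ((1 + b / t) ^ d * h)
     = ((1 + b / t) ^ S d - 1) * (t * h)) by (simpl; field; lra).
  nra.
Qed.

Record op := Op { op_al : C; op_be : C; op_s : nat }.

Definition app1 (eta : R) (o : op) (f : R -> C) (x : R) : C :=
  (op_al o * f x + op_be o * f (x + INR (op_s o) * eta)%R)%C.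

Fixpoint opapp (eta : R) (l : list op) (f : R -> C) : R -> C :=
  match l with
  | [] => f
  | o :: l => opapp eta l (app1 eta o f)
  end.

(** The operator of [app1] on lattice samples. Energies are sums over one period, so this version
    acts on periodic sequences. *)
Definition appN1 (o : op) (f : nat -> C) (q : nat) : C :=
  (op_al o * f q + op_be o * f (q + op_s o)%nat)%C.

Fixpoint appN (l : list op) (f : nat -> C) : nat -> C :=
  match l with
  | [] => f
  | o :: l => appN l (appN1 o f)
  end.

Fixpoint width (l : list op) : nat :=
  match l with
  | [] => O
  | o :: l => (op_s o + width l)%nat
  end.

Lemma app_cat eta l1 : forall l2 f, opapp eta (l1 ++ l2) f = opapp eta l2 (opapp eta l1 f).
Proof. induction l1 as [|o l1 IH]; intros l2 f; simpl; auto. Qed.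

Lemma appN_cat l1 : forall l2 f, appN (l1 ++ l2) f = appN l2 (appN l1 f).
Proof. induction l1 as [|o l1 IH]; intros l2 f; simpl; auto. Qed.

Lemma width_cat l1 l2 : width (l1 ++ l2) = (width l1 + width l2)%nat.
Proof. induction l1 as [|o l1 IH]; simpl; lia. Qed.

(** An operator list of width w reads at most w samples ahead. As long as it stays inside the window
    of length Q, the periodic extension of the samples is invisible. *)
Lemma appN_sample eta x0 l : forall (f : R -> C) (g : nat -> C) Q,
  (forall q, (q < Q)%nat -> g q = f (x0 + INR q * eta)) ->
  forall q, (q + width l < Q)%nat -> appN l g q = opapp eta l f (x0 + INR q * eta).
Proof.
  induction l as [|o l IH]; intros f g Q H q Hq; simpl in *.
  - apply H. lia.
  - apply (IH (app1 eta o f) (appN1 o g) (Q - op_s o)%nat); [|lia].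
    intros q' Hq'. unfold appN1, app1. rewrite !H by lia.
    rewrite plus_INR. do 3 f_equal. ring.
Qed.

Lemma app_ext eta l : forall f g, (forall x, f x = g x) -> forall x, opapp eta l f x = opapp eta l g x.
Proof.
  induction l as [|o l IH]; intros f g H x; simpl; [apply H|].
  apply IH. intro y. unfold app1. now rewrite !H.
Qed.

Lemma app_plus eta l : forall f g x,
  opapp eta l (fun y => f y + g y)%C x = (opapp eta l f x + opapp eta l g x)%C.
Proof.
  induction l as [|o l IH]; intros f g x; simpl; [reflexivity|].
  rewrite <- IH. apply app_ext. intro y. unfold app1. ring.
Qed.

Definition expoly (lam : C) (d : nat) (f : R -> C) : Prop :=
  exists a, forall x : R, f x = (hev d a x * cexp (x * lam))%C.

Definition op_coef (eta : R) (lam : C) (d : nat) (o : op) (a : nat -> C) : nat -> C :=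
  fun i => (op_al o * a i + op_be o * cexp ((INR (op_s o) * eta)%R * lam)
             * hshift (INR (op_s o) * eta) d a i)%C.

Lemma app1_expoly eta lam d o a f : (forall x : R, f x = (hev d a x * cexp (x * lam))%C) ->
  forall x : R, app1 eta o f x = (hev d (op_coef eta lam d o a) x * cexp (x * lam))%C.
Proof.
  intros H x. unfold app1, op_coef. rewrite !H.
  rewrite hev_lin, hev_shift.
  replace ((x + INR (op_s o) * eta)%R * lam)%C with (x * lam + (INR (op_s o) * eta)%R * lam)%C
    by (rewrite RtoC_plus; ring).
  rewrite cexp_plus. ring.
Qed.

Lemma expoly_app1 eta lam d o f : expoly lam d f -> expoly lam d (app1 eta o f).
Proof. intros [a H]. exists (op_coef eta lam d o a). now apply app1_expoly. Qed.

Lemma expoly_app eta lam d l : forall f, expoly lam d f -> expoly lam d (opapp eta l f).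
Proof.
  induction l as [|o l IH]; intros f H; simpl; [exact H|]. now apply IH, expoly_app1.
Qed.

Definition op_symbol (eta : R) (lam : C) (o : op) : C :=
  (op_al o + op_be o * cexp ((INR (op_s o) * eta)%R * lam))%C.

(** Translation preserves the leading coefficient, so the operator multiplies it by the symbol; a
    vanishing symbol lowers the degree by one. *)
Lemma expoly_kill1 eta lam d o f : op_symbol eta lam o = 0%C ->
  expoly lam (S d) f -> expoly lam d (app1 eta o f).
Proof.
  intros Ho [a H]. exists (op_coef eta lam (S d) o a). intro x.
  rewrite (app1_expoly eta lam (S d) o a f H). f_equal. apply hev_trunc.
  unfold op_coef. rewrite hshift_top. unfold op_symbol in Ho.
  rewrite <- Cmult_plus_distr_r, Ho. ring.
Qed.

Lemma expoly_kill eta lam d l : (exists o, In o l /\ op_symbol eta lam o = 0%C) ->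
  forall f, expoly lam (S d) f -> expoly lam d (opapp eta l f).
Proof.
  induction l as [|o l IH]; intros [o' [Hin Ho]] f Hf; [destruct Hin|].
  destruct Hin as [->|Hin]; simpl.
  - now apply expoly_app, expoly_kill1.
  - apply IH; [now exists o'|]. now apply expoly_app1.
Qed.

(** On coefficient sequences the operator is its symbol times the identity plus a multiple of
    translation minus identity. This is the modulus of the symbol minus the bound of
    [hnorm_shift_diff] for the second part. *)
Definition op_low (eta : R) (lam : C) (d : nat) (t : R) (o : op) : R :=
  Cmod (op_symbol eta lam o)
  - Cmod (op_be o * cexp ((INR (op_s o) * eta)%R * lam)) * ((1 + INR (op_s o) * eta / t) ^ d - 1).

Lemma op_coef_low eta lam d t o a : 0 < t -> 0 <= eta ->
  op_low eta lam d t o * hnorm t d a <= hnorm t d (op_coef eta lam d o a).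
Proof.
  intros Ht Heta. set (b := INR (op_s o) * eta).
  assert (Hb : 0 <= b) by (apply Rmult_le_pos; [apply pos_INR|exact Heta]).
  set (w := (op_be o * cexp (b * lam))%C).
  assert (E : hnorm t d (fun i => op_symbol eta lam o * a i)%C
    <= hnorm t d (op_coef eta lam d o a) + hnorm t d (fun i => - w * (hshift b d a i - a i))%C).
  { rewrite (hnorm_ext t d _ (fun i => op_coef eta lam d o a i + (fun j => - w * (hshift b d a j - a j)) i)%C).
    - apply hnorm_plus. lra.
    - intros i _. unfold op_coef, op_symbol, w, b. ring. }
  rewrite hnorm_scal in E.
  rewrite (hnorm_scal t d (- w) (fun i => hshift b d a i - a i)%C), Cmod_opp in E.
  pose proof (hnorm_shift_diff t b d Ht Hb a) as D.
  pose proof (Cmod_ge_0 w).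
  assert (Cmod w * hnorm t d (fun i => hshift b d a i - a i)%C <= Cmod w * (((1 + b / t) ^ d - 1) * hnorm t d a))
    by (apply Rmult_le_compat_l; assumption).
  unfold op_low. fold b. fold w. nra.
Qed.

Lemma app_low eta lam d t ell : 0 < t -> 0 <= eta -> 0 <= ell -> forall l,
  (forall o, In o l -> ell <= op_low eta lam d t o) ->
  forall f a, (forall x : R, f x = (hev d a x * cexp (x * lam))%C) ->
  exists a', (forall x : R, opapp eta l f x = (hev d a' x * cexp (x * lam))%C) /\
    ell ^ (length l) * hnorm t d a <= hnorm t d a'.
Proof.
  intros Ht Heta Hell l. induction l as [|o l IH]; intros Hl f a Hf.
  - exists a. split; [exact Hf|]. simpl. lra.
  - destruct (IH (fun o' H => Hl o' (or_intror H)) (app1 eta o f) (op_coef eta lam d o a)) as [a' [H1 H2]].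
    { now apply app1_expoly. }
    exists a'. split; [exact H1|].
    eapply Rle_trans; [|exact H2]. simpl.
    replace (ell * ell ^ length l * hnorm t d a) with (ell ^ length l * (ell * hnorm t d a)) by ring.
    apply Rmult_le_compat_l; [now apply pow_le|].
    eapply Rle_trans; [|apply op_coef_low; assumption].
    apply Rmult_le_compat_r; [apply hnorm_ge_0; lra|]. apply Hl. now left.
Qed.

(** * Energy of periodic sequences *)

Definition periodic {T : Type} (Q : nat) (f : nat -> T) : Prop := forall q, f (q + Q)%nat = f q.

Definition energy (Q : nat) (f : nat -> C) : R := rsum (fun q => Cmod (f q) ^ 2) Q.

Lemma rsum_shift1 g Q : periodic Q g -> rsum (fun q => g (S q)) Q = rsum g Q.
Proof.
  intro H.
  assert (E : forall n, rsum (fun q => g (S q)) n = rsum g n + g n - g O).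
  { induction n as [|n IH]; simpl; [ring|]. rewrite IH. ring. }
  rewrite E. specialize (H O). simpl in H. rewrite H. ring.
Qed.

Lemma rsum_shift g Q s : periodic Q g -> rsum (fun q => g (q + s)%nat) Q = rsum g Q.
Proof.
  intro H. induction s as [|s IH].
  - apply rsum_ext. intros q _. now rewrite Nat.add_0_r.
  - rewrite <- IH. rewrite <- (rsum_shift1 (fun q => g (q + s)%nat)).
    + apply rsum_ext. intros q _. f_equal. lia.
    + intro q. rewrite <- (H (q + s)%nat). f_equal. lia.
Qed.

Lemma appN1_periodic Q o f : periodic Q f -> periodic Q (appN1 o f).
Proof.
  intros H q. unfold appN1. rewrite H.
  replace (q + Q + op_s o)%nat with (q + op_s o + Q)%nat by lia. now rewrite H.
Qed.

Lemma appN_periodic Q l : forall f, periodic Q f -> periodic Q (appN l f).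
Proof.
  induction l as [|o l IH]; intros f H; simpl; [exact H|]. now apply IH, appN1_periodic.
Qed.

Definition energy_bound (kap : R) (l : list op) : Prop :=
  forall Q f, periodic Q f -> energy Q (appN l f) <= kap * energy Q f.

Lemma energy_bound_cat k1 k2 l1 l2 : 0 <= k2 ->
  energy_bound k1 l1 -> energy_bound k2 l2 -> energy_bound (k1 * k2) (l1 ++ l2).
Proof.
  intros Hk H1 H2 Q f Hf. rewrite appN_cat.
  eapply Rle_trans; [apply H2; now apply appN_periodic|].
  specialize (H1 Q f Hf). rewrite (Rmult_comm k1), Rmult_assoc.
  now apply Rmult_le_compat_l.
Qed.

(** Convexity of the square, (A F + B G)^2 <= (A + B) (A F^2 + B G^2), keeps the two samples
    separate, and each of them sums to the energy by periodicity. *)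
Lemma energy_bound_single o : energy_bound ((Cmod (op_al o) + Cmod (op_be o)) ^ 2) [o].
Proof.
  intros Q f Hf. simpl appN.
  set (A := Cmod (op_al o)). set (B := Cmod (op_be o)).
  assert (HA : 0 <= A) by apply Cmod_ge_0. assert (HB : 0 <= B) by apply Cmod_ge_0.
  set (x := fun q => Cmod (f q) ^ 2).
  assert (Hx : periodic Q x) by (intro q; unfold x; now rewrite Hf).
  apply Rle_trans with (rsum (fun q => (A + B) * A * x q + (A + B) * B * x (q + op_s o)%nat) Q).
  - apply rsum_le. intros q _. unfold x, appN1.
    set (F := Cmod (f q)). set (G := Cmod (f (q + op_s o)%nat)).
    assert (T : Cmod (op_al o * f q + op_be o * f (q + op_s o)%nat) <= A * F + B * G).
    { eapply Rle_trans; [apply Cmod_triangle|]. rewrite !Cmod_mult. apply Rle_refl. }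
    apply Rle_trans with ((A * F + B * G) ^ 2).
    + apply pow_incr. split; [apply Cmod_ge_0|exact T].
    + assert (0 <= A * B * (F - G) ^ 2) by (apply Rmult_le_pos; [apply Rmult_le_pos; assumption|apply pow2_ge_0]).
      nra.
  - rewrite rsum_plus, !rsum_scal, (rsum_shift x Q _ Hx). unfold energy. fold x.
    right. ring.
Qed.

Definition half_sum (s : nat) (f : nat -> C) (q : nat) : C := (/ 2 * (f q + f (q + s)%nat))%C.
Definition half_diff (s : nat) (f : nat -> C) (q : nat) : C := (/ 2 * (f (q + s)%nat - f q))%C.

Lemma energy_ext Q f g : (forall q, f q = g q) -> energy Q f = energy Q g.
Proof. intro H. apply rsum_ext. intros q _. now rewrite H. Qed.

Lemma energy_ge_0 Q f : 0 <= energy Q f.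
Proof. apply rsum_nonneg. intros q _. apply pow_le, Cmod_ge_0. Qed.

Lemma half_periodic Q s f : periodic Q f -> periodic Q (half_sum s f) /\ periodic Q (half_diff s f).
Proof.
  intro H. split; intro q; unfold half_sum, half_diff;
    replace (q + Q + s)%nat with (q + s + Q)%nat by lia; now rewrite !H.
Qed.

(** The parallelogram law. In Fourier terms the two multipliers have moduli |cos| and |sin| of the
    same half-angle. *)
Lemma energy_parallelogram Q s f : periodic Q f ->
  energy Q (half_sum s f) + energy Q (half_diff s f) = energy Q f.
Proof.
  intro H. set (x := fun q => Cmod (f q) ^ 2).
  assert (Hx : periodic Q x) by (intro q; unfold x; now rewrite H).
  unfold energy. rewrite <- rsum_plus.
  rewrite (rsum_ext _ (fun q => / 2 * x q + / 2 * x (q + s)%nat)).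
  - rewrite rsum_plus, !rsum_scal, (rsum_shift x Q s Hx). unfold x. field.
  - intros q _. unfold x, half_sum, half_diff. rewrite !Cmod2_alt.
    rewrite <- RtoC_inv by lra.
    destruct (f q) as [a b], (f (q + s)%nat) as [c d]. simpl. field.
Qed.

Lemma half_comm s f q : half_diff s (half_sum s f) q = half_sum s (half_diff s f) q.
Proof. unfold half_diff, half_sum. ring. Qed.

(** At frequency theta the square of [half_diff] is - e^(i theta) sin^2(theta/2), so the operator
    has modulus |1 + a sin^2| <= 1 + sin^2, and squaring gives the three terms. The proof is the
    same computation without Fourier transform. *)
Lemma energy_skew Q s g (a : C) : periodic Q g -> Cmod a <= 1 ->
  energy Q (fun q => g (q + s)%nat - a * half_diff s (half_diff s g) q)%C
  <= energy Q g + 2 * energy Q (half_diff s g) + energy Q (half_diff s (half_diff s g)).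
Proof.
  intros H Ha. destruct a as [p r].
  (* J and I are the real and imaginary parts of the correlation of g with its shift. The sum of J
     is the energy of g minus twice that of [half_diff s g]; I enters only as I shifted minus I,
     which sums to zero over a period. *)
  set (J := fun q => Re (g (q + s)%nat * Cconj (g q))%C).
  set (I := fun q => Im (g (q + s)%nat * Cconj (g q))%C).
  set (x := fun q => Cmod (g q) ^ 2).
  assert (HJ : periodic Q J).
  { intro q. unfold J. replace (q + Q + s)%nat with (q + s + Q)%nat by lia. now rewrite !H. }
  assert (HI : periodic Q I).
  { intro q. unfold I. replace (q + Q + s)%nat with (q + s + Q)%nat by lia. now rewrite !H. }
  assert (Hx : periodic Q x) by (intro q; unfold x; now rewrite H).
  set (y := fun q => Cmod (half_diff s (half_diff s g) q) ^ 2).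
  assert (E1 : energy Q (half_diff s g) = / 2 * (energy Q g - rsum J Q)).
  { unfold energy. rewrite (rsum_ext _ (fun q => (/ 4 * x (q + s)%nat + / 4 * x q) + (- / 2) * J q)).
    - rewrite !rsum_plus, !rsum_scal, (rsum_shift x Q s Hx). unfold x. field.
    - intros q _. unfold x, J, half_diff. rewrite !Cmod2_alt. rewrite <- RtoC_inv by lra.
      destruct (g q) as [u v], (g (q + s)%nat) as [u' v']. simpl. field. }
  assert (E2 : energy Q (fun q => g (q + s)%nat - (p, r) * half_diff s (half_diff s g) q)%C
     = energy Q g + (p ^ 2 + r ^ 2) * energy Q (half_diff s (half_diff s g))
       + 2 * p * energy Q (half_diff s g)).
  { rewrite E1. unfold energy at 1.
    rewrite (rsum_ext _ (fun q => (x (q + s)%nat + (p ^ 2 + r ^ 2) * y q)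
       + ((- / 2 * p) * J q + (- / 2 * p) * J (q + s)%nat)
       + (p * x (q + s)%nat + ((- / 2 * r) * I q + (/ 2 * r) * I (q + s)%nat)))).
    - rewrite !rsum_plus, !rsum_scal, (rsum_shift x Q s Hx), (rsum_shift J Q s HJ), (rsum_shift I Q s HI).
      unfold energy. fold x. fold y. field.
    - intros q _. unfold x, y, J, I, half_diff. rewrite !Cmod2_alt. rewrite <- RtoC_inv by lra.
      destruct (g q) as [u v], (g (q + s)%nat) as [u' v'], (g (q + s + s)%nat) as [u'' v''].
      simpl. field. }
  rewrite E2.
  assert (Hpr : p ^ 2 + r ^ 2 <= 1).
  { pose proof (Cmod2_alt (p, r)) as E. simpl Re in E. simpl Im in E. rewrite <- E.
    pose proof (Cmod_ge_0 (p, r)). nra. }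
  assert (Hp : p <= 1) by nra.
  pose proof (energy_ge_0 Q (half_diff s g)).
  pose proof (energy_ge_0 Q (half_diff s (half_diff s g))). nra.
Qed.

(* The operator ((1+E)/2)^2 (VE-1)(V-E)/(V-1)^2 equals ((1+E)/2)^2 (E - a((E-1)/2)^2)
   with a = 4V/(V-1)^2; its symbol is 1 at E = 1, and |a| <= 1 makes it a contraction. *)
Definition far_block (V : C) (s : nat) : list op :=
  [Op (/ 2) (/ 2) s; Op (/ 2) (/ 2) s; Op (- / (V - 1)) (V / (V - 1)) s; Op (V / (V - 1)) (- / (V - 1)) s].

(** With the bound of [energy_skew], the multiplier is at most cos^2 (1 + sin^2) = 1 - sin^4 <= 1.
    The two averaging factors are in the block to compensate the growth 1 + sin^2 of the rest. *)
Lemma far_block_contraction V s : (V - 1)%C <> 0%C -> 4 * Cmod V <= Cmod (V - 1) ^ 2 ->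
  energy_bound 1 (far_block V s).
Proof.
  intros HV Ha Q f Hf. rewrite Rmult_1_l.
  set (a := (4 * V / ((V - 1) * (V - 1)))%C).
  assert (HV0 : 0 < Cmod (V - 1)) by now apply Cmod_gt_0.
  assert (Ca : Cmod a <= 1).
  { unfold a. rewrite Cmod_div, !Cmod_mult, Cmod_R, Rabs_pos_eq by (try lra; apply Cmult_neq_0; assumption).
    apply (Rmult_le_reg_r (Cmod (V - 1) * Cmod (V - 1))); [nra|].
    unfold Rdiv. rewrite Rmult_assoc, Rinv_l by nra. nra. }
  set (c := half_sum s). set (d := half_diff s).
  set (g := c (c f)).
  assert (Pg : forall h, periodic Q h -> periodic Q (c h) /\ periodic Q (d h)) by (intros; now apply half_periodic).
  assert (Hg : periodic Q g) by (apply Pg, Pg; exact Hf).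
  rewrite (energy_ext Q _ (fun q => g (q + s)%nat - a * d (d g) q)%C).
  2:{ intro q. unfold far_block, appN, appN1, g, a, c, d, half_sum, half_diff. simpl op_al; simpl op_be; simpl op_s.
      field. exact HV. }
  apply Rle_trans with (energy Q g + 2 * energy Q (d g) + energy Q (d (d g)));
    [apply energy_skew; assumption|].
  assert (PP : forall h, periodic Q h -> energy Q (c h) + energy Q (d h) = energy Q h)
    by (intros; now apply energy_parallelogram).
  assert (X1 : forall h, energy Q (d (c h)) = energy Q (c (d h))) by (intro h; apply energy_ext; intro; apply half_comm).
  assert (X2 : energy Q (d g) = energy Q (c (c (d f)))).
  { apply energy_ext. intro q. unfold g, c, d, half_sum, half_diff. ring. }
  assert (X3 : energy Q (d (d g)) = energy Q (c (c (d (d f))))).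
  { apply energy_ext. intro q. unfold g, c, d, half_sum, half_diff. ring. }
  (* Repeated parallelogram identities split the energy of f by powers of cos^2 and sin^2; the
     inequality is then linear in the pieces. *)
  pose proof (PP f Hf) as Y1.
  pose proof (PP (c f) (proj1 (Pg f Hf))) as Y2. rewrite X1 in Y2.
  pose proof (PP (d f) (proj2 (Pg f Hf))) as Y3.
  assert (Pcd : periodic Q (c (d f))) by (apply Pg, Pg; exact Hf).
  assert (Pdd : periodic Q (d (d f))) by (apply Pg, Pg; exact Hf).
  pose proof (PP (c (d f)) Pcd) as Y4. rewrite X1 in Y4.
  pose proof (PP (c (d (d f))) (proj1 (Pg _ Pdd))) as Y5.
  rewrite X2, X3.
  pose proof (energy_ge_0 Q (d (d f))). pose proof (energy_ge_0 Q (d (c (d (d f))))).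
  pose proof (energy_ge_0 Q (c (c (d (d f))))).
  change (c (c f)) with g in Y2. lra.
Qed.

(** * Newton interpolation at equispaced nodes *)

Fixpoint csum (f : nat -> C) (n : nat) : C :=
  match n with
  | O => 0%C
  | S n => (csum f n + f n)%C
  end.

Lemma csum_ext f g n : (forall i, (i < n)%nat -> f i = g i) -> csum f n = csum g n.
Proof. induction n as [|n IH]; intro H; simpl; [reflexivity|]. rewrite IH, H; auto. Qed.

Lemma csum_Sl f n : csum f (S n) = (f O + csum (fun i => f (S i)) n)%C.
Proof.
  induction n as [|n IH]; [simpl; ring|].
  change (csum f (S (S n))) with (csum f (S n) + f (S n))%C. rewrite IH. simpl. ring.
Qed.

Lemma csum_scal (a : C) f n : csum (fun i => a * f i)%C n = (a * csum f n)%C.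
Proof. induction n as [|n IH]; simpl; [ring|]. rewrite IH. ring. Qed.

Lemma csum_minus f g n : csum (fun i => f i - g i)%C n = (csum f n - csum g n)%C.
Proof. induction n as [|n IH]; simpl; [ring|]. rewrite IH. ring. Qed.

Lemma csum_0 (f : nat -> C) n : (forall i, (i < n)%nat -> f i = 0%C) -> csum f n = 0%C.
Proof. induction n as [|n IH]; intro H; simpl; [reflexivity|]. rewrite IH, H by auto. ring. Qed.

(** The binomial coefficient of q over i as a real number, by Pascal's rule. *)
Fixpoint bn (q i : nat) : R :=
  match i, q with
  | O, _ => 1
  | S _, O => 0
  | S i', S q' => bn q' i' + bn q' i
  end.

Lemma bn_0 q : bn q 0 = 1.
Proof. now destruct q. Qed.

Lemma bn_absorb q : forall i, (INR q - INR i) * bn q i = INR (S i) * bn q (S i).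
Proof.
  induction q as [|q IH]; intro i.
  - destruct i as [|i]; simpl bn; [simpl; ring|ring].
  - change (bn (S q) (S i)) with (bn q i + bn q (S i)). destruct i as [|i].
    + specialize (IH O). rewrite !bn_0 in *. rewrite S_INR. simpl INR in *. nra.
    + change (bn (S q) (S i)) with (bn q i + bn q (S i)).
      pose proof (IH i) as I1. pose proof (IH (S i)) as I2.
      rewrite !S_INR in *. nra.
Qed.

Lemma bn_absorb' q i : INR (S q) * bn q i = INR (S i) * bn (S q) (S i).
Proof.
  change (bn (S q) (S i)) with (bn q i + bn q (S i)).
  pose proof (bn_absorb q i) as H. rewrite !S_INR in *. nra.
Qed.

(** The coefficient [ep i] is the i-th forward difference of G at 0. Each difference doubles the
    bound and uses up one node. *)
Lemma binomial_inversion i : forall (ep : nat -> C) (G : nat -> C) M d,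
  (forall q, G q = csum (fun j => ep j * bn q j)%C d) ->
  (forall q, (q < d)%nat -> Cmod (G q) <= M) -> (i < d)%nat -> Cmod (ep i) <= 2 ^ i * M.
Proof.
  induction i as [|i IH]; intros ep G M d HG HM Hi.
  - destruct d as [|d]; [lia|].
    specialize (HM O Hi). rewrite HG, csum_Sl, csum_0 in HM by (intros; simpl; ring).
    simpl bn in HM. replace (ep O * 1 + 0)%C with (ep O) in HM by ring. simpl. lra.
  - destruct d as [|d]; [lia|].
    replace (2 ^ S i * M) with (2 ^ i * (2 * M)) by (simpl; ring).
    apply (IH (fun j => ep (S j)) (fun q => G (S q) - G q)%C (2 * M) d).
    + intro q. rewrite !HG, !csum_Sl, !bn_0.
      match goal with |- (?a + ?x - (?a + ?y))%C = _ => replace (a + x - (a + y))%C with (x - y)%C by ring end.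
      rewrite <- csum_minus. apply csum_ext. intros j _.
      change (bn (S q) (S j)) with (bn q j + bn q (S j)). rewrite RtoC_plus. ring.
    + intros q Hq. eapply Rle_trans; [apply Cmod_triangle_minus|].
      pose proof (HM (S q) ltac:(lia)). pose proof (HM q ltac:(lia)). lra.
    + lia.
Qed.

Fixpoint newton (y0 h : R) (d : nat) (e : nat -> C) (l : nat) (x : R) : C :=
  match d with
  | O => 0%C
  | S d => (e O + (x - (y0 + INR l * h))%R * newton y0 h d (fun i => e (S i)) (S l) x)%C
  end.

(** Each step divides by x - y for the next node y. In the norm with weight 1, multiplying the
    quotient back by x - y costs at most 1 + |y| <= Y, which becomes the weight on the Newton
    side. *)
Lemma newton_form y0 h Y d : forall a l,
  (forall q, (l <= q < l + d)%nat -> 1 + Rabs (y0 + INR q * h) <= Y) ->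
  exists e, (forall x, hev d a x = newton y0 h d e l x) /\ hnorm 1 d a <= hnorm Y d e.
Proof.
  induction d as [|d IH]; intros a l HY.
  - exists a. split; [reflexivity|simpl; lra].
  - set (y := y0 + INR l * h).
    (* Synthetic division: q_i = sum_j a_(i+1+j) y^j are the coefficients of the quotient by x -
       y. *)
    set (q := fun i => hev (d - i) (fun j => a (S (i + j))) y).
    assert (Hqd : q d = 0%C) by (unfold q; now rewrite Nat.sub_diag).
    assert (Hq : forall i, (i < d)%nat -> a (S i) = (q i - y * q (S i))%C).
    { intros i Hi. unfold q. replace (d - i)%nat with (S (d - S i)) by lia.
      simpl. rewrite Nat.add_0_r.
      rewrite (hev_ext (d - S i) (fun j => a (S (i + S j))) (fun j => a (S (S (i + j))))); [ring|].
      intros j _. do 2 f_equal. lia. }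
    assert (H0 : a O = (hev (S d) a y - y * q O)%C).
    { unfold q. rewrite Nat.sub_0_r. simpl. ring. }
    destruct (IH q (S l)) as [e [He1 He2]].
    { intros k Hk. apply HY. lia. }
    exists (fun i => match i with O => hev (S d) a y | S i => e i end). split.
    + intro x.
      change (newton y0 h (S d) (fun i => match i with O => hev (S d) a y | S i => e i end) l x)
        with (hev (S d) a y + (x - y)%R * newton y0 h d e (S l) x)%C.
      rewrite <- He1.
      assert (E : hev (S d) a x = (a O + x * hev d (fun i => 1 * q i + - y * q (S i)) x)%C).
      { simpl. do 2 f_equal. apply hev_ext. intros i Hi. rewrite Hq by exact Hi. ring. }
      rewrite E, (hev_lin 1 (- y)%C d q (fun i => q (S i)) x), H0.
      pose proof (hev_trunc d q x Hqd) as T. rewrite <- T at 2. simpl. rewrite RtoC_minus.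
      pose proof (hev_trunc d q x Hqd) as T'. simpl in T'.
      replace (hev d q x) with (q O + x * hev d (fun i => q (S i)) x)%C. ring.
    + change (hnorm Y (S d) (fun i => match i with O => hev (S d) a y | S i => e i end))
        with (Cmod (hev (S d) a y) + Y * hnorm Y d e).
      change (hnorm 1 (S d) a) with (Cmod (a O) + 1 * hnorm 1 d (fun i => a (S i))).
      rewrite H0 at 1.
      assert (E : hnorm 1 d (fun i => a (S i)) <= hnorm 1 d q + Rabs y * hnorm 1 d (fun i => q (S i))).
      { rewrite (hnorm_ext 1 d _ (fun i => q i + (fun j => - y * q (S j)) i)%C).
        - eapply Rle_trans; [apply hnorm_plus; lra|].
          rewrite (hnorm_scal 1 d (- y)%C (fun j => q (S j))), Cmod_opp, Cmod_R. lra.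
        - intros i Hi. rewrite Hq by exact Hi. ring. }
      pose proof (hnorm_trunc 1 d q Hqd) as T. simpl in T.
      pose proof (Cmod_triangle_minus (hev (S d) a y) (y * q O)) as T1.
      rewrite Cmod_mult, Cmod_R in T1.
      assert (HYl : 1 + Rabs y <= Y) by (apply HY; lia).
      pose proof (hnorm_ge_0 1 d Rle_0_1 q) as P.
      pose proof (Rabs_pos y).
      assert (E2 : (1 + Rabs y) * hnorm 1 d q <= Y * hnorm Y d e) by (apply Rmult_le_compat; lra).
      assert (E3 : Rabs y * (Cmod (q O) + 1 * hnorm 1 d (fun i => q (S i))) = Rabs y * hnorm 1 d q) by now rewrite T.
      lra.
Qed.

(** At the q-th node after the first one, the i-th Newton product equals h^i q (q-1) ... (q-i+1),
    that is h^i i! times the binomial coefficient. *)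
Lemma newton_values y0 h d : forall e l q,
  newton y0 h d e l (y0 + INR (l + q) * h)
  = csum (fun i => e i * (h ^ i * INR (fact i))%R * bn q i)%C d.
Proof.
  induction d as [|d IH]; intros e l q; [reflexivity|].
  rewrite csum_Sl, bn_0.
  replace (e O * (h ^ 0 * INR (fact 0))%R * 1)%C with (e O)
    by (simpl; rewrite Rmult_1_l; ring).
  change (newton y0 h (S d) e l (y0 + INR (l + q) * h))
    with (e O + (y0 + INR (l + q) * h - (y0 + INR l * h))%R
           * newton y0 h d (fun i => e (S i)) (S l) (y0 + INR (l + q) * h))%C.
  replace (y0 + INR (l + q) * h - (y0 + INR l * h)) with (INR q * h) by (rewrite plus_INR; ring).
  destruct q as [|q].
  - rewrite csum_0 by (intros; simpl; ring). simpl.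
    replace (0 * h) with 0 by ring. replace (1 * 1) with 1 by ring. ring.
  - replace (l + S q)%nat with (S l + q)%nat by lia. rewrite IH.
    rewrite <- csum_scal. f_equal. apply csum_ext. intros i _.
    rewrite INR_fact_S. pose proof (bn_absorb' q i) as E.
    replace ((INR (S q) * h)%R * (e (S i) * (h ^ i * INR (fact i))%R * bn q i))%C
      with (e (S i) * (h ^ S i * INR (fact i) * (INR (S q) * bn q i))%R)%C
      by (rewrite !RtoC_mult; simpl pow; rewrite RtoC_mult; ring).
    rewrite E. replace (e (S i) * (h ^ S i * (INR (S i) * INR (fact i)))%R * bn (S q) (S i))%C
      with (e (S i) * (h ^ S i * (INR (S i) * INR (fact i)) * bn (S q) (S i))%R)%C
      by (rewrite !RtoC_mult; ring).
    f_equal. f_equal. ring.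
Qed.

Lemma hnorm_rsum t d : forall e, hnorm t d e = rsum (fun i => Cmod (e i) * t ^ i) d.
Proof.
  assert (L : forall (g : nat -> R) n, rsum g (S n) = g O + rsum (fun i => g (S i)) n).
  { intros g n. induction n as [|n IH]; [simpl; ring|].
    change (rsum g (S (S n))) with (rsum g (S n) + g (S n)). rewrite IH. simpl. ring. }
  induction d as [|d IH]; intro e; [reflexivity|].
  rewrite L. change (hnorm t (S d) e) with (Cmod (e O) + t * hnorm t d (fun i => e (S i))).
  rewrite IH, <- rsum_scal. simpl pow at 2. f_equal; [ring|].
  apply rsum_ext. intros i _. simpl. ring.
Qed.

Lemma exp_partial_sum x d : 0 <= x -> rsum (fun i => x ^ i / INR (fact i)) d <= exp x.
Proof.
  intro Hx. destruct d as [|d]; [simpl; apply Rlt_le, exp_pos|].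
  replace (rsum (fun i => x ^ i / INR (fact i)) (S d)) with (sum_f_R0 (fun k => x ^ k / INR (fact k)) d).
  - now apply exp_ge_taylor.
  - induction d as [|d IH]; [simpl; lra|]. simpl sum_f_R0. rewrite IH. reflexivity.
Qed.

(* The divided differences are at most M (2/h)^i / i!, so the bound is an exponential series
   and no factor d^d appears. *)
Lemma poly_coef_bound d a y0 h Y M : 0 < h -> 0 <= M -> 1 <= Y ->
  (forall q, (q < d)%nat -> 1 + Rabs (y0 + INR q * h) <= Y) ->
  (forall q, (q < d)%nat -> Cmod (hev d a (y0 + INR q * h)) <= M) ->
  hnorm 1 d a <= M * exp (2 * Y / h).
Proof.
  intros Hh HM HY1 HY Hv.
  destruct (newton_form y0 h Y d a O) as [e [He1 He2]].
  { intros q Hq. apply HY. lia. }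
  eapply Rle_trans; [exact He2|]. rewrite hnorm_rsum.
  apply Rle_trans with (rsum (fun i => M * ((2 * Y / h) ^ i / INR (fact i))) d).
  - apply rsum_le. intros i Hi.
    assert (B : Cmod (e i * (h ^ i * INR (fact i))%R) <= 2 ^ i * M).
    { apply (binomial_inversion i (fun j => e j * (h ^ j * INR (fact j))%R)%C
               (fun q => hev d a (y0 + INR q * h)) M d); [|exact Hv|exact Hi].
      intro q. rewrite He1. apply (newton_values y0 h d e O q). }
    assert (Hf : 0 < INR (fact i)) by apply INR_fact_lt_0.
    assert (Hhi : 0 < h ^ i) by now apply pow_lt.
    rewrite Cmod_mult, Cmod_R, Rabs_pos_eq in B by (apply Rlt_le, Rmult_lt_0_compat; assumption).
    apply (Rmult_le_reg_r (h ^ i * INR (fact i))); [now apply Rmult_lt_0_compat|].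
    replace (M * ((2 * Y / h) ^ i / INR (fact i)) * (h ^ i * INR (fact i))) with (2 ^ i * M * Y ^ i).
    2:{ unfold Rdiv. rewrite !Rpow_mult_distr, pow_inv. field. lra. }
    replace (Cmod (e i) * Y ^ i * (h ^ i * INR (fact i)))
      with (Cmod (e i) * (h ^ i * INR (fact i)) * Y ^ i) by ring.
    apply Rmult_le_compat_r; [apply pow_le; lra|exact B].
  - rewrite rsum_scal. apply Rmult_le_compat_l; [exact HM|]. apply exp_partial_sum.
    apply Rlt_le, Rdiv_lt_0_compat; lra.
Qed.

(** * Isolating one coefficient *)

Fixpoint rep (k : nat) (l : list op) : list op :=
  match k with
  | O => []
  | S k => l ++ rep k l
  end.

Fixpoint annihilator (blk : nat -> list op) (mu : nat -> nat) (n N : nat) : list op :=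
  match N with
  | O => []
  | S N => annihilator blk mu n N ++ (if Nat.eq_dec N n then [] else rep (mu N) (blk N))
  end.

(** The interface between the blocks and the estimate: [cost] is the logarithmic loss in the lower
    bound at lamn, [kcost] the logarithmic growth of the energy, w a bound for the total
    translation. All three add up under concatenation. *)
Definition good_block (eta : R) (lamm lamn : C) (d : nat) (t cost kcost w : R) (l : list op) : Prop :=
  (exists o, In o l /\ op_symbol eta lamm o = 0%C) /\
  energy_bound (exp kcost) l /\
  (exists ell, 0 <= ell /\ (forall o, In o l -> ell <= op_low eta lamn d t o) /\
     exp (- cost) <= ell ^ (length l)) /\
  INR (width l) * eta <= w.

Definition off (n : nat) (mu : nat -> nat) (f : nat -> R) (m : nat) : R :=
  if Nat.eq_dec m n then 0 else INR (mu m) * f m.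

Lemma rep_kill eta lam l : (exists o, In o l /\ op_symbol eta lam o = 0%C) ->
  forall k f, expoly lam k f -> expoly lam 0 (opapp eta (rep k l) f).
Proof.
  intros Hl k. induction k as [|k IH]; intros f Hf; simpl; [exact Hf|].
  rewrite app_cat. apply IH. now apply expoly_kill.
Qed.

Lemma rep_low eta lam d t cost l : 0 < t -> 0 <= eta ->
  (exists ell, 0 <= ell /\ (forall o, In o l -> ell <= op_low eta lam d t o) /\
     exp (- cost) <= ell ^ (length l)) ->
  forall k f a, (forall x : R, f x = (hev d a x * cexp (x * lam))%C) ->
  exists a', (forall x : R, opapp eta (rep k l) f x = (hev d a' x * cexp (x * lam))%C) /\
    exp (- (INR k * cost)) * hnorm t d a <= hnorm t d a'.
Proof.
  intros Ht Heta [ell [He [Hl Hc]]] k. induction k as [|k IH]; intros f a Hf.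
  - exists a. split; [exact Hf|]. simpl. rewrite Rmult_0_l, Ropp_0, exp_0. lra.
  - destruct (app_low eta lam d t ell Ht Heta He l Hl f a Hf) as [a1 [H1 H2]].
    destruct (IH (opapp eta l f) a1 H1) as [a2 [H3 H4]].
    exists a2. split; [intro x; simpl rep; rewrite app_cat; apply H3|].
    eapply Rle_trans; [|exact H4].
    replace (- (INR (S k) * cost)) with (- (INR k * cost) + - cost) by (rewrite S_INR; ring).
    rewrite exp_plus, Rmult_assoc. apply Rmult_le_compat_l; [apply Rlt_le, exp_pos|].
    eapply Rle_trans; [|exact H2]. apply Rmult_le_compat_r; [apply hnorm_ge_0; lra|exact Hc].
Qed.

Lemma energy_bound_nil : energy_bound (exp 0) [].
Proof. intros Q f _. rewrite exp_0. simpl. lra. Qed.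

Lemma rep_energy kc l : energy_bound (exp kc) l -> forall k, energy_bound (exp (INR k * kc)) (rep k l).
Proof.
  intros H k. induction k as [|k IH]; simpl rep.
  - simpl INR. rewrite Rmult_0_l. apply energy_bound_nil.
  - rewrite S_INR, Rmult_plus_distr_r, Rmult_1_l, Rplus_comm, exp_plus.
    apply energy_bound_cat; [apply Rlt_le, exp_pos|exact H|exact IH].
Qed.

Lemma rep_width l k : width (rep k l) = (k * width l)%nat.
Proof. induction k as [|k IH]; simpl; [reflexivity|]. rewrite width_cat, IH. lia. Qed.

Section Annihilator.

Context (lam : nat -> C) (mu : nat -> nat) (blk : nat -> list op) (n N : nat).
Context (eta t : R) (cost kcost w : nat -> R).
Hypothesis Ht : 0 < t.
Hypothesis Heta : 0 < eta.
Hypothesis Hblk : forall m, (m < N)%nat -> m <> n ->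
  good_block eta (lam m) (lam n) (mu n) t (cost m) (kcost m) (w m) (blk m).

Lemma annihilator_kill m f : (m < N)%nat -> m <> n -> expoly (lam m) (mu m) f ->
  forall x, opapp eta (annihilator blk mu n N) f x = 0%C.
Proof.
  intros Hm Hmn Hf.
  assert (K : forall N', (m < N')%nat -> expoly (lam m) 0 (opapp eta (annihilator blk mu n N') f)).
  { induction N' as [|N' IH]; intro L; [lia|]. simpl. rewrite app_cat.
    destruct (Nat.eq_dec m N') as [E|E].
    - subst N'. destruct (Nat.eq_dec m n) as [E'|_]; [tauto|].
      apply rep_kill; [apply Hblk; assumption|]. now apply expoly_app.
    - apply expoly_app, IH. lia. }
  destruct (K N Hm) as [a Ha]. intro x. rewrite Ha. simpl. ring.
Qed.

Lemma annihilator_low f a : (forall x : R, f x = (hev (mu n) a x * cexp (x * lam n))%C) ->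
  exists a', (forall x : R, opapp eta (annihilator blk mu n N) f x = (hev (mu n) a' x * cexp (x * lam n))%C) /\
    exp (- rsum (off n mu cost) N) * hnorm t (mu n) a <= hnorm t (mu n) a'.
Proof.
  intro Hf.
  assert (K : forall N', (N' <= N)%nat -> exists a',
    (forall x : R, opapp eta (annihilator blk mu n N') f x = (hev (mu n) a' x * cexp (x * lam n))%C) /\
    exp (- rsum (off n mu cost) N') * hnorm t (mu n) a <= hnorm t (mu n) a').
  { induction N' as [|N' IH]; intro L.
    - exists a. split; [exact Hf|]. simpl. rewrite Ropp_0, exp_0. lra.
    - destruct IH as [a1 [H1 H2]]; [lia|]. simpl. unfold off at 2.
      destruct (Nat.eq_dec N' n) as [E|E].
      + exists a1. split; [intro x; rewrite app_nil_r; apply H1|].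
        rewrite Rplus_0_r. exact H2.
      + destruct (rep_low eta (lam n) (mu n) t (cost N') (blk N') Ht (Rlt_le _ _ Heta)
                   (proj1 (proj2 (proj2 (Hblk N' ltac:(lia) E)))) (mu N') _ a1 H1) as [a2 [H3 H4]].
        exists a2. split; [intro x; rewrite app_cat; apply H3|].
        eapply Rle_trans; [|exact H4].
        rewrite Ropp_plus_distr, exp_plus, (Rmult_comm (exp (- rsum _ _))), Rmult_assoc.
        apply Rmult_le_compat_l; [apply Rlt_le, exp_pos|exact H2]. }
  apply K. lia.
Qed.

Lemma annihilator_energy : energy_bound (exp (rsum (off n mu kcost) N)) (annihilator blk mu n N).
Proof.
  assert (K : forall N', (N' <= N)%nat ->
    energy_bound (exp (rsum (off n mu kcost) N')) (annihilator blk mu n N')).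
  { induction N' as [|N' IH]; intro L; [apply energy_bound_nil|].
    simpl. rewrite exp_plus. apply energy_bound_cat; [apply Rlt_le, exp_pos|apply IH; lia|].
    unfold off. destruct (Nat.eq_dec N' n) as [E|E]; [apply energy_bound_nil|].
    apply rep_energy. apply Hblk; [lia|exact E]. }
  apply K. lia.
Qed.

Lemma annihilator_width : INR (width (annihilator blk mu n N)) * eta <= rsum (off n mu w) N.
Proof.
  assert (K : forall N', (N' <= N)%nat ->
    INR (width (annihilator blk mu n N')) * eta <= rsum (off n mu w) N').
  { induction N' as [|N' IH]; intro L; [simpl; lra|].
    simpl. rewrite width_cat, plus_INR, Rmult_plus_distr_r.
    apply Rplus_le_compat; [apply IH; lia|]. unfold off.
    destruct (Nat.eq_dec N' n) as [E|E]; [simpl; lra|].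
    rewrite rep_width, mult_INR, Rmult_assoc. apply Rmult_le_compat_l; [apply pos_INR|].
    apply Hblk; [lia|exact E]. }
  apply K. lia.
Qed.

End Annihilator.

Lemma app_csum eta l N : forall (F : nat -> R -> C) x,
  opapp eta l (fun y => csum (fun m => F m y) N) x = csum (fun m => opapp eta l (F m) x) N.
Proof.
  intros F x. induction N as [|N IH]; simpl.
  - revert x. induction l as [|o l IHl]; intro x; simpl; [reflexivity|].
    transitivity (opapp eta l (fun _ => 0%C) x); [|apply IHl].
    apply app_ext. intro y. unfold app1. ring.
  - rewrite <- IH. apply (app_plus eta l (fun y => csum (fun m => F m y) N) (F N)).
Qed.

Lemma csum_single (f : nat -> C) n N : (n < N)%nat -> (forall m, (m < N)%nat -> m <> n -> f m = 0%C) ->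
  csum f N = f n.
Proof.
  intros Hn H. induction N as [|N IH]; [lia|]. simpl.
  destruct (Nat.eq_dec N n) as [E|E].
  - subst N. rewrite csum_0; [ring|]. intros m Hm. apply H; lia.
  - rewrite IH, (H N) by (try lia; intros; apply H; lia). ring.
Qed.

Lemma rsum_const x n : rsum (fun _ => x) n = INR n * x.
Proof. induction n as [|n IH]; [simpl; ring|]. rewrite S_INR. simpl rsum. rewrite IH. ring. Qed.

Lemma rsum_progressions F g k : rsum F (g * k) = rsum (fun q => rsum (fun l => F (q + l * g)%nat) k) g.
Proof.
  induction k as [|k IH].
  - rewrite Nat.mul_0_r. simpl. induction g as [|g IHg]; simpl; [reflexivity|]. rewrite <- IHg. ring.
  - assert (A : forall a b, rsum F (a + b) = rsum F a + rsum (fun q => F (a + q)%nat) b).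
    { intros a b. induction b as [|b IHb]; [rewrite Nat.add_0_r; simpl; ring|].
      rewrite Nat.add_succ_r. simpl. rewrite IHb. ring. }
    replace (g * S k)%nat with (g * k + g)%nat by lia. rewrite A, IH.
    rewrite <- rsum_plus. apply rsum_ext. intros q _. simpl. do 2 f_equal. lia.
Qed.

(** The residue classes mod g share the total T, so one of them sums to at most T / g; as the terms
    are nonnegative, each of its terms obeys the same bound. *)
Lemma progression_pigeonhole F g k T : (0 < g)%nat -> (forall q, 0 <= F q) -> rsum F (g * k) <= T ->
  exists q0, (q0 < g)%nat /\ forall l, (l < k)%nat -> F (q0 + l * g)%nat <= T / INR g.
Proof.
  intros Hg HF HT. rewrite rsum_progressions in HT.
  assert (Hg' : 0 < INR g) by now apply lt_0_INR.
  apply NNPP. intro N.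
  assert (K : forall q, (q < g)%nat -> T / INR g < rsum (fun l => F (q + l * g)%nat) k).
  { intros q Hq. apply Rnot_le_lt. intro L. apply N. exists q. split; [exact Hq|].
    intros l Hl. eapply Rle_trans; [|exact L].
    apply (rsum_term_le (fun l => F (q + l * g)%nat)); [intro; apply HF|exact Hl]. }
  set (h := fun q => rsum (fun l => F (q + l * g)%nat) k) in *.
  assert (S1 : forall j, (0 < j <= g)%nat -> INR j * (T / INR g) < rsum h j).
  { induction j as [|j IH]; intro Hj; [lia|]. simpl rsum. rewrite S_INR.
    pose proof (K j ltac:(lia)). fold (h j) in H. destruct j as [|j].
    - simpl. unfold h in *. simpl in *. lra.
    - specialize (IH ltac:(lia)). lra. }
  specialize (S1 g ltac:(lia)).
  replace (INR g * (T / INR g)) with T in S1 by (field; lra). lra.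
Qed.

Lemma hnorm_le_pow t d : 1 <= t -> forall a, hnorm t d a <= t ^ d * hnorm 1 d a.
Proof.
  intros Ht. induction d as [|d IH]; intro a; simpl; [lra|].
  specialize (IH (fun i => a (S i))).
  assert (P : 1 <= t ^ d) by now apply pow_R1_Rle.
  pose proof (Cmod_ge_0 (a O)). pose proof (hnorm_ge_0 1 d Rle_0_1 (fun i => a (S i))).
  assert (P' : 1 <= t * t ^ d) by nra.
  assert (1 * Cmod (a O) <= t * t ^ d * Cmod (a O)) by (apply Rmult_le_compat_r; lra).
  assert (t * hnorm t d (fun i => a (S i)) <= t * (t ^ d * hnorm 1 d (fun i => a (S i)))) by (apply Rmult_le_compat_l; lra).
  lra.
Qed.

Lemma coef_le_hnorm t d k : 1 <= t -> (k < d)%nat -> forall a, Cmod (a k) <= hnorm t d a.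
Proof.
  intros Ht. revert k. induction d as [|d IH]; intros k Hk a; [lia|]. simpl.
  pose proof (hnorm_ge_0 t d ltac:(lra) (fun i => a (S i))) as P.
  destruct k as [|k]; [nra|].
  specialize (IH k ltac:(lia) (fun i => a (S i))). simpl in IH.
  pose proof (Cmod_ge_0 (a O)). nra.
Qed.

(** The factors of the bound, from left to right: the loss of T in [hnorm t]; the passage from
    weight t to weight 1; the sup bound, transported to the left endpoint x0; the energy growth and
    the pigeonhole; the Newton interpolation on nodes of spacing g eta. *)
Lemma coefficient_estimate lam mu blk n N eta t cost kcost w (c : nat -> nat -> C)
    (x0 s Y : R) (Q W g k : nat) :
  1 <= t -> 0 < eta -> (n < N)%nat -> (k < mu n)%nat ->
  (forall m, (m < N)%nat -> m <> n ->
     good_block eta (lam m) (lam n) (mu n) t (cost m) (kcost m) (w m) (blk m)) ->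
  (forall m, 0 <= kcost m) -> 0 <= Re (lam n) -> 0 <= s ->
  rsum (off n mu w) N <= INR W * eta ->
  (0 < g)%nat -> (g * mu n + W <= Q)%nat ->
  (forall q, (q < Q)%nat -> 1 + Rabs (x0 + INR q * eta) <= Y) ->
  (forall q, (q < Q)%nat ->
     Cmod (csum (fun m => hev (mu m) (c m) (x0 + INR q * eta) * cexp ((x0 + INR q * eta)%R * lam m))%C N) <= s) ->
  Cmod (c n k) <= exp (rsum (off n mu cost) N) * (t ^ (mu n) *
     (s * exp (- (x0 * Re (lam n))) * (exp (rsum (off n mu kcost) N) * (INR Q / INR g))
        * exp (2 * Y / (INR g * eta)))).
Proof.
  intros Ht Heta Hn Hk Hblk Hkc Hre Hs HW Hg HQ HY Hsup.
  set (T := annihilator blk mu n N).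
  set (P := fun x : R => csum (fun m => hev (mu m) (c m) x * cexp (x * lam m))%C N).
  assert (Hwid : (width T <= W)%nat).
  { apply INR_le. apply (Rmult_le_reg_r eta); [exact Heta|].
    eapply Rle_trans; [|exact HW].
    apply (annihilator_width lam mu blk n N eta t cost kcost w Hblk). }
  destruct (annihilator_low lam mu blk n N eta t cost kcost w ltac:(lra) Heta Hblk
              (fun x => hev (mu n) (c n) x * cexp (x * lam n))%C (c n) (fun x => eq_refl)) as [a' [Ha1 Ha2]].
  fold T in Ha1.
  assert (HTP : forall x, opapp eta T P x = (hev (mu n) a' x * cexp (x * lam n))%C).
  { intro x. unfold P. rewrite (app_csum eta T N (fun m y => hev (mu m) (c m) y * cexp (y * lam m))%C).
    rewrite (csum_single _ n N Hn); [apply Ha1|].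
    intros m Hm Hmn. apply (annihilator_kill lam mu blk n N eta t cost kcost w Hblk m); [exact Hm|exact Hmn|].
    exists (c m). reflexivity. }
  assert (HQ0 : (0 < Q)%nat) by nia.
  (* The window of Q samples is repeated periodically. T has width at most W, so by
     [g * mu n + W <= Q] the first g mu_n values of T f are true values of T P. *)
  set (f := fun q => P (x0 + INR (q mod Q) * eta)).
  assert (Hper : periodic Q f).
  { intro q. unfold f. replace (q + Q)%nat with (q + 1 * Q)%nat by lia. now rewrite Nat.Div0.mod_add. }
  set (K := rsum (off n mu kcost) N).
  assert (HK : 0 <= K).
  { apply rsum_nonneg. intros m _. unfold off. destruct (Nat.eq_dec m n); [lra|].
    apply Rmult_le_pos; [apply pos_INR|apply Hkc]. }
  assert (HeK : 1 <= exp K) by (rewrite <- exp_0; now apply exp_le_compat).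
  assert (En : energy Q (appN T f) <= exp K * (INR Q * s ^ 2)).
  { eapply Rle_trans; [apply (annihilator_energy lam mu blk n N eta t cost kcost w Hblk); exact Hper|].
    apply Rmult_le_compat_l; [lra|]. unfold energy.
    apply Rle_trans with (rsum (fun _ => s ^ 2) Q).
    - apply rsum_le. intros q Hq. apply pow_incr. split; [apply Cmod_ge_0|].
      unfold f. rewrite Nat.mod_small by exact Hq. now apply Hsup.
    - rewrite rsum_const. apply Rle_refl. }
  (* As Re lam_n >= 0, this is a lower bound for |exp(x lam_n)| at all sample points. *)
  set (E := exp (x0 * Re (lam n))).
  assert (HE : 0 < E) by apply exp_pos.
  set (F := fun q => E ^ 2 * Cmod (hev (mu n) a' (x0 + INR q * eta)) ^ 2).
  assert (HF : rsum F (g * mu n) <= exp K * (INR Q * s ^ 2)).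
  { eapply Rle_trans; [|exact En]. unfold energy.
    eapply Rle_trans; [|apply (rsum_mono _ (g * mu n) Q)]; [|intro; apply pow_le, Cmod_ge_0|lia].
    apply rsum_le. intros q Hq.
    rewrite (appN_sample eta x0 T P f Q); [| |lia].
    2:{ intros q' Hq'. unfold f. now rewrite Nat.mod_small. }
    rewrite HTP, Cmod_mult, Rpow_mult_distr. unfold F. rewrite Rmult_comm.
    apply Rmult_le_compat_l; [apply pow_le, Cmod_ge_0|].
    apply pow_incr. split; [lra|]. rewrite Cmod_cexp. unfold E. apply exp_le_compat.
    replace (Re ((x0 + INR q * eta)%R * lam n)%C) with ((x0 + INR q * eta) * Re (lam n))
      by (destruct (lam n); simpl; ring).
    apply Rmult_le_compat_r; [exact Hre|].
    assert (0 <= INR q * eta) by (apply Rmult_le_pos; [apply pos_INR|lra]). lra. }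
  assert (HF0 : forall q, 0 <= F q).
  { intro q. apply Rmult_le_pos; apply pow_le; [lra|apply Cmod_ge_0]. }
  destruct (progression_pigeonhole F g (mu n) _ Hg HF0 HF) as [q0 [Hq0 Hsmall]].
  assert (Hg' : 0 < INR g) by now apply lt_0_INR.
  assert (HQg : 1 <= INR Q / INR g).
  { apply (Rmult_le_reg_r (INR g)); [exact Hg'|].
    unfold Rdiv. rewrite Rmult_assoc, Rinv_l, Rmult_1_r, Rmult_1_l by lra. apply le_INR. nia. }
  set (B := exp K * (INR Q / INR g)).
  assert (HB : 1 <= B) by (unfold B; nra).
  set (M := s * exp (- (x0 * Re (lam n))) * B).
  assert (HE' : exp (- (x0 * Re (lam n))) = / E) by apply exp_Ropp.
  assert (HM0 : 0 <= M).
  { unfold M. apply Rmult_le_pos; [apply Rmult_le_pos; [exact Hs|apply Rlt_le, exp_pos]|lra]. }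
  assert (Hbnd : hnorm 1 (mu n) a' <= M * exp (2 * Y / (INR g * eta))).
  { apply (poly_coef_bound (mu n) a' (x0 + INR q0 * eta) (INR g * eta)).
    - now apply Rmult_lt_0_compat.
    - exact HM0.
    - specialize (HY O HQ0). pose proof (Rabs_pos (x0 + INR 0 * eta)). lra.
    - intros l Hl.
      replace (x0 + INR q0 * eta + INR l * (INR g * eta)) with (x0 + INR (q0 + l * g) * eta)
        by (rewrite plus_INR, mult_INR; ring).
      apply HY. nia.
    - intros l Hl.
      replace (x0 + INR q0 * eta + INR l * (INR g * eta)) with (x0 + INR (q0 + l * g) * eta)
        by (rewrite plus_INR, mult_INR; ring).
      specialize (Hsmall l Hl). unfold F in Hsmall.
      set (v := Cmod (hev (mu n) a' (x0 + INR (q0 + l * g) * eta))) in *.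
      assert (Hv : 0 <= v) by apply Cmod_ge_0.
      (* The pigeonhole gives s^2 B; as B >= 1 it may be replaced by (s B)^2, which avoids a square
         root. *)
      assert (Q1 : (E * v) ^ 2 <= (s * B) ^ 2).
      { rewrite !Rpow_mult_distr. eapply Rle_trans; [exact Hsmall|].
        replace (exp K * (INR Q * s ^ 2) / INR g) with (s ^ 2 * B) by (unfold B; field; lra).
        apply Rmult_le_compat_l; [apply pow2_ge_0|]. nra. }
      assert (Q2 : E * v <= s * B).
      { apply Rsqr_incr_0; [unfold Rsqr; lra|nra|nra]. }
      unfold M. rewrite HE'. apply (Rmult_le_reg_l E); [exact HE|].
      replace (E * (s * / E * B)) with (s * B) by (field; lra). exact Q2. }
  assert (HC : hnorm t (mu n) (c n) <= exp (rsum (off n mu cost) N) * hnorm t (mu n) a').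
  { rewrite exp_Ropp in Ha2. pose proof (exp_pos (rsum (off n mu cost) N)) as Hp.
    apply (Rmult_le_reg_l (/ exp (rsum (off n mu cost) N))); [now apply Rinv_0_lt_compat|].
    rewrite <- Rmult_assoc, Rinv_l, Rmult_1_l by lra. exact Ha2. }
  eapply Rle_trans; [apply (coef_le_hnorm t (mu n) k Ht Hk)|].
  eapply Rle_trans; [exact HC|]. apply Rmult_le_compat_l; [apply Rlt_le, exp_pos|].
  eapply Rle_trans; [apply hnorm_le_pow; exact Ht|]. apply Rmult_le_compat_l; [apply pow_le; lra|].
  exact Hbnd.
Qed.

(** * The two kinds of blocks *)

Lemma exp_lower x : 1 + x <= exp x.
Proof. apply exp_ineq1_le. Qed.

Lemma exp_upper x : x < 1 -> exp x * (1 - x) <= 1.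
Proof.
  intro H. pose proof (exp_lower (- x)) as E. rewrite exp_Ropp in E.
  pose proof (exp_pos x) as P.
  apply (Rmult_le_compat_l (exp x)) in E; [|lra]. rewrite Rinv_r in E by lra. lra.
Qed.

Lemma exp_second_order x : Rabs x <= 1 / 2 -> Rabs (exp x - 1 - x) <= 2 * x ^ 2.
Proof.
  intro H. apply Rabs_le_between in H. pose proof (exp_lower x). pose proof (exp_upper x ltac:(lra)).
  rewrite Rabs_pos_eq by lra. nra.
Qed.

Lemma sin_abs_le x : Rabs (sin x) <= Rabs x.
Proof.
  destruct (Rtotal_order x 0) as [H|[H|H]].
  - rewrite <- Rabs_Ropp, <- sin_neg, <- (Rabs_Ropp x).
    assert (K : 0 < - x) by lra. revert K. generalize (- x). intros y Hy.
    pose proof (sin_lt_x y Hy). rewrite (Rabs_pos_eq y) by lra. apply Rabs_le. split; [|lra].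
    destruct (Rle_dec y 1).
    + assert (0 < sin y) by (apply sin_gt_0; [exact Hy|pose proof PI2_1; lra]). lra.
    + pose proof (SIN_bound y). lra.
  - subst. rewrite sin_0, Rabs_R0. lra.
  - pose proof (sin_lt_x x H). rewrite (Rabs_pos_eq x) by lra. apply Rabs_le. split; [|lra].
    destruct (Rle_dec x 1).
    + assert (0 < sin x) by (apply sin_gt_0; [exact H|pose proof PI2_1; lra]). lra.
    + pose proof (SIN_bound x). lra.
Qed.

Lemma cos_second_order x : 0 <= 1 - cos x <= x ^ 2 / 2.
Proof.
  pose proof (COS_bound x). split; [lra|].
  replace x with (2 * (x / 2)) at 1 by field. rewrite cos_2a_sin.
  pose proof (sin_abs_le (x / 2)) as S. pose proof (Rabs_pos (sin (x / 2))).
  assert (sin (x / 2) * sin (x / 2) <= (x / 2) * (x / 2)).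
  { rewrite <- (Rabs_pos_eq (sin (x / 2) * _)) by nra. rewrite <- (Rabs_pos_eq (x / 2 * _)) by nra.
    rewrite !Rabs_mult. nra. }
  nra.
Qed.

Lemma sin_second_order x : Rabs x <= 1 / 2 -> Rabs (sin x - x) <= x ^ 2.
Proof.
  intro Hx. assert (Hr := Hx). apply Rabs_le_between in Hr.
  assert (HD : forall c, derivable_pt_lim (fun y => sin y - y) c (cos c - 1)).
  { intro c. apply derivable_pt_lim_minus; [apply derivable_pt_lim_sin|apply derivable_pt_lim_id]. }
  destruct (Req_dec x 0) as [E|E].
  { subst. rewrite sin_0. replace (0 - 0) with 0 by ring. rewrite Rabs_R0. nra. }
  assert (M : exists c, Rabs c <= Rabs x /\ sin x - x = (cos c - 1) * x).
  { destruct (Rlt_dec 0 x) as [P|P].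
    - destruct (MVT_cor2 (fun y => sin y - y) (fun c => cos c - 1) 0 x P (fun c _ => HD c)) as [c [Hc Ic]].
      exists c. rewrite sin_0 in Hc. split; [rewrite !Rabs_pos_eq; lra|lra].
    - destruct (MVT_cor2 (fun y => sin y - y) (fun c => cos c - 1) x 0 ltac:(lra) (fun c _ => HD c)) as [c [Hc Ic]].
      exists c. rewrite sin_0 in Hc. split; [rewrite !Rabs_left1; lra|lra]. }
  destruct M as [c [Hc ->]]. rewrite Rabs_mult.
  pose proof (cos_second_order c) as K.
  assert (Rabs (cos c - 1) <= Rabs x).
  { rewrite Rabs_left1 by lra.
    assert (c ^ 2 <= Rabs x ^ 2) by (rewrite <- (pow2_abs c); apply pow_incr; split; [apply Rabs_pos|exact Hc]).
    pose proof (Rabs_pos x). nra. }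
  rewrite <- (pow2_abs x). pose proof (Rabs_pos x). nra.
Qed.

Lemma cexp_second_order z : Cmod z <= 1 / 2 -> Cmod (cexp z - 1 - z) <= 4 * Cmod z ^ 2.
Proof.
  intro Hz. rewrite (Cmod2_alt z). pose proof (Rmax_Cmod z) as HR.
  destruct z as [x y]. simpl fst in HR. simpl snd in HR. simpl Re; simpl Im.
  assert (Hx : Rabs x <= 1 / 2) by (pose proof (Rmax_l (Rabs x) (Rabs y)); lra).
  assert (Hy : Rabs y <= 1 / 2) by (pose proof (Rmax_r (Rabs x) (Rabs y)); lra).
  replace (cexp (x, y) - 1 - (x, y))%C with (exp x * cos y - 1 - x, exp x * sin y - y)
    by (unfold cexp, Cminus, Cplus, Copp, RtoC; simpl; f_equal; ring).
  eapply Rle_trans; [apply Cmod_le_abs|].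
  pose proof (exp_second_order x Hx) as E. pose proof (cos_second_order y) as Cs.
  pose proof (sin_second_order y Hy) as Sn.
  assert (Ex : 0 < exp x <= 2).
  { split; [apply exp_pos|]. apply Rabs_le_between in Hx. pose proof (exp_upper x ltac:(lra)).
    pose proof (exp_pos x). nra. }
  assert (R1 : Rabs (exp x * cos y - 1 - x) <= 2 * x ^ 2 + y ^ 2).
  { replace (exp x * cos y - 1 - x) with ((exp x - 1 - x) - exp x * (1 - cos y)) by ring.
    eapply Rle_trans; [apply Rabs_triang|]. rewrite Rabs_Ropp, (Rabs_pos_eq (exp x * _)) by nra. nra. }
  assert (R2 : Rabs (exp x * sin y - y) <= 2 * Rabs x * Rabs y + y ^ 2).
  { replace (exp x * sin y - y) with ((exp x - 1) * sin y + (sin y - y)) by ring.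
    eapply Rle_trans; [apply Rabs_triang|]. apply Rplus_le_compat; [|exact Sn].
    rewrite Rabs_mult. apply Rmult_le_compat; try apply Rabs_pos; [|apply sin_abs_le].
    replace (exp x - 1) with ((exp x - 1 - x) + x) by ring.
    eapply Rle_trans; [apply Rabs_triang|]. rewrite <- (pow2_abs x) in E.
    pose proof (Rabs_pos x). nra. }
  assert (2 * Rabs x * Rabs y <= x ^ 2 + y ^ 2).
  { rewrite <- (pow2_abs x), <- (pow2_abs y). pose proof (pow2_ge_0 (Rabs x - Rabs y)). lra. }
  nra.
Qed.

Lemma cexp_sub1_lower z : Cmod z <= 1 / 8 -> Cmod z / 2 <= Cmod (cexp z - 1).
Proof.
  intro Hz. pose proof (cexp_second_order z ltac:(lra)) as E.
  pose proof (Cmod_triangle_rev z (cexp z - 1 - z)) as T.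
  replace (z + (cexp z - 1 - z))%C with (cexp z - 1)%C in T by ring.
  pose proof (Cmod_ge_0 z). nra.
Qed.

Lemma cexp_sub1_upper z : Cmod z <= 1 / 8 -> Cmod (cexp z - 1) <= 2 * Cmod z.
Proof.
  intro Hz. pose proof (cexp_second_order z ltac:(lra)) as E.
  pose proof (Cmod_triangle z (cexp z - 1 - z)) as T.
  replace (z + (cexp z - 1 - z))%C with (cexp z - 1)%C in T by ring.
  pose proof (Cmod_ge_0 z). nra.
Qed.

Lemma pow_sub1_upper y d : 0 <= y -> INR d * y <= 1 / 2 -> 0 <= (1 + y) ^ d - 1 <= 2 * (INR d * y).
Proof.
  intros Hy Hd. split.
  - pose proof (pow_R1_Rle (1 + y) d ltac:(lra)). lra.
  - assert ((1 + y) ^ d <= exp (INR d * y)).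
    { clear Hd. induction d as [|d IH]; [simpl; rewrite Rmult_0_l, exp_0; lra|].
      rewrite S_INR, Rmult_plus_distr_r, Rmult_1_l, exp_plus. simpl.
      rewrite Rmult_comm. apply Rmult_le_compat; [apply pow_le; lra|lra|exact IH|apply exp_lower]. }
    pose proof (exp_upper (INR d * y) ltac:(lra)).
    assert (0 <= INR d * y) by (apply Rmult_le_pos; [apply pos_INR|exact Hy]).
    pose proof (exp_pos (INR d * y)). nra.
Qed.

Lemma Cmod_scal_R (b : R) z : 0 <= b -> Cmod (b * z) = b * Cmod z.
Proof. intro H. now rewrite Cmod_mult, Cmod_R, Rabs_pos_eq. Qed.

Lemma Re_scal_R (b : R) z : Re (b * z)%C = b * Re z.
Proof. destruct z; simpl; ring. Qed.

Definition near_block (V : C) (s : nat) : list op := [Op (- V)%C 1%C s].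

(** With D = |lamn - lamm|, the symbol at lamn is V (exp(b (lamn - lamm)) - 1), of modulus at least
    b D / 2. The condition on t makes the translation error at most b D / 7, so b D / 4 survives.
    Both |U| and |V| are at most 8/7, whence the energy factor (1 + 8/7)^2 <= 8 <= exp 3. *)
Lemma near_block_good eta (lamm lamn : C) d t s :
  0 < INR s * eta -> 0 < t ->
  INR s * eta * (Cmod lamn + Cmod lamm) <= 1 / 8 -> 0 <= Re lamm ->
  lamn <> lamm -> 16 * INR d <= t * Cmod (lamn - lamm) ->
  good_block eta lamm lamn d t (ln (4 / (INR s * eta * Cmod (lamn - lamm)))) 3 (INR s * eta)
    (near_block (cexp ((INR s * eta)%R * lamm)) s).
Proof.
  set (b := INR s * eta). intros Hb Ht Hsmall Hre Hneq Hd.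
  set (D := Cmod (lamn - lamm)).
  assert (HD : 0 < D) by now apply Cmod_gt_0, Csub_neq0.
  set (V := cexp (b * lamm)). set (U := cexp (b * lamn)).
  pose proof (Cmod_ge_0 lamn) as Pn. pose proof (Cmod_ge_0 lamm) as Pm.
  assert (Hbn : b * Cmod lamn <= 1 / 8) by nra.
  assert (Hbm : b * Cmod lamm <= 1 / 8) by nra.
  assert (HV1 : 1 <= Cmod V).
  { unfold V. rewrite Cmod_cexp, Re_scal_R, <- exp_0. apply exp_le_compat. nra. }
  assert (Hexp : forall z, b * Cmod z <= 1 / 8 -> Cmod (cexp (b * z)) <= 8 / 7).
  { intros z Hz. rewrite Cmod_cexp.
    assert (Re (b * z)%C <= 1 / 8).
    { eapply Rle_trans; [apply Rle_abs|]. eapply Rle_trans; [apply re_le_Cmod|].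
      rewrite Cmod_scal_R; lra. }
    pose proof (exp_upper (Re (b * z)%C) ltac:(lra)). pose proof (exp_pos (Re (b * z)%C)). nra. }
  assert (HUu : Cmod U <= 8 / 7) by now apply Hexp.
  assert (HVu : Cmod V <= 8 / 7) by now apply Hexp.
  assert (HDs : b * D <= 1 / 8).
  { assert (D <= Cmod lamn + Cmod lamm) by apply Cmod_triangle_minus. nra. }
  split; [|split; [|split]].
  - eexists. split; [left; reflexivity|]. unfold op_symbol; simpl. fold b. fold V. ring.
  - assert (E3 : (Cmod (- V) + Cmod 1) ^ 2 <= exp 3).
    { rewrite Cmod_opp, Cmod_1.
      assert (2 <= exp 1) by (pose proof (exp_lower 1); lra).
      assert (8 <= exp 3).
      { replace 3 with (1 + (1 + 1)) by ring. rewrite !exp_plus.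
        assert (4 <= exp 1 * exp 1) by nra. nra. }
      nra. }
    intros Q f Hf. eapply Rle_trans; [apply energy_bound_single; exact Hf|].
    simpl op_al; simpl op_be. apply Rmult_le_compat_r; [apply energy_ge_0|exact E3].
  - exists (b * D / 4). split; [nra|]. split.
    + intros o [<-|[]]. unfold op_low, op_symbol. simpl op_al; simpl op_be; simpl op_s. fold b. fold U.
      replace (- V + 1 * U)%C with (V * (cexp (b * (lamn - lamm)) - 1))%C.
      2:{ unfold V, U. replace (b * lamn)%C with (b * lamm + b * (lamn - lamm))%C by ring.
          rewrite cexp_plus. ring. }
      rewrite Cmod_mult. replace (1 * U)%C with U by ring.
      assert (L1 : b * D / 2 <= Cmod (cexp (b * (lamn - lamm)) - 1)).
      { unfold D. rewrite <- Cmod_scal_R by lra. apply cexp_sub1_lower.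
        rewrite Cmod_scal_R by lra. exact HDs. }
      assert (Hy : INR d * (b / t) <= b * D / 16).
      { apply (Rmult_le_reg_r t); [exact Ht|]. replace (INR d * (b / t) * t) with (INR d * b) by (field; lra).
        fold D in Hd. nra. }
      assert (Hbt : 0 <= b / t) by (apply Rlt_le, Rdiv_lt_0_compat; lra).
      destruct (pow_sub1_upper (b / t) d Hbt ltac:(nra)) as [Z0 Z1].
      pose proof (Cmod_ge_0 U).
      assert (Cmod U * ((1 + b / t) ^ d - 1) <= 8 / 7 * (b * D / 8)) by (apply Rmult_le_compat; lra).
      assert (1 * (b * D / 2) <= Cmod V * Cmod (cexp (b * (lamn - lamm)) - 1)) by (apply Rmult_le_compat; nra).
      nra.
    + assert (0 < b * D) by nra.
      simpl length. rewrite pow_1.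
      replace (- ln (4 / (b * D))) with (ln (b * D / 4)).
      * rewrite exp_ln by lra. lra.
      * rewrite !ln_div_eq by lra. ring.
  - simpl. rewrite Nat.add_0_r. fold b. lra.
Qed.

(** The condition 3 <= b Re lamm gives |V| >= 8, hence 4 |V| <= |V - 1|^2 and the contraction. Each
    of the four factors has symbol 1 + O(y) at lamn and keeps at least 1 - 8 y >= exp(-16 y), so the
    block costs 64 y; it translates by 4 b in total. *)
Lemma far_block_good eta (lamm lamn : C) d t s y :
  0 < INR s * eta -> 0 < t -> 3 <= INR s * eta * Re lamm ->
  0 <= y <= 1 / 16 -> INR s * eta * Cmod lamn <= y -> INR d * (INR s * eta / t) <= y ->
  good_block eta lamm lamn d t (64 * y) 0 (4 * (INR s * eta))
    (far_block (cexp ((INR s * eta)%R * lamm)) s).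
Proof.
  set (b := INR s * eta). intros Hb Ht H3 Hy Hbn Hd.
  set (V := cexp (b * lamm)). set (U := cexp (b * lamn)).
  assert (HV8 : 8 <= Cmod V).
  { unfold V. rewrite Cmod_cexp, Re_scal_R. apply Rle_trans with (exp 3).
    - assert (2 <= exp 1) by (pose proof (exp_lower 1); lra).
      replace 3 with (1 + (1 + 1)) by ring. rewrite !exp_plus.
      assert (4 <= exp 1 * exp 1) by nra. nra.
    - now apply exp_le_compat. }
  assert (HV1 : Cmod V - 1 <= Cmod (V - 1)).
  { pose proof (Cmod_triangle_rev V (- (1))%C) as T. rewrite Cmod_opp, Cmod_1 in T. exact T. }
  assert (HVn : (V - 1)%C <> 0%C) by (apply Cmod_gt_0; lra).
  set (p := / Cmod (V - 1)).
  assert (Hp : 0 < p <= / 7).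
  { unfold p. split; [apply Rinv_0_lt_compat; lra|]. apply Rinv_le_contravar; lra. }
  assert (Hp1 : Cmod V * p <= 8 / 7).
  { unfold p. apply (Rmult_le_reg_r (Cmod (V - 1))); [lra|].
    rewrite Rmult_assoc, Rinv_l by lra. lra. }
  assert (HU : Cmod (U - 1) <= 2 * y).
  { unfold U. eapply Rle_trans; [apply cexp_sub1_upper; rewrite Cmod_scal_R; lra|].
    rewrite Cmod_scal_R; lra. }
  assert (HUu : Cmod U <= 9 / 8).
  { replace U with (1 + (U - 1))%C by ring. eapply Rle_trans; [apply Cmod_triangle|].
    rewrite Cmod_1. lra. }
  assert (Hbt : 0 <= b / t) by (apply Rlt_le, Rdiv_lt_0_compat; lra).
  destruct (pow_sub1_upper (b / t) d Hbt ltac:(lra)) as [Z0 Z1].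
  set (Z := (1 + b / t) ^ d - 1) in *.
  pose proof (Cmod_ge_0 U) as PU. pose proof (Cmod_ge_0 (U - 1)) as PU1. pose proof (Cmod_ge_0 V) as PV.
  assert (PZ : Cmod U * Z <= 9 / 8 * (2 * y)) by (apply Rmult_le_compat; lra).
  assert (PZ0 : 0 <= Cmod U * Z) by (apply Rmult_le_pos; lra).
  assert (Hinv : Cmod (/ (V - 1)) = p) by (apply Cmod_inv; exact HVn).
  split; [|split; [|split]].
  - eexists. split; [right; right; right; left; reflexivity|].
    unfold op_symbol; simpl. fold b. fold V. field. exact HVn.
  - rewrite exp_0. apply far_block_contraction; [exact HVn|]. nra.
  - exists (1 - 8 * y). split; [lra|]. split.
    + assert (S1 : 1 - 8 * y <= op_low eta lamn d t (Op (/ 2) (/ 2) s)).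
      { unfold op_low, op_symbol. simpl op_al; simpl op_be; simpl op_s. fold b. fold U. fold Z.
        replace (/ 2 + / 2 * U)%C with (1 + / 2 * (U - 1))%C by (field; intro K; injection K; lra).
        pose proof (Cmod_triangle_rev 1 (/ 2 * (U - 1))) as T.
        rewrite Cmod_1 in T. rewrite (Cmod_mult (/ 2) U). rewrite Cmod_mult in T.
        assert (E2 : Cmod (/ 2) = / 2).
        { rewrite <- RtoC_inv by lra. rewrite Cmod_R, Rabs_pos_eq; lra. }
        rewrite E2 in *. nra. }
      assert (S3 : 1 - 8 * y <= op_low eta lamn d t (Op (- / (V - 1)) (V / (V - 1)) s)).
      { unfold op_low, op_symbol. simpl op_al; simpl op_be; simpl op_s. fold b. fold U. fold Z.
        replace (- / (V - 1) + V / (V - 1) * U)%C with (1 + V * / (V - 1) * (U - 1))%C by (field; exact HVn).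
        pose proof (Cmod_triangle_rev 1 (V * / (V - 1) * (U - 1))) as T.
        rewrite Cmod_1, !Cmod_mult, Hinv in T. unfold Cdiv. rewrite !Cmod_mult, Hinv.
        assert (Q1 : Cmod V * p * Cmod (U - 1) <= 8 / 7 * (2 * y)) by (apply Rmult_le_compat; nra).
        assert (Q2 : Cmod V * p * (Cmod U * Z) <= 8 / 7 * (9 / 8 * (2 * y))) by (apply Rmult_le_compat; nra).
        lra. }
      assert (S4 : 1 - 8 * y <= op_low eta lamn d t (Op (V / (V - 1)) (- / (V - 1)) s)).
      { unfold op_low, op_symbol. simpl op_al; simpl op_be; simpl op_s. fold b. fold U. fold Z.
        replace (V / (V - 1) + - / (V - 1) * U)%C with (1 + - (/ (V - 1) * (U - 1)))%C by (field; exact HVn).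
        pose proof (Cmod_triangle_rev 1 (- (/ (V - 1) * (U - 1)))) as T.
        rewrite Cmod_1, Cmod_opp, !Cmod_mult, Hinv in T. rewrite !Cmod_mult, Cmod_opp, Hinv.
        assert (Q1 : p * Cmod (U - 1) <= / 7 * (2 * y)) by (apply Rmult_le_compat; lra).
        assert (Q2 : p * (Cmod U * Z) <= / 7 * (9 / 8 * (2 * y))) by (apply Rmult_le_compat; lra).
        lra. }
      intros o [<-|[<-|[<-|[<-|[]]]]]; assumption.
    + simpl length.
      assert (K : exp (- (16 * y)) <= 1 - 8 * y).
      { rewrite exp_Ropp. pose proof (exp_lower (16 * y)). pose proof (exp_pos (16 * y)).
        apply (Rmult_le_reg_l (exp (16 * y))); [assumption|]. rewrite Rinv_r by lra. nra. }
      replace (- (64 * y)) with (INR 4 * - (16 * y)) by (simpl; ring).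
      rewrite <- (ln_exp (- (16 * y))), exp_nat_ln by apply exp_pos.
      apply pow_incr. split; [apply Rlt_le, exp_pos|exact K].
  - simpl width. rewrite Nat.add_0_r, !plus_INR. fold b. unfold b. lra.
Qed.

(** * Geometry of the exponents *)

(** An argument below pi/2 in modulus forces x > 0 and |y| <= x tan theta, and |z| <= |x| + |y|
    gives the constant 1 / (1 + tan theta). *)
Lemma sector_re (lam : nat -> C) theta : theta < PI / 2 ->
  (forall n, lam n <> 0%C) -> (forall n, Rabs (carg (lam n)) <= theta) ->
  exists kap, 0 < kap <= 1 /\ forall n, kap * Cmod (lam n) <= Re (lam n).
Proof.
  intros Ht Hnz Harg.
  assert (Hth0 : 0 <= theta) by (eapply Rle_trans; [apply Rabs_pos|apply (Harg O)]).
  assert (HT : 0 <= tan theta).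
  { destruct Hth0 as [L|<-]; [|rewrite tan_0; lra]. apply Rlt_le, tan_gt_0; lra. }
  exists (/ (1 + tan theta)). split.
  { split; [apply Rinv_0_lt_compat; lra|]. rewrite <- Rinv_1. apply Rinv_le_contravar; lra. }
  intro n. specialize (Harg n). unfold carg in Harg. apply Rabs_le_between in Harg.
  pose proof (Cmod_le_abs (Re (lam n)) (Im (lam n))) as HC.
  replace (Re (lam n), Im (lam n)) with (lam n) in HC by now destruct (lam n).
  set (x := Re (lam n)) in *. set (y := Im (lam n)) in *.
  pose proof PI_RGT_0.
  destruct (Rlt_dec 0 x) as [Hx|Hx].
  - assert (Hy : Rabs (y / x) <= tan theta).
    { assert (B1 : y / x <= tan theta).
      { rewrite <- (tan_atan (y / x)). destruct (proj2 Harg) as [L|L].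
        - apply Rlt_le, tan_increasing; lra.
        - rewrite L. lra. }
      assert (B2 : - tan theta <= y / x).
      { rewrite <- (tan_atan (y / x)), <- tan_neg. destruct (proj1 Harg) as [L|L].
        - apply Rlt_le, tan_increasing; lra.
        - rewrite <- L. lra. }
      apply Rabs_le; lra. }
    assert (Hy' : Rabs y <= tan theta * x).
    { replace y with (y / x * x) by (field; lra). rewrite Rabs_mult, (Rabs_pos_eq x) by lra.
      apply Rmult_le_compat_r; lra. }
    rewrite (Rabs_pos_eq x) in HC by lra.
    apply (Rmult_le_reg_l (1 + tan theta)); [lra|].
    rewrite <- Rmult_assoc, Rinv_r, Rmult_1_l by lra. lra.
  - exfalso. pose proof (atan_bound (y / x)) as AB.
    destruct (Rlt_dec x 0) as [Hx'|Hx'].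
    + destruct (Rle_dec 0 y); lra.
    + destruct (Rle_dec 0 y); lra.
Qed.

Lemma series_tail u : (forall n, 0 <= u n) -> ex_series u -> forall eta, 0 < eta ->
  exists m0, forall N, rsum (fun m => if lt_dec m m0 then 0 else u m) N <= eta.
Proof.
  intros Hu [l Hl] eta He.
  assert (Hs : forall n, sum_n u n = rsum u (S n)).
  { induction n as [|n IH]; [rewrite sum_O; simpl; ring|]. rewrite sum_Sn, IH. reflexivity. }
  assert (Hlim : is_lim_seq (fun n => rsum u (S n)) l).
  { apply is_lim_seq_ext with (2 := Hl). exact Hs. }
  assert (Hub : forall n, rsum u n <= l).
  { intro n. apply Rle_trans with (rsum u (S n)); [simpl; specialize (Hu n); lra|].
    apply (is_lim_seq_incr_compare (fun n => rsum u (S n)) l Hlim).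
    intro k. change (rsum u (S (S k))) with (rsum u (S k) + u (S k)). specialize (Hu (S k)). lra. }
  apply is_lim_seq_spec in Hlim. destruct (Hlim (mkposreal eta He)) as [k Hk].
  specialize (Hk k (le_n k)). change (pos {| pos := eta; cond_pos := He |}) with eta in Hk.
  apply Rabs_def2 in Hk. exists (S k). intro N.
  assert (E : forall N, rsum (fun m => if lt_dec m (S k) then 0 else u m) (S k + N)
                + rsum u (S k) = rsum u (S k + N)).
  { induction N0 as [|N0 IH].
    - rewrite Nat.add_0_r. replace (rsum (fun m => if lt_dec m (S k) then 0 else u m) (S k)) with 0; [ring|].
      rewrite (rsum_ext _ (fun _ => 0)).
      + rewrite rsum_const. ring.
      + intros i Hi. destruct (lt_dec i (S k)); [reflexivity|lia].
    - rewrite Nat.add_succ_r.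
      change (rsum u (S (S k + N0))) with (rsum u (S k + N0) + u (S k + N0)%nat). rewrite <- IH.
      change (rsum (fun m => if lt_dec m (S k) then 0 else u m) (S (S k + N0)))
        with (rsum (fun m => if lt_dec m (S k) then 0 else u m) (S k + N0)
              + (if lt_dec (S k + N0) (S k) then 0 else u (S k + N0)%nat)).
      destruct (lt_dec (S k + N0) (S k)); [lia|ring]. }
  apply Rle_trans with (rsum (fun m => if lt_dec m (S k) then 0 else u m) (S k + N)).
  - apply rsum_mono; [|lia]. intro i. destruct (lt_dec i (S k)); [lra|apply Hu].
  - specialize (E N). specialize (Hub (S k + N)%nat). lra.
Qed.

Definition count_term (lam : nat -> C) (mu : nat -> nat) (r : R) (m : nat) : R :=
  if Rle_dec (Cmod (lam m)) r then INR (mu m) else 0.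

Definition tail_term (lam : nat -> C) (mu : nat -> nat) (r : R) (m : nat) : R :=
  if Rle_dec (Cmod (lam m)) r then 0 else INR (mu m) / Cmod (lam m).

(** The series is cut at m0, where its tail is at most eta / 2. The earlier multiplicities form a
    fixed number, small against large r; a later one with |lam_m| <= r is at most r times its term
    of the series. *)
Lemma counting lam mu : multiplicity_sequence lam mu ->
  ex_series (fun n => INR (mu n) / Cmod (lam n)) -> forall eta, 0 < eta ->
  exists A0, 0 < A0 /\ forall r, A0 <= r -> forall N,
    rsum (count_term lam mu r) N <= eta * r /\ rsum (tail_term lam mu r) N <= eta.
Proof.
  intros [Hinj [Hnz [_ [Hmono _]]]] Hser eta He.
  set (u := fun n => INR (mu n) / Cmod (lam n)) in *.
  assert (Hp : forall n, 0 < Cmod (lam n)) by (intro; now apply Cmod_gt_0).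
  assert (Hu : forall n, 0 <= u n) by (intro n; apply Rdiv_le_0_compat; [apply pos_INR|apply Hp]).
  destruct (series_tail u Hu Hser (eta / 2)) as [m0 Hm0]; [lra|].
  set (C0 := rsum (fun m => INR (mu m)) m0).
  assert (HC0 : 0 <= C0) by (apply rsum_nonneg; intros; apply pos_INR).
  exists (2 * C0 / eta + Cmod (lam m0)). split.
  { specialize (Hp m0). assert (0 <= 2 * C0 / eta) by (apply Rdiv_le_0_compat; lra). lra. }
  intros r Hr N. pose proof (Hp m0) as Hpm.
  assert (H0 : 0 <= 2 * C0 / eta) by (apply Rdiv_le_0_compat; lra).
  assert (HCr : C0 <= eta / 2 * r).
  { replace C0 with (eta / 2 * (2 * C0 / eta)) by (field; lra). apply Rmult_le_compat_l; lra. }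
  split.
  - apply Rle_trans with (rsum (fun m => (if lt_dec m m0 then INR (mu m) else 0)
                                 + r * (if lt_dec m m0 then 0 else u m)) N).
    + apply rsum_le. intros m _. unfold count_term.
      destruct (Rle_dec (Cmod (lam m)) r) as [L|L]; destruct (lt_dec m m0) as [L'|L'].
      * lra.
      * rewrite Rplus_0_l. unfold u. specialize (Hp m).
        replace (INR (mu m)) with (Cmod (lam m) * (INR (mu m) / Cmod (lam m))) at 1 by (field; lra).
        apply Rmult_le_compat_r; [apply Hu|exact L].
      * pose proof (pos_INR (mu m)). lra.
      * specialize (Hu m). nra.
    + rewrite rsum_plus, rsum_scal.
      assert (rsum (fun m => if lt_dec m m0 then INR (mu m) else 0) N <= C0).
      { eapply Rle_trans; [apply (rsum_stable _ m0)|].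
        - intro i. destruct (lt_dec i m0); [apply pos_INR|lra].
        - intros i Hi. destruct (lt_dec i m0); [lia|reflexivity].
        - apply rsum_le. intros i Hi. destruct (lt_dec i m0); [lra|lia]. }
      specialize (Hm0 N).
      assert (r * rsum (fun m => if lt_dec m m0 then 0 else u m) N <= r * (eta / 2)) by (apply Rmult_le_compat_l; lra).
      lra.
  - eapply Rle_trans; [|apply Rle_trans with (1 := Hm0 N); lra].
    apply rsum_le. intros m _. unfold tail_term.
    destruct (Rle_dec (Cmod (lam m)) r) as [L|L]; destruct (lt_dec m m0) as [L'|L'].
    + lra.
    + apply Hu.
    + exfalso. apply L. apply Rle_trans with (Cmod (lam m0)); [|lra].
      assert (Hm : (m <= m0)%nat) by lia. clear - Hm Hmono.
      induction Hm as [|k Hm IH]; [lra|]. specialize (Hmono k). lra.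
    + apply Rle_refl.
Qed.

Lemma ln_ratio_bound v A y : 0 < y -> 0 <= A -> 0 < v -> v <= 3 * (y + A) / y -> ln v <= 2 + A / y.
Proof.
  intros Hy HA Hv H. rewrite <- (ln_exp (2 + A / y)). apply ln_le; [exact Hv|].
  eapply Rle_trans; [exact H|]. rewrite exp_plus.
  replace (3 * (y + A) / y) with (3 * (1 + A / y)) by (field; lra).
  assert (0 <= A / y) by (apply Rdiv_le_0_compat; lra).
  apply Rmult_le_compat; [lra|lra|pose proof (exp_lower 2); lra|apply exp_lower].
Qed.

Definition crowd_term (lam : nat -> C) (mu : nat -> nat) (r X : R) (n m : nat) : R :=
  if Nat.eq_dec m n then 0
  else count_term lam mu r m * Rmax 0 (ln (X / Cmod (lam n - lam m))).

(** Passing from the radius |lam_n| / 2 to X = |lam_n| + A changes each logarithm by at most 2 + A /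
    |lam_n|, and nodes outside the smaller disc contribute no more than that. Only multiplicity eta
    X is counted, so the total change is a small multiple of X plus a constant. *)
Lemma crowding_scaled lam mu eps eta K1 A : multiplicity_sequence lam mu -> interpolating_variety lam mu ->
  0 < eps -> 0 < eta -> eta <= eps / 8 -> 2 <= K1 -> 0 < A ->
  (forall n N, rsum (count_term lam mu (K1 * (Cmod (lam n) + A))) N <= eta * (Cmod (lam n) + A)) ->
  exists C2, 0 <= C2 /\ forall n,
    (forall N, rsum (crowd_term lam mu (K1 * (Cmod (lam n) + A)) (Cmod (lam n) + A) n) N
       <= eps * (Cmod (lam n) + A) + C2) /\
    (forall m, m <> n -> INR (mu n) * ln ((Cmod (lam n) + A) / Cmod (lam n - lam m))
       <= eps * (Cmod (lam n) + A) + C2).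
Proof.
  intros Hms Hint He Heta Hee HK HA Hcount.
  destruct (crowding_bound lam mu Hms Hint (eps / 4)) as [C1 HC1]; [lra|].
  destruct Hms as [Hinj [Hnz [_ [Hmono Hmu]]]].
  assert (Hp : forall n, 0 < Cmod (lam n)) by (intro; now apply Cmod_gt_0).
  set (y0 := Cmod (lam O)). assert (Hy0 : 0 < y0) by apply Hp.
  assert (Hy : forall n, y0 <= Cmod (lam n)).
  { induction n as [|n IH]; [unfold y0; lra|]. specialize (Hmono n). lra. }
  (* A bound for X A / |lam_n| = A + A^2 / |lam_n| that is uniform in n, as |lam_n| >= |lam_0|. *)
  set (B := A + A * A / y0).
  assert (HB : 0 <= B) by (unfold B; assert (0 <= A * A / y0) by (apply Rdiv_le_0_compat; nra); lra).
  exists (Rabs C1 + eta * B). split; [pose proof (Rabs_pos C1); nra|]. intro n.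
  pose proof (Rle_abs C1) as HC1a.
  set (y := Cmod (lam n)). assert (Hyn : 0 < y) by apply Hp. pose proof (Hy n) as Hyy. fold y in Hyy.
  set (X := y + A). assert (HX : 0 < X) by (unfold X; lra).
  assert (HXA : X * (A / y) <= B).
  { replace (X * (A / y)) with (A + A * A * / y) by (unfold X; field; lra). unfold B, Rdiv.
    apply Rplus_le_compat_l, Rmult_le_compat_l; [nra|]. apply Rinv_le_contravar; lra. }
  assert (HAy : 0 <= A / y) by (apply Rdiv_le_0_compat; lra).
  assert (Hp2 : forall p, 0 <= p <= eta * X -> p * (2 + A / y) <= eps / 4 * X + eta * B).
  { intros p Hpp. apply Rle_trans with (eta * X * (2 + A / y)); [apply Rmult_le_compat_r; lra|].
    replace (eta * X * (2 + A / y)) with (2 * eta * X + eta * (X * (A / y))) by ring.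
    apply Rplus_le_compat; [nra|]. apply Rmult_le_compat_l; lra. }
  assert (HD : forall m, m <> n -> 0 < Cmod (lam n - lam m)).
  { intros m Hm. apply Cmod_gt_0, Csub_neq0, Hinj. auto. }
  specialize (Hcount n). fold y in Hcount. fold X in Hcount.
  assert (Hcp : forall m, 0 <= count_term lam mu (K1 * X) m).
  { intro m. unfold count_term. destruct (Rle_dec _ _); [apply pos_INR|lra]. }
  split.
  - intro N.
    apply Rle_trans with (crowding lam mu n N + rsum (fun m => (2 + A / y) * count_term lam mu (K1 * X) m) N).
    + unfold crowding. rewrite <- rsum_plus. apply rsum_le. intros m _. unfold crowd_term.
      pose proof (crowding_term_nonneg lam mu n m Hinj) as CT. specialize (Hcp m).
      destruct (Nat.eq_dec m n) as [E|E]; [nra|].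
      specialize (HD m E). set (D := Cmod (lam n - lam m)) in *.
      assert (ED : Cmod (lam m - lam n) = D) by apply Cmod_minus_sym.
      rewrite ED in *. fold y in CT |- *.
      destruct (Rle_dec D (y / 2)) as [L|L].
      * assert (Hle : Cmod (lam m) <= K1 * X).
        { pose proof (Cmod_triangle (lam m - lam n) (lam n)) as T.
          replace (lam m - lam n + lam n)%C with (lam m) in T by ring. rewrite ED in T. fold y in T.
          assert (2 * y <= K1 * X) by (apply Rmult_le_compat; unfold X; lra). lra. }
        assert (E1 : near_mult lam mu n m = mu m).
        { unfold near_mult. destruct (Nat.eq_dec m n); [tauto|]. rewrite ED. fold y.
          destruct (Rle_dec D (y / 2)); [reflexivity|tauto]. }
        assert (E2 : count_term lam mu (K1 * X) m = INR (mu m)).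
        { unfold count_term. destruct (Rle_dec _ _); [reflexivity|tauto]. }
        rewrite E1 in *. rewrite E2.
        assert (L1 : 0 <= ln (y / 2 / D)).
        { apply ln_nonneg. apply (Rmult_le_reg_r D); [exact HD|]. unfold Rdiv at 1.
          rewrite Rmult_assoc, Rinv_l; lra. }
        assert (L2 : ln (X / D) = ln (y / 2 / D) + ln (2 * X / y)).
        { rewrite <- ln_mult; [f_equal; field; lra| |]; repeat apply Rdiv_lt_0_compat; lra. }
        assert (L3 : ln (2 * X / y) <= 2 + A / y).
        { apply ln_ratio_bound; try lra; [apply Rdiv_lt_0_compat; lra|]. fold X. unfold Rdiv.
          apply Rmult_le_compat_r; [apply Rlt_le, Rinv_0_lt_compat; lra|lra]. }
        assert (Rmax 0 (ln (X / D)) <= ln (y / 2 / D) + (2 + A / y)) by (apply Rmax_lub; lra).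
        pose proof (pos_INR (mu m)). nra.
      * assert (L3 : ln (X / D) <= 2 + A / y).
        { apply ln_ratio_bound; try lra; [apply Rdiv_lt_0_compat; lra|]. fold X.
          apply (Rmult_le_reg_r (D * y)); [nra|].
          replace (X / D * (D * y)) with (X * y) by (field; lra).
          replace (3 * X / y * (D * y)) with (3 * X * D) by (field; lra). nra. }
        assert (Rmax 0 (ln (X / D)) <= 2 + A / y) by (apply Rmax_lub; lra). nra.
    + rewrite rsum_scal. specialize (HC1 n N). fold y in HC1.
      assert (Hs : 0 <= rsum (count_term lam mu (K1 * X)) N <= eta * X)
        by (split; [apply rsum_nonneg; auto|apply Hcount]).
      specialize (Hp2 _ Hs). assert (y <= X) by (unfold X; lra). nra.
  - intros m Hm. specialize (HD m Hm). set (D := Cmod (lam n - lam m)) in *.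
    assert (Hmun : 0 <= INR (mu n) <= eta * X).
    { split; [apply pos_INR|]. eapply Rle_trans; [|apply (Hcount (S n))].
      replace (INR (mu n)) with (count_term lam mu (K1 * X) n).
      - apply rsum_term_le; [exact Hcp|lia].
      - unfold count_term. destruct (Rle_dec _ _) as [|L]; [reflexivity|].
        exfalso. apply L. fold y.
        assert (1 * y <= K1 * X) by (apply Rmult_le_compat; unfold X; lra). lra. }
    specialize (Hp2 _ Hmun).
    pose proof (Cmod_triangle (lam m - lam n) (lam n)) as T.
    replace (lam m - lam n + lam n)%C with (lam m) in T by ring.
    rewrite (Cmod_minus_sym (lam m)) in T. fold y in T. fold D in T.
    pose proof (Cmod_triangle (lam n - lam m) (lam m)) as T'.
    replace (lam n - lam m + lam m)%C with (lam n) in T' by ring. fold y in T'. fold D in T'.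
    set (z := Cmod (lam m)) in *. assert (Hz : 0 < z) by apply Hp.
    assert (Hyx : y <= X) by (unfold X; lra). pose proof (Rabs_pos C1).
    destruct (Rle_dec D (z / 2)) as [L|L].
    (* The crowding around lam_m contains lam_n with weight mu_n, and its other terms are
       nonnegative. Here |lam_m| <= 2 |lam_n|, so the bound can be restated in terms of X. *)
    + specialize (HC1 m (S n)).
      assert (K : INR (mu n) * ln (z / 2 / D) <= eps / 4 * z + C1).
      { eapply Rle_trans; [|exact HC1]. unfold crowding.
        pose proof (rsum_term_le (fun k => INR (near_mult lam mu m k) * ln (Cmod (lam m) / 2 / Cmod (lam k - lam m)))
                     (S n) n (fun k => crowding_term_nonneg lam mu m k Hinj) ltac:(lia)) as R. cbv beta in R.
        assert (E1 : near_mult lam mu m n = mu n).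
        { unfold near_mult. destruct (Nat.eq_dec n m) as [E|]; [symmetry in E; tauto|]. fold D. fold z.
          destruct (Rle_dec D (z / 2)); [reflexivity|tauto]. }
        rewrite E1 in R. exact R. }
      assert (L2 : ln (X / D) = ln (z / 2 / D) + ln (2 * X / z)).
      { rewrite <- ln_mult; [f_equal; field; lra| |]; repeat apply Rdiv_lt_0_compat; lra. }
      assert (L3 : ln (2 * X / z) <= 2 + A / y).
      { apply ln_ratio_bound; try lra; [apply Rdiv_lt_0_compat; lra|]. fold X.
        apply (Rmult_le_reg_r (z * y)); [nra|].
        replace (2 * X / z * (z * y)) with (2 * X * y) by (field; lra).
        replace (3 * X / y * (z * y)) with (3 * X * z) by (field; lra). nra. }
      rewrite L2. assert (INR (mu n) * ln (2 * X / z) <= INR (mu n) * (2 + A / y)) by (apply Rmult_le_compat_l; lra).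
      nra.
    + assert (L3 : ln (X / D) <= 2 + A / y).
      { apply ln_ratio_bound; try lra; [apply Rdiv_lt_0_compat; lra|]. fold X.
        apply (Rmult_le_reg_r (D * y)); [nra|].
        replace (X / D * (D * y)) with (X * y) by (field; lra).
        replace (3 * X / y * (D * y)) with (3 * X * D) by (field; lra). nra. }
      assert (INR (mu n) * ln (X / D) <= INR (mu n) * (2 + A / y)) by (apply Rmult_le_compat_l; lra).
      nra.
Qed.

Lemma dyadic_near v : 0 < v <= 1 -> exists l : nat, v / 2 <= / 2 ^ l <= v.
Proof.
  intros [Hv Hv1].
  assert (Hex : exists l : nat, / 2 ^ l <= v).
  { destruct (pow_lt_1_zero (/ 2)) with (y := v) as [l Hl]; [rewrite Rabs_pos_eq; lra|exact Hv|].
    exists l. specialize (Hl l (le_n l)). rewrite pow_inv in Hl.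
    pose proof (Rle_abs (/ 2 ^ l)). lra. }
  destruct Hex as [l Hl]. induction l as [|l IH].
  - exists O. simpl in *. lra.
  - destruct (Rle_dec (/ 2 ^ l) v) as [L|L]; [auto|].
    exists (S l). split; [|exact Hl]. simpl. rewrite Rinv_mult. lra.
Qed.

Lemma common_bound (f : nat -> nat) N : exists L, forall m, (m < N)%nat -> (f m <= L)%nat.
Proof.
  induction N as [|N [L IH]]; [exists O; lia|].
  exists (Nat.max L (f N)). intros m Hm.
  destruct (Nat.eq_dec m N) as [->|]; [lia|]. specialize (IH m ltac:(lia)). lia.
Qed.

Lemma INR_pow2 k : INR (2 ^ k) = 2 ^ k.
Proof. rewrite pow_INR. reflexivity. Qed.

Lemma dyadic_step (del : R) l L : (l <= L)%nat -> INR (2 ^ (L - l)) * (del / 2 ^ L) = del * / 2 ^ l.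
Proof.
  intro H. rewrite INR_pow2. replace L with ((L - l) + l)%nat at 2 by lia.
  rewrite pow_add. field. split; apply pow_nonzero; lra.
Qed.

Lemma Rinv_mult_le1 z Z : 0 < Z -> z <= Z -> / Z * z <= 1.
Proof.
  intros HZ H. apply (Rmult_le_reg_l Z); [exact HZ|].
  rewrite <- Rmult_assoc, Rinv_r by lra. lra.
Qed.

(** [C0] is fixed before N and c. The interval has length 2 del: one half carries the interpolation
    nodes, the other is room for the translations of the annihilator. *)
Lemma coefficient_bound lam mu : in_ABC lam mu ->
  forall bet del eps1, 0 < del -> 0 < eps1 ->
  exists C0, 0 < C0 /\ forall (n k N : nat) (c : nat -> nat -> C) (s : R),
    (k < mu n)%nat -> (n < N)%nat ->
    (forall x : R, bet - 2 * del <= x <= bet ->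
       Cmod (csum (fun m => hev (mu m) (c m) x * cexp (x * lam m))%C N) <= s) ->
    Cmod (c n k) <= C0 * exp (eps1 * Cmod (lam n)) * exp (- ((bet - 2 * del) * Re (lam n))) * s.
Proof.
  intros [Hms [Hser [[theta [Hth Harg]] Hint]]] bet del eps1 Hdel Heps1.
  pose proof Hms as [Hinj [Hnz [_ [_ Hmu]]]].
  destruct (sector_re lam theta Hth Hnz Harg) as [kap [Hkap Hsec]].
  assert (Hp : forall n, 0 < Cmod (lam n)) by (intro; now apply Cmod_gt_0).
  (* A far step b >= K2 / |lam_m| then satisfies b Re lam_m >= 3. *)
  set (K2 := 3 / kap).
  assert (HK2 : 3 <= K2).
  { unfold K2. apply (Rmult_le_reg_r kap); [lra|]. unfold Rdiv. rewrite Rmult_assoc, Rinv_l by lra. lra. }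
  (* For |lam_m| > K1 X and b <= 2 K2 / |lam_m| this gives b X <= 1/16, as [far_block_good]
     requires. *)
  set (K1 := 32 * K2).
  (* For |lam_m| <= K1 X a near step b <= K / X gives b (|lam_n| + |lam_m|) <= 1/8. *)
  set (K := / (8 * (1 + K1))).
  assert (HK : 0 < K <= 1).
  { unfold K. split; [apply Rinv_0_lt_compat; unfold K1; lra|].
    rewrite <- Rinv_1. apply Rinv_le_contravar; unfold K1; lra. }
  set (c1 := ln (8 / K)).
  assert (HK8 : 1 <= 8 / K).
  { apply (Rmult_le_reg_r K); [lra|]. unfold Rdiv. rewrite Rmult_assoc, Rinv_l; lra. }
  assert (Hc1 : 0 <= c1) by (apply ln_nonneg; exact HK8).
  set (Y := 1 + Rabs bet + 2 * del).
  assert (HY : 1 <= Y) by (unfold Y; pose proof (Rabs_pos bet); lra).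
  (* The total coefficient of eta X in the final exponent: near costs, far costs, then 3 for the
     energy, 3 from 16 <= exp 3 in t^(mu_n) and 1 for Q / g, and finally the interpolation. *)
  set (Ct := c1 + 128 * K2 + 7 + 4 * Y / del).
  assert (HYd : 0 <= 4 * Y / del) by (apply Rdiv_le_0_compat; lra).
  assert (HCt : 0 <= Ct) by (unfold Ct; lra).
  (* The crowding bound enters twice, through the cost and through t^(mu_n), and so uses half of
     eps1; the other half pays for eta Ct. *)
  set (eps2 := eps1 / 4).
  (* The summands of Z are the reciprocals of the upper bounds required of eta. *)
  set (Z := 1 + 32 / eps1 + 2 * Ct / eps1 + 2 / del + 16 * K2 / del).
  assert (Z1 : 0 <= 32 / eps1) by (apply Rdiv_le_0_compat; lra).
  assert (Z2 : 0 <= 2 * Ct / eps1) by (apply Rdiv_le_0_compat; lra).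
  assert (Z3 : 0 <= 2 / del) by (apply Rdiv_le_0_compat; lra).
  assert (Z4 : 0 <= 16 * K2 / del) by (apply Rdiv_le_0_compat; lra).
  assert (HZ : 0 < Z) by (unfold Z; lra).
  set (eta := / Z).
  assert (Heta : 0 < eta) by now apply Rinv_0_lt_compat.
  assert (He0 : eta <= 1) by (pose proof (Rinv_mult_le1 1 Z HZ ltac:(unfold Z; lra)); fold eta in H; lra).
  assert (He1 : eta <= eps2 / 8).
  { pose proof (Rinv_mult_le1 (32 / eps1) Z HZ ltac:(unfold Z; lra)) as H. fold eta in H.
    unfold eps2. apply (Rmult_le_reg_r (32 / eps1)); [apply Rdiv_lt_0_compat; lra|].
    replace (eps1 / 4 / 8 * (32 / eps1)) with 1 by (field; lra). exact H. }
  assert (He2 : eta * Ct <= eps1 / 2).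
  { pose proof (Rinv_mult_le1 (2 * Ct / eps1) Z HZ ltac:(unfold Z; lra)) as H. fold eta in H.
    replace (eta * Ct) with (eta * (2 * Ct / eps1) * (eps1 / 2)) by (field; lra). nra. }
  assert (He3 : eta <= del / 2).
  { pose proof (Rinv_mult_le1 (2 / del) Z HZ ltac:(unfold Z; lra)) as H. fold eta in H.
    replace eta with (eta * (2 / del) * (del / 2)) by (field; lra). nra. }
  assert (He4 : 8 * K2 * eta <= del / 2).
  { pose proof (Rinv_mult_le1 (16 * K2 / del) Z HZ ltac:(unfold Z; lra)) as H. fold eta in H.
    replace (8 * K2 * eta) with (eta * (16 * K2 / del) * (del / 2)) by (field; lra). nra. }
  assert (HK1 : 96 <= K1) by (unfold K1; lra).
  destruct (counting lam mu Hms Hser (eta / K1)) as [A0 [HA0 Hcnt]].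
  { apply Rdiv_lt_0_compat; lra. }
  assert (Hid : 0 < / del) by now apply Rinv_0_lt_compat.
  (* A0 makes the counting estimate applicable at radius K1 X, and 1 / del ensures X del >= 1, so
     that the targets of [dyadic_near] are at most 1. *)
  set (A := A0 + / del).
  assert (HA : 0 < A) by (unfold A; lra).
  assert (Hcount : forall n N, rsum (count_term lam mu (K1 * (Cmod (lam n) + A))) N <= eta * (Cmod (lam n) + A) /\
                               rsum (tail_term lam mu (K1 * (Cmod (lam n) + A))) N <= eta).
  { intros n N. specialize (Hp n).
    destruct (Hcnt (K1 * (Cmod (lam n) + A))) with (N := N) as [H1 H2].
    { assert (1 * A0 <= K1 * (Cmod (lam n) + A)) by (apply Rmult_le_compat; unfold A; lra). lra. }
    split.
    - replace (eta * (Cmod (lam n) + A)) with (eta / K1 * (K1 * (Cmod (lam n) + A))) by (field; lra). exact H1.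
    - eapply Rle_trans; [exact H2|]. apply (Rmult_le_reg_r K1); [lra|].
      unfold Rdiv. rewrite Rmult_assoc, Rinv_l by lra. nra. }
  destruct (crowding_scaled lam mu eps2 eta K1 A Hms Hint) as [C2 [HC2 Hcrowd]]; try assumption.
  { unfold eps2; lra. } { lra. } { intros n N. apply Hcount. }
  exists (4 * exp (eps1 * A + 2 * C2)). split; [pose proof (exp_pos (eps1 * A + 2 * C2)); lra|].
  intros n k N c s Hk Hn Hsup.
  assert (Hs : 0 <= s).
  { eapply Rle_trans; [|apply (Hsup bet); lra]. apply Cmod_ge_0. }
  destruct (Hcrowd n) as [Hcr1 Hcr2]. specialize (Hcr1 N).
  destruct (Hcount n N) as [Hc2 Htl].
  pose proof (Hp n) as Hyp. set (y := Cmod (lam n)) in *. set (X := y + A) in *.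
  assert (HX : 0 < X) by (unfold X; lra).
  assert (HXd : 1 <= X * del).
  { apply Rle_trans with (/ del * del); [rewrite Rinv_l; lra|].
    apply Rmult_le_compat_r; [lra|unfold X, A; lra]. }
  set (r := K1 * X) in *.
  assert (HrX : X <= r) by (unfold r; nra).
  assert (Hcp : forall m, 0 <= count_term lam mu r m).
  { intro m. unfold count_term. destruct (Rle_dec _ _); [apply pos_INR|lra]. }
  assert (Htp : forall m, 0 <= tail_term lam mu r m).
  { intro m. unfold tail_term. destruct (Rle_dec _ _); [lra|].
    apply Rdiv_le_0_compat; [apply pos_INR|apply Hp]. }
  set (mun := INR (mu n)).
  assert (Hmn1 : 1 <= mun) by (apply (le_INR 1), Hmu).
  assert (Hmn2 : mun <= eta * X).
  { eapply Rle_trans; [|exact Hc2].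
    replace mun with (count_term lam mu r n).
    - apply rsum_term_le; assumption.
    - unfold count_term. destruct (Rle_dec _ _) as [|L]; [reflexivity|].
      exfalso. apply L. fold y. unfold X in HrX. lra. }
  assert (Hmn3 : mun <= X) by nra.
  set (Ex := eps2 * X + C2) in *.
  assert (HEx : 0 <= Ex) by (unfold Ex, eps2; nra).
  (* The second crowding bound reads X <= exp(Ex / mun) |lam_n - lam_m|, and mun <= X, so t meets
     the requirement of [near_block_good] for all m at once, while t^(mu_n) is only 16^(mu_n)
     exp(Ex). *)
  set (t := 16 * exp (Ex / mun)).
  assert (Ht1 : 1 <= exp (Ex / mun)).
  { rewrite <- exp_0. apply exp_le_compat. apply Rdiv_le_0_compat; lra. }
  assert (Ht : 16 <= t) by (unfold t; lra).
  destruct (dyadic_near (K / (X * del))) as [lq [Hln1 Hln2]].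
  { split; [apply Rdiv_lt_0_compat; lra|]. apply (Rmult_le_reg_r (X * del)); [lra|].
    unfold Rdiv. rewrite Rmult_assoc, Rinv_l; lra. }
  assert (Hfar : forall m, exists l : nat, r < Cmod (lam m) ->
     K2 / (Cmod (lam m) * del) <= / 2 ^ l <= 2 * K2 / (Cmod (lam m) * del)).
  { intro m. destruct (Rlt_dec r (Cmod (lam m))) as [L|L]; [|exists O; tauto].
    assert (Hq : 2 * K2 <= Cmod (lam m) * del).
    { apply Rle_trans with (r * del); [|apply Rmult_le_compat_r; lra].
      unfold r, K1. rewrite Rmult_assoc. nra. }
    destruct (dyadic_near (2 * K2 / (Cmod (lam m) * del))) as [l [H1 H2]].
    { split; [apply Rdiv_lt_0_compat; lra|]. apply (Rmult_le_reg_r (Cmod (lam m) * del)); [lra|].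
      unfold Rdiv. rewrite Rmult_assoc, Rinv_l; lra. }
    exists l. intros _. split; [|exact H2]. eapply Rle_trans; [|exact H1]. right. field.
    split; [lra|]. pose proof (Hp m). lra. }
  set (lf := fun m => proj1_sig (constructive_indefinite_description _ (Hfar m))).
  assert (Hlf : forall m, r < Cmod (lam m) ->
     K2 / (Cmod (lam m) * del) <= / 2 ^ (lf m) <= 2 * K2 / (Cmod (lam m) * del)).
  { intro m. unfold lf. destruct (constructive_indefinite_description _ (Hfar m)). assumption. }
  clearbody lf.
  (* del / 2^lp will be the spacing of the interpolation nodes: mu_n of them fit into length del,
     and the spacing is at least del / (2 mu_n). *)
  destruct (dyadic_near (/ mun)) as [lp [Hlp1 Hlp2]].
  { split; [apply Rinv_0_lt_compat; lra|]. rewrite <- Rinv_1. apply Rinv_le_contravar; lra. }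
  destruct (common_bound lf N) as [L0 HL0].
  (* A common refinement: all near and far steps and the node spacing become integer multiples of
     del / 2^L. It depends on N, which is harmless as the estimates are uniform in L. *)
  set (L := (L0 + lq + lp)%nat).
  set (st := del / 2 ^ L).
  assert (H2L : 0 < 2 ^ L) by (apply pow_lt; lra).
  assert (Hst : 0 < st) by (apply Rdiv_lt_0_compat; lra).
  set (sn := (2 ^ (L - lq))%nat). set (sf := fun m => (2 ^ (L - lf m))%nat).
  set (g := (2 ^ (L - lp))%nat).
  assert (Esn : INR sn * st = del * / 2 ^ lq) by (apply dyadic_step; unfold L; lia).
  assert (Esf : forall m, (m < N)%nat -> INR (sf m) * st = del * / 2 ^ lf m).
  { intros m Hm. apply dyadic_step. specialize (HL0 m Hm). unfold L. lia. }
  assert (Eg : INR g * st = del * / 2 ^ lp) by (apply dyadic_step; unfold L; lia).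
  assert (Hb1 : K / (2 * X) <= INR sn * st).
  { rewrite Esn. replace (K / (2 * X)) with (del * (K / (X * del) / 2)) by (field; lra).
    apply Rmult_le_compat_l; lra. }
  assert (Hb2 : INR sn * st <= K / X).
  { rewrite Esn. replace (K / X) with (del * (K / (X * del))) by (field; lra).
    apply Rmult_le_compat_l; lra. }
  assert (Hb0 : 0 < INR sn * st) by (eapply Rlt_le_trans; [|exact Hb1]; apply Rdiv_lt_0_compat; lra).
  assert (Hf1 : forall m, (m < N)%nat -> r < Cmod (lam m) ->
     K2 / Cmod (lam m) <= INR (sf m) * st <= 2 * K2 / Cmod (lam m)).
  { intros m Hm Hr. pose proof (Hp m). destruct (Hlf m Hr) as [H1 H2]. rewrite (Esf m Hm).
    replace (K2 / Cmod (lam m)) with (del * (K2 / (Cmod (lam m) * del))) by (field; lra).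
    replace (2 * K2 / Cmod (lam m)) with (del * (2 * K2 / (Cmod (lam m) * del))) by (field; lra).
    split; apply Rmult_le_compat_l; lra. }
  set (blk := fun m => if Rle_dec (Cmod (lam m)) r then near_block (cexp ((INR sn * st)%R * lam m)) sn
                       else far_block (cexp ((INR (sf m) * st)%R * lam m)) (sf m)).
  set (cost := fun m => if Rle_dec (Cmod (lam m)) r then ln (4 / (INR sn * st * Cmod (lam n - lam m)))
                        else 64 * (2 * K2 * X / Cmod (lam m))).
  set (kcost := fun m => if Rle_dec (Cmod (lam m)) r then 3 else 0).
  set (w := fun m => if Rle_dec (Cmod (lam m)) r then INR sn * st else 4 * (INR (sf m) * st)).
  assert (Hgood : forall m, (m < N)%nat -> m <> n ->
     good_block st (lam m) (lam n) (mu n) t (cost m) (kcost m) (w m) (blk m)).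
  { intros m Hm Hmn. unfold cost, kcost, w, blk. pose proof (Hp m) as Hpm.
    assert (Hrem : kap * Cmod (lam m) <= Re (lam m)) by apply Hsec.
    destruct (Rle_dec (Cmod (lam m)) r) as [Hnear|Hfarm].
    - assert (HD : 0 < Cmod (lam n - lam m)) by (apply Cmod_gt_0, Csub_neq0, Hinj; auto).
      apply near_block_good; [exact Hb0|lra| |nra|apply Hinj; auto|].
      + fold y. apply Rle_trans with (K / X * (X + r)).
        * apply Rmult_le_compat; try lra. unfold X; lra.
        * right. unfold r, K. field. unfold K1. lra.
      + set (D := Cmod (lam n - lam m)) in *.
        assert (X / D <= exp (Ex / mun)).
        { rewrite <- (exp_ln (X / D)) by (apply Rdiv_lt_0_compat; lra). apply exp_le_compat.
          apply (Rmult_le_reg_l mun); [lra|].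
          replace (mun * (Ex / mun)) with Ex by (field; lra). apply (Hcr2 m Hmn). }
        assert (X <= exp (Ex / mun) * D).
        { replace X with (X / D * D) by (field; lra). apply Rmult_le_compat_r; lra. }
        fold mun. unfold t. lra.
    - apply Rnot_le_lt in Hfarm. destruct (Hf1 m Hm Hfarm) as [F1 F2].
      assert (Hqm : 0 < K2 / Cmod (lam m)) by (apply Rdiv_lt_0_compat; lra).
      assert (Hy16 : 2 * K2 * X / Cmod (lam m) <= 1 / 16).
      { apply (Rmult_le_reg_r (Cmod (lam m))); [exact Hpm|].
        unfold Rdiv at 1. rewrite Rmult_assoc, Rinv_l, Rmult_1_r by lra. unfold r, K1 in Hfarm. lra. }
      assert (HbX : INR (sf m) * st * X <= 2 * K2 * X / Cmod (lam m)).
      { replace (2 * K2 * X / Cmod (lam m)) with (2 * K2 / Cmod (lam m) * X) by (field; lra).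
        apply Rmult_le_compat_r; lra. }
      assert (Hb : 0 < INR (sf m) * st) by lra.
      apply far_block_good; [exact Hb|lra| | | |].
      + apply Rle_trans with (K2 / Cmod (lam m) * (kap * Cmod (lam m))).
        * right. unfold K2. field. lra.
        * apply Rmult_le_compat; nra.
      + split; [apply Rlt_le, Rdiv_lt_0_compat; nra|exact Hy16].
      + eapply Rle_trans; [|exact HbX]. apply Rmult_le_compat_l; [lra|]. fold y. unfold X; lra.
      + eapply Rle_trans; [|exact HbX]. fold mun. unfold Rdiv.
        assert (/ t <= 1) by (rewrite <- Rinv_1; apply Rinv_le_contravar; lra).
        assert (0 < / t) by (apply Rinv_0_lt_compat; lra).
        replace (mun * (INR (sf m) * st * / t)) with (INR (sf m) * st * (mun * / t)) by ring.
        apply Rmult_le_compat_l; [lra|]. nra. }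
  assert (Hkc0 : forall m, 0 <= kcost m) by (intro m; unfold kcost; destruct (Rle_dec _ _); lra).
  assert (Hren : 0 <= Re (lam n)) by (pose proof (Hsec n); fold y in H; nra).
  set (x0 := bet - 2 * del).
  assert (Hoff : forall f m, off n mu f m = (if Nat.eq_dec m n then 0 else INR (mu m) * f m)) by reflexivity.
  (* Near translations sum to at most K eta, far ones to at most 8 K2 eta. Each is at most del / 2,
     so together they fit into 2^L lattice steps. *)
  assert (HW : rsum (off n mu w) N <= INR (2 ^ L) * st).
  { rewrite INR_pow2. replace (2 ^ L * st) with del by (unfold st; field; lra).
    apply Rle_trans with (rsum (fun m => K / X * count_term lam mu r m + 8 * K2 * tail_term lam mu r m) N).
    - apply rsum_le. intros m Hm. rewrite Hoff. specialize (Hcp m). specialize (Htp m).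
      assert (HKX : 0 < K / X) by (apply Rdiv_lt_0_compat; lra).
      destruct (Nat.eq_dec m n); [nra|]. unfold w, count_term, tail_term in *.
      pose proof (pos_INR (mu m)). pose proof (Hp m).
      destruct (Rle_dec (Cmod (lam m)) r) as [Q|Q].
      + rewrite Rmult_0_r, Rplus_0_r, Rmult_comm. apply Rmult_le_compat_r; lra.
      + apply Rnot_le_lt in Q. destruct (Hf1 m Hm Q) as [_ F2].
        rewrite Rmult_0_r, Rplus_0_l.
        replace (8 * K2 * (INR (mu m) / Cmod (lam m))) with (INR (mu m) * (4 * (2 * K2 / Cmod (lam m)))) by (field; lra).
        apply Rmult_le_compat_l; lra.
    - rewrite rsum_plus, !rsum_scal.
      assert (K / X * rsum (count_term lam mu r) N <= K / X * (eta * X)).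
      { apply Rmult_le_compat_l; [apply Rlt_le, Rdiv_lt_0_compat; lra|exact Hc2]. }
      replace (K / X * (eta * X)) with (K * eta) in H by (field; lra).
      assert (8 * K2 * rsum (tail_term lam mu r) N <= 8 * K2 * eta) by (apply Rmult_le_compat_l; lra).
      nra. }
  assert (Hg0 : (0 < g)%nat) by (unfold g; pose proof (Nat.pow_nonzero 2 (L - lp)); lia).
  assert (Hmlp : (mu n <= 2 ^ lp)%nat).
  { apply INR_le. rewrite INR_pow2. fold mun. rewrite <- (Rinv_inv mun), <- (Rinv_inv (2 ^ lp)).
    apply Rinv_le_contravar; [apply Rinv_0_lt_compat, pow_lt; lra|exact Hlp2]. }
  assert (HgQ : (g * mu n + 2 ^ L <= 2 * 2 ^ L)%nat).
  { assert (g * mu n <= 2 ^ L)%nat; [|lia].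
    replace (2 ^ L)%nat with (g * 2 ^ lp)%nat.
    - now apply Nat.mul_le_mono_l.
    - unfold g. rewrite <- Nat.pow_add_r. f_equal. unfold L. lia. }
  assert (Hrange : forall q, (q < 2 * 2 ^ L)%nat -> x0 <= x0 + INR q * st <= bet).
  { intros q Hq. apply lt_INR in Hq. rewrite mult_INR, INR_pow2 in Hq. simpl INR in Hq.
    pose proof (pos_INR q).
    assert (INR q * st <= 2 * 2 ^ L * st) by (apply Rmult_le_compat_r; lra).
    replace (2 * 2 ^ L * st) with (2 * del) in H0 by (unfold st; field; lra).
    unfold x0. split; [nra|lra]. }
  pose proof (coefficient_estimate lam mu blk n N st t cost kcost w c x0 s Y (2 * 2 ^ L) (2 ^ L) g k
    ltac:(lra) Hst Hn Hk Hgood Hkc0 Hren Hs HW Hg0 HgQ) as Main.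
  assert (HYq : forall q, (q < 2 * 2 ^ L)%nat -> 1 + Rabs (x0 + INR q * st) <= Y).
  { intros q Hq. specialize (Hrange q Hq). unfold Y, x0 in *.
    assert (Rabs (bet - 2 * del + INR q * st) <= Rabs bet + 2 * del); [|lra].
    pose proof (Rle_abs bet). pose proof (Rle_abs (- bet)). rewrite Rabs_Ropp in *.
    apply Rabs_le. lra. }
  specialize (Main HYq (fun q Hq => Hsup _ (Hrange q Hq))).
  eapply Rle_trans; [exact Main|].
  set (S1 := rsum (off n mu cost) N). set (S2 := rsum (off n mu kcost) N).
  assert (HS1 : S1 <= c1 * (eta * X) + Ex + 128 * K2 * X * eta).
  { apply Rle_trans with (rsum (fun m => c1 * count_term lam mu r m + crowd_term lam mu r X n m
        + 128 * K2 * X * tail_term lam mu r m) N).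
    - apply rsum_le. intros m Hm. rewrite Hoff. specialize (Hcp m). specialize (Htp m).
      unfold crowd_term. assert (HKX : 0 < 128 * K2 * X) by nra.
      destruct (Nat.eq_dec m n) as [|Hmn]; [nra|]. unfold cost, count_term, tail_term in *.
      pose proof (pos_INR (mu m)). pose proof (Hp m).
      destruct (Rle_dec (Cmod (lam m)) r) as [Q|Q].
      + assert (HD : 0 < Cmod (lam n - lam m)) by (apply Cmod_gt_0, Csub_neq0, Hinj; auto).
        set (D := Cmod (lam n - lam m)) in *.
        assert (ln (4 / (INR sn * st * D)) <= c1 + Rmax 0 (ln (X / D))).
        { apply Rle_trans with (c1 + ln (X / D)); [|pose proof (Rmax_r 0 (ln (X / D))); lra].
          unfold c1. rewrite <- ln_mult; [|lra|apply Rdiv_lt_0_compat; lra].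
          apply ln_le; [apply Rdiv_lt_0_compat; nra|].
          apply (Rmult_le_reg_r (INR sn * st * D)); [nra|].
          replace (4 / (INR sn * st * D) * (INR sn * st * D)) with 4 by (field; nra).
          replace (8 / K * (X / D) * (INR sn * st * D)) with (8 * X / K * (INR sn * st)) by (field; lra).
          apply Rle_trans with (8 * X / K * (K / (2 * X))); [right; field; lra|].
          apply Rmult_le_compat_l; [apply Rlt_le, Rdiv_lt_0_compat; lra|exact Hb1]. }
        nra.
      + right. field. lra.
    - rewrite !rsum_plus, !rsum_scal.
      assert (c1 * rsum (count_term lam mu r) N <= c1 * (eta * X)) by (apply Rmult_le_compat_l; lra).
      assert (128 * K2 * X * rsum (tail_term lam mu r) N <= 128 * K2 * X * eta) by (apply Rmult_le_compat_l; nra).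
      lra. }
  assert (HS2 : S2 <= 3 * (eta * X)).
  { apply Rle_trans with (rsum (fun m => 3 * count_term lam mu r m) N).
    - apply rsum_le. intros m _. rewrite Hoff. specialize (Hcp m).
      destruct (Nat.eq_dec m n); [nra|]. unfold kcost, count_term in *.
      destruct (Rle_dec (Cmod (lam m)) r); lra.
    - rewrite rsum_scal. lra. }
  assert (Htmu : t ^ mu n <= exp (3 * mun + Ex)).
  { rewrite exp_plus. unfold t. rewrite Rpow_mult_distr.
    assert (T1 : exp (Ex / mun) ^ mu n = exp Ex).
    { rewrite <- exp_nat_ln, ln_exp by apply exp_pos. f_equal. fold mun. field. lra. }
    rewrite T1. apply Rmult_le_compat_r; [apply Rlt_le, exp_pos|].
    rewrite Rmult_comm. unfold mun. rewrite <- (ln_exp 3), exp_nat_ln by apply exp_pos.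
    apply pow_incr. split; [lra|].
    apply Rle_trans with (sum_f_R0 (fun i => 3 ^ i / INR (fact i)) 5); [simpl; lra|].
    apply exp_ge_taylor. lra. }
  assert (HQg : INR (2 * 2 ^ L) / INR g <= 4 * exp mun).
  { assert (Hg' : 0 < INR g) by now apply lt_0_INR.
    replace (INR (2 * 2 ^ L) / INR g) with (2 * 2 ^ lp).
    - assert (2 ^ lp <= 2 * mun).
      { rewrite <- (Rinv_inv (2 ^ lp)), <- (Rinv_inv (2 * mun)).
        apply Rinv_le_contravar; [apply Rinv_0_lt_compat; lra|]. rewrite Rinv_mult.
        unfold Rdiv in Hlp1. lra. }
      pose proof (exp_lower mun). lra.
    - assert (EQ : INR (2 * 2 ^ L) = 2 * 2 ^ lp * INR g).
      { rewrite mult_INR. unfold g. rewrite !INR_pow2.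
        replace (2 ^ L) with (2 ^ ((L - lp) + lp)) by (f_equal; unfold L; lia).
        rewrite pow_add. simpl INR. ring. }
      rewrite EQ. field. lra. }
  assert (HYg : 2 * Y / (INR g * st) <= 4 * Y / del * mun).
  { rewrite Eg.
    assert (P2 : 0 < / 2 ^ lp) by (apply Rinv_0_lt_compat, pow_lt; lra).
    set (p2 := / 2 ^ lp) in *.
    apply (Rmult_le_reg_r (del * p2)); [nra|].
    replace (2 * Y / (del * p2) * (del * p2)) with (2 * Y) by (field; lra).
    replace (4 * Y / del * mun * (del * p2)) with (4 * Y * mun * p2) by (field; lra).
    apply Rle_trans with (4 * Y * mun * (/ mun / 2)); [right; field; lra|].
    apply Rmult_le_compat_l; [nra|exact Hlp1]. }
  set (E0 := exp (- (x0 * Re (lam n)))).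
  assert (HE0 : 0 < E0) by apply exp_pos.
  set (T1 := exp S1) in *. set (T2 := t ^ mu n) in *. set (T3 := exp S2) in *.
  set (T4 := INR (2 * 2 ^ L) / INR g) in *. set (T5 := exp (2 * Y / (INR g * st))) in *.
  assert (P1 : T1 <= exp (c1 * (eta * X) + Ex + 128 * K2 * X * eta)) by now apply exp_le_compat.
  assert (P3 : T3 <= exp (3 * (eta * X))) by now apply exp_le_compat.
  assert (P5 : T5 <= exp (4 * Y / del * mun)) by now apply exp_le_compat.
  assert (N1 : 0 <= T1) by apply Rlt_le, exp_pos. assert (N3 : 0 <= T3) by apply Rlt_le, exp_pos.
  assert (N5 : 0 <= T5) by apply Rlt_le, exp_pos. assert (N2 : 0 <= T2) by (apply pow_le; lra).
  assert (N4 : 0 <= T4).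
  { apply Rdiv_le_0_compat; [apply pos_INR|now apply lt_0_INR]. }
  clear Main. clearbody T1 T2 T3 T4 T5.
  (* The logarithm of the product of all five losses, apart from the factor 4 that comes from Q /
     g. *)
  set (Tot := (c1 * (eta * X) + Ex + 128 * K2 * X * eta) + (3 * mun + Ex) + 3 * (eta * X) + mun + 4 * Y / del * mun).
  assert (HTot : T1 * T2 * T3 * T4 * T5 <= 4 * exp Tot).
  { unfold Tot. rewrite !exp_plus.
    rewrite exp_plus in P1. rewrite exp_plus in P1. rewrite exp_plus in Htmu.
    match goal with |- _ <= 4 * (?a * ?b * ?c * ?d * ?e) =>
      replace (4 * (a * b * c * d * e)) with (a * b * c * (4 * d) * e) by ring end.
    repeat (apply Rmult_le_compat; [repeat apply Rmult_le_pos; assumption|assumption| |assumption]).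
    exact P1. }
  assert (HTot2 : Tot <= eps1 * X + 2 * C2).
  { assert (Hm4 : (4 + 4 * Y / del) * mun <= (4 + 4 * Y / del) * (eta * X)) by (apply Rmult_le_compat_l; lra).
    assert (Hct : eta * Ct * X <= eps1 / 2 * X) by (apply Rmult_le_compat_r; lra).
    unfold Tot, Ex, eps2. unfold Ct in Hct. nra. }
  replace (T1 * (T2 * (s * E0 * (T3 * T4) * T5))) with (T1 * T2 * T3 * T4 * T5 * (E0 * s)) by ring.
  replace (4 * exp (eps1 * A + 2 * C2) * exp (eps1 * y) * E0 * s)
    with (4 * exp (eps1 * X + 2 * C2) * (E0 * s)).
  2:{ replace (eps1 * X + 2 * C2) with ((eps1 * A + 2 * C2) + eps1 * y) by (unfold X; ring).
      rewrite exp_plus. ring. }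
  apply Rmult_le_compat_r; [nra|]. eapply Rle_trans; [exact HTot|].
  apply Rmult_le_compat_l; [lra|]. now apply exp_le_compat.
Qed.

(** * The distance estimate *)

Lemma sum_n_csum (F : nat -> C) N : sum_n F N = csum F (S N).
Proof.
  induction N as [|N IH]; [rewrite sum_O; simpl; ring|]. rewrite sum_Sn, IH. reflexivity.
Qed.

Lemma hev_csum d : forall a x z,
  (hev d a x * z)%C = csum (fun j => a j * (RtoC (x ^ j) * z))%C d.
Proof.
  induction d as [|d IH]; intros a x z; [simpl; ring|].
  rewrite csum_Sl. simpl hev. simpl pow at 1.
  replace ((a O + x * hev d (fun i => a (S i)) x) * z)%C
    with (a O * (1 * z) + x * (hev d (fun i => a (S i)) x * z))%C by ring.
  rewrite IH, <- csum_scal. f_equal. apply csum_ext. intros i _. simpl pow. rewrite RtoC_mult. ring.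
Qed.

Lemma csum_trunc (f : nat -> C) M N : (M <= N)%nat ->
  csum (fun m => if lt_dec m M then f m else 0%C) N = csum f M.
Proof.
  intro L. induction L as [|N L IH].
  - apply csum_ext. intros i Hi. destruct (lt_dec i M); [reflexivity|lia].
  - simpl. rewrite IH. destruct (lt_dec N M); [lia|ring].
Qed.

Lemma csum_plus f g n : csum (fun i => f i + g i)%C n = (csum f n + csum g n)%C.
Proof. induction n as [|n IH]; simpl; [ring|]. rewrite IH. ring. Qed.

(** The span element has no (n, k) term, so the difference is a finite exponential sum whose (n, k)
    coefficient is exactly 1. The range is enlarged to contain n and padded with zeros. *)
Lemma span_complement lam mu n k h : (forall m, (1 <= mu m)%nat) -> (k < mu n)%nat -> in_span_without lam mu n k h ->
  exists N (c : nat -> nat -> C), (n < N)%nat /\ c n k = 1%C /\ forall x : R,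
    (e_fun lam n k x - h x)%C = csum (fun m => hev (mu m) (c m) x * cexp (x * lam m))%C N.
Proof.
  intros Hmu Hk [N [c [Hc0 Hh]]].
  set (c' := fun m j => ((if lt_dec m (S N) then - c m j else 0)
     + (if Nat.eq_dec m n then if Nat.eq_dec j k then 1 else 0 else 0))%C).
  exists (S (Nat.max N n)), c'. split; [lia|]. split.
  { unfold c'. destruct (Nat.eq_dec n n); [|tauto]. destruct (Nat.eq_dec k k); [|tauto].
    rewrite Hc0. destruct (lt_dec n (S N)); ring. }
  intro x. rewrite Hh, sum_n_csum.
  rewrite (csum_ext _ (fun m => csum (fun j => c m j * e_fun lam m j x)%C (S (pred (mu m)))))
    by (intros; apply sum_n_csum).
  rewrite (csum_ext (fun m => hev (mu m) (c' m) x * cexp (x * lam m))%C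
    (fun m => (if lt_dec m (S N) then (fun m => - (1) * csum (fun j => c m j * e_fun lam m j x) (S (pred (mu m))))%C m else 0)
       + (if Nat.eq_dec m n then e_fun lam n k x else 0))%C).
  - rewrite csum_plus, csum_trunc by lia. rewrite csum_scal.
    rewrite (csum_single (fun m => if Nat.eq_dec m n then e_fun lam n k x else RtoC 0) n); [|lia|].
    2:{ intros m _ Hm. destruct (Nat.eq_dec m n); [tauto|reflexivity]. }
    destruct (Nat.eq_dec n n); [|tauto]. ring.
  - intros m _. rewrite hev_csum. fold (RtoC x).
    change (fun j => c' m j * (RtoC (x ^ j) * cexp (x * lam m)))%C with (fun j => c' m j * e_fun lam m j x)%C.
    rewrite (csum_ext _ (fun j => (if lt_dec m (S N) then - c m j else 0) * e_fun lam m j x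
      + (if Nat.eq_dec m n then if Nat.eq_dec j k then 1 else 0 else 0) * e_fun lam m j x)%C)
      by (intros; unfold c'; ring).
    rewrite csum_plus. f_equal.
    + destruct (lt_dec m (S N)) as [L|L].
      * rewrite <- csum_scal. replace (S (pred (mu m))) with (mu m) by (specialize (Hmu m); lia).
        apply csum_ext. intros j _. ring.
      * apply csum_0. intros; ring.
    + destruct (Nat.eq_dec m n) as [->|E].
      * rewrite (csum_single _ k (mu n) Hk).
        -- destruct (Nat.eq_dec k k); [ring|tauto].
        -- intros j _ Hj. destruct (Nat.eq_dec j k); [tauto|ring].
      * apply csum_0. intros; ring.
Qed.

Lemma supnorm_ge gam bet f x : gam <= x <= bet -> Rbar_le (Cmod (f x)) (supnorm gam bet f).
Proof.
  intro Hx. unfold supnorm.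
  destruct (Lub_Rbar_correct (fun r => exists x, gam <= x <= bet /\ r = Cmod (f x))) as [H _].
  apply H. now exists x.
Qed.

Theorem theorem10p1 (lam : nat -> C) (mu : nat -> nat) :
  in_ABC lam mu ->
  forall gam bet : R, gam < bet ->
  forall eps : R, 0 < eps ->
  exists u : R, 0 < u /\
    forall n k : nat, (k < mu n)%nat ->
      Rbar_le (Finite (u * exp ((bet - eps) * Re (lam n)))) (D_dist gam bet lam mu n k).
Proof.
  intros HABC gam bet Hgb eps Heps.
  pose proof HABC as [[_ [Hnz [_ [_ Hmu]]]] [_ [[theta [Hth Harg]] _]]].
  destruct (sector_re lam theta Hth Hnz Harg) as [kap [Hkap Hsec]].
  (* The first bound puts [bet - 2 del, bet] inside [gam, bet]. The second spends half of eps on the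
     endpoint; the other half absorbs eps1 |lam_n| <= (eps / 2) Re lam_n. *)
  set (del := Rmin ((bet - gam) / 2) (eps / 4)).
  assert (Hdel : 0 < del) by (apply Rmin_glb_lt; lra).
  assert (Hdel1 : del <= (bet - gam) / 2) by apply Rmin_l.
  assert (Hdel2 : del <= eps / 4) by apply Rmin_r.
  set (eps1 := kap * eps / 2).
  assert (Heps1 : 0 < eps1) by (unfold eps1; nra).
  destruct (coefficient_bound lam mu HABC bet del eps1 Hdel Heps1) as [C0 [HC0 Hbound]].
  exists (/ C0). split; [now apply Rinv_0_lt_compat|].
  intros n k Hk. unfold D_dist.
  match goal with |- Rbar_le _ (Glb_Rbar ?E) => destruct (Glb_Rbar_correct E) as [_ Hglb] end.
  apply Hglb. intros r [g [Hg Hr]]. simpl.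
  (* An element of the closed span is replaced by a finite sum at distance less than d. The bound
     does not depend on this sum, so d may tend to 0. *)
  apply le_epsilon. intros d Hd.
  destruct (Hg d Hd) as [h [Hh Hgh]].
  destruct (span_complement lam mu n k h Hmu Hk Hh) as [N [c [HnN [Hck Hsum]]]].
  specialize (Hbound n k N c (r + d) Hk HnN). rewrite Hck, Cmod_1 in Hbound.
  assert (H1 : 1 <= C0 * exp (eps1 * Cmod (lam n)) * exp (- ((bet - 2 * del) * Re (lam n))) * (r + d)).
  { apply Hbound. intros x Hx. rewrite <- Hsum.
    assert (Hxg : gam <= x <= bet) by lra.
    pose proof (supnorm_ge gam bet (fun x => e_fun lam n k x - g x)%C x Hxg) as S1.
    rewrite Hr in S1. simpl in S1.
    pose proof (supnorm_ge gam bet (fun x => g x - h x)%C x Hxg) as S2.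
    pose proof (Rbar_le_lt_trans _ _ _ S2 Hgh) as S3. simpl in S3.
    eapply Rle_trans; [apply (Cmod_triangle3 _ (g x))|]. lra. }
  pose proof (Hsec n) as Hre. pose proof (Cmod_ge_0 (lam n)) as Hy.
  assert (Hrd : 0 < r + d).
  { apply Rnot_le_lt. intro Q.
    pose proof (exp_pos (eps1 * Cmod (lam n))). pose proof (exp_pos (- ((bet - 2 * del) * Re (lam n)))).
    assert (0 < C0 * exp (eps1 * Cmod (lam n)) * exp (- ((bet - 2 * del) * Re (lam n))))
      by (repeat apply Rmult_lt_0_compat; assumption).
    nra. }
  assert (Hexp : exp ((bet - eps) * Re (lam n)) * (exp (eps1 * Cmod (lam n)) * exp (- ((bet - 2 * del) * Re (lam n)))) <= 1).
  { rewrite <- !exp_plus, <- exp_0. apply exp_le_compat. unfold eps1.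
    assert (0 <= kap * Cmod (lam n)) by (apply Rmult_le_pos; lra).
    assert (del * Re (lam n) <= eps / 4 * Re (lam n)) by (apply Rmult_le_compat_r; lra).
    assert (eps / 2 * (kap * Cmod (lam n)) <= eps / 2 * Re (lam n)) by (apply Rmult_le_compat_l; lra).
    lra. }
  apply (Rmult_le_reg_l C0); [exact HC0|]. rewrite <- Rmult_assoc, Rinv_r, Rmult_1_l by lra.
  set (E := exp ((bet - eps) * Re (lam n))) in *.
  set (F := exp (eps1 * Cmod (lam n)) * exp (- ((bet - 2 * del) * Re (lam n)))) in *.
  assert (HE : 0 < E) by apply exp_pos.
  replace (C0 * exp (eps1 * Cmod (lam n)) * exp (- ((bet - 2 * del) * Re (lam n))) * (r + d))
    with (C0 * (r + d) * F) in H1 by (unfold F; ring).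
  assert (0 < C0 * (r + d)) by nra.
  apply Rle_trans with (E * (C0 * (r + d) * F)).
  - rewrite <- (Rmult_1_r E) at 1. apply Rmult_le_compat_l; lra.
  - replace (E * (C0 * (r + d) * F)) with (C0 * (r + d) * (E * F)) by ring.
    rewrite <- (Rmult_1_r (C0 * (r + d))) at 2. apply Rmult_le_compat_l; lra.
Qed.
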